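(* Let $\theta$ and $\mathfrak g$ be vector bundles over a manifold $M$ and $\phi:\theta\to\mathfrak g$ a bundle map, and put $\phi^{T}:=-\phi^*:\mathfrak g^*\to\theta^*$. Suppose that $(\theta\stackrel{\phi}{\rightharpoonup}\mathfrak g)$ and $(\mathfrak g^*\stackrel{\phi^{T}}{\rightharpoonup}\theta^* )$ are both Lie algebroid crossed modules. Then they form a Lie bialgebroid crossed module if and only if the pair of Lie algebroids $(\mathfrak g,\theta^* )$ is a matched pair of Lie algebroids, where the $\mathfrak g$-action on $\theta^*$ is the dual of the given $\mathfrak g$-action on $\theta$, and the $\theta^*$-action on $\mathfrak g$ is the dual of the given $\theta^*$-action on $\mathfrak g^*$.
   Context: All vector bundles are real, smooth, of finite rank over a manifold $M$; bundle maps cover the identity. For a Lie algebroid $A$ the anchor is $\rho_A:A\to TM$ and the bracket on $\Gamma(A)$ is $[\cdot,\cdot]$. Representation: a representation $\triangleright$ of a Lie algebroid $A$ on a vector bundle $E$ is an $\mathbb R$-bilinear map $\Gamma(A)\times\Gamma(E)\to\Gamma(E)$, $(x,e)\mapsto x\triangleright e$, with $(fx)\triangleright e=f(x\triangleright e)$, $x\triangleright(fe)=f(x\triangleright e)+(\rho_A(x)f)e$ and $[x,y]\triangleright e=x\triangleright(y\triangleright e)-y\triangleright(x\triangleright e)$. The dual action on $E^*$ is given by $\langle x\triangleright\varepsilon\,|\,e\rangle=\rho_A(x)\langle\varepsilon\,|\,e\rangle-\langle\varepsilon\,|\,x\triangleright e\rangle$. Lie algebroid crossed module: $(\theta\stackrel{\phi}{\rightharpoonup}\mathfrak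 g)$ consists of a Lie algebra bundle $\theta$ over $M$ (a vector bundle with a smoothly varying Lie bracket on the fibres, viewed as a Lie algebroid with zero anchor), a Lie algebroid $\mathfrak g$ over $M$, a Lie algebroid morphism $\phi:\theta\to\mathfrak g$, and a representation $\triangleright$ of $\mathfrak g$ on $\theta$, such that $\phi(u)\triangleright v=[u,v]$ and $\phi(x\triangleright u)=[x,\phi(u)]$ for all $u,v\in\Gamma(\theta)$, $x\in\Gamma(\mathfrak g)$. Associated Lie algebroid: $A_{\mathfrak g\triangleright\theta}$ is the vector bundle $\mathfrak g\oplus\theta$ with anchor $\rho_{\mathfrak g}$ on $\mathfrak g$ and $0$ on $\theta$, and with the Lie bracket for which $\mathfrak g$ and $\theta$ are Lie subalgebroids and $[x,u]=x\triangleright u$ for $x\in\Gamma(\mathfrak g)$, $u\in\Gamma(\theta)$. Similarly $A_{\theta^*\triangleright\mathfrak g^*}=\theta^*\oplus\mathfrak g^*$ is built from $(\mathfrak g^*\stackrel{\phi^T}{\rightharpoonup}\theta^* )$; it is the dual vector bundle of $A_{\mathfrak g\triangleright\theta}$. Lie bialgebroid: a pair of Lie algebroids $(A,A^* )$ on dual vector bundles such that the Lie algebroid differential $d_*$ of $A^*$, acting on $\Gamma(\wedge^\bullet A)$, satisfies $d_*[u,v]=[d_*u,v]+(-1)^{k-1}[u,d_*v]$ for all $u\in\Gamma(\wedge^kA)$, $v\in\Gamma(\wedge^lA)$, where $[\cdot,\cdot]$ is the Schouten (Gerstenhaber) bracket of $A$. Lie bialgebroid crossed module: two Lie algebroid crossed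 modules in duality, $(\theta\stackrel{\phi}{\rightharpoonup}\mathfrak g)$ and $(\mathfrak g^*\stackrel{\phi^T}{\rightharpoonup}\theta^* )$ with $\phi^T=-\phi^*$, form a Lie bialgebroid crossed module if $(A_{\mathfrak g\triangleright\theta},A_{\theta^*\triangleright\mathfrak g^*})$ is a Lie bialgebroid. Matched pair: Lie algebroids $P,Q$ over $M$ with representations of $P$ on $Q$ and of $Q$ on $P$ (both written $\triangleright$) form a matched pair if for all $X,X_1,X_2\in\Gamma(P)$, $Y,Y_1,Y_2\in\Gamma(Q)$: $[\rho_P(X),\rho_Q(Y)]=-\rho_P(Y\triangleright X)+\rho_Q(X\triangleright Y)$; $X\triangleright[Y_1,Y_2]=[X\triangleright Y_1,Y_2]+[Y_1,X\triangleright Y_2]+(Y_2\triangleright X)\triangleright Y_1-(Y_1\triangleright X)\triangleright Y_2$; $Y\triangleright[X_1,X_2]=[Y\triangleright X_1,X_2]+[X_1,Y\triangleright X_2]+(X_2\triangleright Y)\triangleright X_1-(X_1\triangleright Y)\triangleright X_2$. *)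

(* Defs.v *)
From HB Require Import structures.
From mathcomp Require Import all_boot all_order all_algebra.
From mathcomp Require Import all_classical all_reals all_analysis.
From mathcomp Require Import ring.
Set Implicit Arguments.
Unset Strict Implicit.
Unset Printing Implicit Defensive.
Import Order.TTheory GRing.Theory Num.Theory numFieldNormedType.Exports.
Local Open Scope classical_set_scope.
Local Open Scope ring_scope.

Section CkFunctions.
Context {R : realType} {n : nat}.
Implicit Types (D : set 'rV[R]_n) (f g : 'rV[R]_n -> R).

(* Meaningful for D open: all iterated partial derivatives of order at most k
   exist and are continuous at every point of D. *)
Fixpoint Ck (k : nat) D f : Prop :=
  (forall x, D x -> {for x, continuous f}) /\
  (if k is k'.+1 then
     forall i : 'I_n, (forall x, D x -> derivable f x (delta_mx 0 i)) /\
                      Ck k' D ('D_(delta_mx 0 i) f)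
   else True).

Definition smooth_on D f := forall k, Ck k D f.

Lemma Ck_glue k D f :
  (forall x, D x -> exists2 D', D' x & Ck k D' f) -> Ck k D f.
Proof.
elim: k f => [|k IH] f H.
  by split=> // x /H[D' D'x [+ _]]; apply.
split=> [x /H[D' D'x [+ _]]|i]; first by apply.
split=> [x /H[D' D'x [_ /(_ i)[+ _]]]|]; first by apply.
by apply: IH => x /H[D' D'x [_ /(_ i)[_ ?]]]; exists D'.
Qed.

Lemma CkW k D f : Ck k.+1 D f -> Ck k D f.
Proof.
elim: k f => [|k IH] f [cf df]; first by split.
by split=> // i; have [d1 /IH] := df i.
Qed.

Lemma Ck_sub k D D' f : D' `<=` D -> Ck k D f -> Ck k D' f.
Proof.
move=> s; elim: k f => [|k IH] f [cf df]; split=> //.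
- by move=> x /s/cf.
- by move=> x /s/cf.
- by move=> i; have [d1 /IH d2] := df i; split=> // x /s /d1.
Qed.

Lemma Ck_eq k D f g : open D -> (forall x, D x -> f x = g x) ->
  Ck k D f -> Ck k D g.
Proof.
move=> oD; elim: k f g => [|k IH] f g fg [cf df].
  split=> // x Dx; have := cf _ Dx; rewrite /prop_for /continuous_at fg //.
  apply: cvg_trans; apply: (@near_eq_cvg _ _ (nbhs x)).
  by apply: filterS (open_nbhs_nbhs (conj oD Dx)) => y /fg.
have nfg x : D x -> {near x, f =1 g}.
  by move=> Dx; apply: filterS (open_nbhs_nbhs (conj oD Dx)) => y /fg.
split=> [x Dx|i].
  have := cf _ Dx; rewrite /prop_for /continuous_at fg //.
  by apply: cvg_trans; apply: (@near_eq_cvg _ _ (nbhs x)); exact: nfg.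
have [d1 d2] := df i; split=> [x Dx|].
  by apply: near_eq_derivable (d1 _ Dx); exact: nfg.
by apply: IH d2 => x Dx; apply: near_eq_derive; exact: nfg.
Qed.

Lemma Ck_cst k D (a : R) : Ck k D (cst a).
Proof.
elim: k a => [|k IH] a; first by split=> // x _; exact: cst_continuous.
split=> [x _|i]; first exact: cst_continuous.
split=> [x _|]; first exact: derivable_cst.
rewrite (_ : (fun _ => _) = cst 0) //.
by apply/funext => x; rewrite derive_cst.
Qed.

Lemma CkD k D f g : open D -> Ck k D f -> Ck k D g -> Ck k D (f + g).
Proof.
move=> oD; elim: k f g => [|k IH] f g [cf df] [cg dg];
  (split=> [x Dx|//]; first by apply: continuousD; [exact: cf|exact: cg]).
move=> i; have [f1 f2] := df i; have [g1 g2] := dg i; split=> [x Dx|].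
  by apply: derivableD; [exact: f1|exact: g1].
apply: Ck_eq (IH _ _ f2 g2) => // x Dx.
by rewrite deriveD //; [exact: f1|exact: g1].
Qed.

Lemma CkM k D f g : open D -> Ck k D f -> Ck k D g -> Ck k D (f * g).
Proof.
move=> oD; elim: k f g => [|k IH] f g Hf Hg;
  have [cf df] := Hf; have [cg dg] := Hg;
  (split=> [x Dx|//]; first by apply: continuousM; [exact: cf|exact: cg]).
move=> i; have [f1 f2] := df i; have [g1 g2] := dg i; split=> [x Dx|].
  by apply: derivableM; [exact: f1|exact: g1].
apply: Ck_eq (CkD oD (IH _ _ (CkW Hf) g2) (IH _ _ (CkW Hg) f2)) => // x Dx.
by rewrite deriveM //; [exact: f1|exact: g1].
Qed.

End CkFunctions.

Record manifold (R : realType) := Manifold {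
  mpoint :> topologicalType;
  mdim : nat;
  mchart : Type;
  mdom : mchart -> set mpoint;
  mcoord : mchart -> mpoint -> 'rV[R]_mdim;
  mparam : mchart -> 'rV[R]_mdim -> mpoint;
  m_hausdorff : hausdorff_space mpoint;
  m_second_countable : @second_countable mpoint;
  mdom_cover : forall p, exists c, mdom c p;
  mdom_open : forall c, open (mdom c);
  mcoord_open : forall c, open (mcoord c @` mdom c);
  mcoordK : forall c p, mdom c p -> mparam c (mcoord c p) = p;
  mcoord_continuous : forall c, {within mdom c, continuous (mcoord c)};
  mparam_continuous :
    forall c, {within mcoord c @` mdom c, continuous (mparam c)};
  mtransition_smooth : forall c d j,
    smooth_on (mcoord c @` (mdom c `&` mdom d))
              (fun x => mcoord d (mparam c x) 0 j)
}.

Section SmoothFunctions.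
Context {R : realType} {M : manifold R}.
Implicit Types (W : set M) (f g : M -> R).

(* Meaningful for W open. *)
Definition smooth_in W f :=
  forall c : mchart M, smooth_on (mcoord c @` (mdom c `&` W)) (f \o mparam c).

Lemma chart_image_open (c : mchart M) W :
  open W -> open (mcoord c @` (mdom c `&` W)).
Proof.
move=> oW; have H := iffLR (@continuousP _ _ _) (@mparam_continuous R M c) _ oW.
have [V oV VE] := iffLR (@open_subspaceP _ _ _) H.
suff -> : mcoord c @` (mdom c `&` W) = V `&` (mcoord c @` mdom c).
  by apply: openI => //; exact: mcoord_open.
rewrite VE; apply/seteqP; split=> x.
  move=> [p [dp Wp] <-]; split; last by exists p.
  by change (W (mparam c (mcoord c p))); rewrite mcoordK.
move=> [Wx [p dp px]]; exists p => //; split=> //.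
by rewrite -(mcoordK dp) px.
Qed.

Lemma smooth_glue W f :
  (forall p, W p -> exists2 W', W' p & smooth_in W' f) -> smooth_in W f.
Proof.
move=> H c k; apply: Ck_glue => _ [p [dp /H[W' W'p /(_ c k) ?]] <-].
by exists (mcoord c @` (mdom c `&` W')) => //; exists p.
Qed.

Lemma smooth_sub W W' f : W' `<=` W -> smooth_in W f -> smooth_in W' f.
Proof. by move=> s sf c k; apply: Ck_sub (sf c k) => _ [p [? /s ?] <-]; exists p. Qed.

Lemma smooth_eq W f g : open W -> (forall p, W p -> f p = g p) ->
  smooth_in W f -> smooth_in W g.
Proof.
move=> oW fg sf c k; apply: Ck_eq (sf c k); first exact: chart_image_open.
by move=> _ [p [dp Wp] <-]; rewrite /= mcoordK // fg.
Qed.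

Lemma smooth_cst W a : smooth_in W (cst a).
Proof. by move=> c k; exact: Ck_cst. Qed.

Lemma smoothD W f g : open W ->
  smooth_in W f -> smooth_in W g -> smooth_in W (fun p => f p + g p).
Proof.
by move=> oW sf sg c k; apply: (CkD _ (sf c k) (sg c k)); exact: chart_image_open.
Qed.

Lemma smoothM W f g : open W ->
  smooth_in W f -> smooth_in W g -> smooth_in W (fun p => f p * g p).
Proof.
by move=> oW sf sg c k; apply: (CkM _ (sf c k) (sg c k)); exact: chart_image_open.
Qed.

Lemma smoothN W f : open W -> smooth_in W f -> smooth_in W (fun p => - f p).
Proof.
move=> oW sf; apply: (smooth_eq oW _ (smoothM oW (smooth_cst W (-1)) sf)) => p _.
by rewrite /= mulN1r.
Qed.

Lemma smooth_sum W (I : Type) (r : seq I) (F : I -> M -> R) : open W ->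
  (forall i, smooth_in W (F i)) -> smooth_in W (fun p => \sum_(i <- r) F i p).
Proof.
move=> oW sF; elim: r => [|i r IH].
  by apply: (smooth_eq oW _ (smooth_cst W 0)) => p _; rewrite big_nil.
by apply: (smooth_eq oW _ (smoothD oW (sF i) IH)) => p _; rewrite big_cons.
Qed.

End SmoothFunctions.

Definition smooth_fun {R : realType} {M : manifold R} : {pred M -> R} :=
  [pred f | `[< smooth_in setT f >]].

Section SmoothRing.
Context {R : realType} {M : manifold R}.

Lemma smooth_fun_subring : subring_closed (@smooth_fun R M).
Proof.
split=> [|f g|f g]; rewrite !inE; first exact: smooth_cst.
- move=> sf sg; apply: smoothD => //; first exact: openT.
  by apply: smoothN => //; exact: openT.
- by move=> sf sg; apply: smoothM => //; exact: openT.
Qed.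

End SmoothRing.

Record Cinf (R : realType) (M : manifold R) := CinfBuild {
  cinf_val :> M -> R;
  cinfP : cinf_val \in smooth_fun
}.
Arguments cinf_val {R M}.

HB.instance Definition _ (R : realType) (M : manifold R) :=
  [isSub of Cinf M for cinf_val].
HB.instance Definition _ (R : realType) (M : manifold R) :=
  [Choice of Cinf M by <:].
HB.instance Definition _ (R : realType) (M : manifold R) :=
  GRing.SubChoice_isSubComPzRing.Build (M -> R) smooth_fun (Cinf M)
    smooth_fun_subring.

Definition mkCinf (R : realType) (M : manifold R) (f : M -> R)
  (fP : smooth_in setT f) : Cinf M := CinfBuild (asboolT fP).

Definition cinf_cst (R : realType) (M : manifold R) (a : R) : Cinf M :=
  mkCinf (smooth_cst setT a).
Arguments cinf_cst {R M}.

Record vbundle (R : realType) (M : manifold R) := VBundle {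
  fiber :> M -> vectType R;
  vrank : nat;
  vtriv : Type;
  vdom : vtriv -> set M;
  vframe : vtriv -> forall p, vrank.-tuple (fiber p);
  vdom_open : forall i, open (vdom i);
  vdom_cover : forall p, exists i, vdom i p;
  vframe_basis : forall i p, vdom i p -> basis_of fullv (vframe i p);
  vframe_smooth : forall i j (k l : 'I_vrank),
    smooth_in (vdom i `&` vdom j)
              (fun p => coord (vframe i p) k (tnth (vframe j p) l))
}.

Section Sections.
Context {R : realType} {M : manifold R}.
Implicit Types E F : vbundle M.

Definition smooth_section E (s : forall p, E p) :=
  forall (i : vtriv E) k,
    smooth_in (vdom i) (fun p => coord (vframe i p) k (s p)).

Record sec E := Sec {
  sec_val :> forall p, E p;
  secP : smooth_section sec_val
}.

Lemma secE E (s t : sec E) : (forall p, s p = t p) -> s = t.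
Proof.
case: s t => [s sP] [t tP] /= st.
have e : s = t by apply: functional_extensionality_dep.
by rewrite e in sP *; congr Sec; exact: Prop_irrelevance.
Qed.

Lemma cinfE (f g : Cinf M) : (forall p, f p = g p) -> f = g.
Proof. by move=> fg; apply: val_inj; apply/funext. Qed.

Lemma cinf_smooth (f : Cinf M) W : smooth_in W f.
Proof. by have /asboolP := cinfP f; exact: smooth_sub. Qed.

Lemma frame_expand E (i : vtriv E) p (v : E p) : vdom i p ->
  v = \sum_k coord (vframe i p) k v *: tnth (vframe i p) k.
Proof.
move=> ip; rewrite {1}(coord_basis (vframe_basis ip) (memvf v)).
by apply: eq_bigr => k _; rewrite (tnth_nth 0).
Qed.

Lemma sec_add_subproof E (s t : sec E) : smooth_section (fun p => s p + t p).
Proof.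
move=> i k; have oi := vdom_open i.
apply: (smooth_eq oi _ (smoothD oi (secP s i k) (secP t i k))) => p _.
by rewrite linearD.
Qed.
Lemma sec_scale_subproof E (f : Cinf M) (s : sec E) :
  smooth_section (fun p => f p *: s p).
Proof.
move=> i k; have oi := vdom_open i.
apply: (smooth_eq oi _ (smoothM oi (cinf_smooth f _) (secP s i k))) => p _.
by rewrite linearZ.
Qed.
Lemma sec_zero_subproof E : smooth_section (fun p => 0 : E p).
Proof.
move=> i k; apply: (smooth_eq (vdom_open i) _ (smooth_cst _ 0)) => p _.
by rewrite linear0.
Qed.
Lemma sec_opp_subproof E (s : sec E) : smooth_section (fun p => - s p).
Proof.
move=> i k; have oi := vdom_open i.
by apply: (smooth_eq oi _ (smoothN oi (secP s i k))) => p _; rewrite linearN.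
Qed.

Definition sec_add E (s t : sec E) := Sec (sec_add_subproof s t).
Definition sec_scale E (f : Cinf M) (s : sec E) := Sec (sec_scale_subproof f s).
Definition sec_zero E := Sec (@sec_zero_subproof E).
Definition sec_opp E (s : sec E) := Sec (sec_opp_subproof s).

HB.instance Definition _ E := gen_eqMixin (sec E).
HB.instance Definition _ E := gen_choiceMixin (sec E).

Lemma sec_addA E : associative (@sec_add E).
Proof. by move=> x y z; apply: secE => p /=; rewrite addrA. Qed.
Lemma sec_addC E : commutative (@sec_add E).
Proof. by move=> x y; apply: secE => p /=; rewrite addrC. Qed.
Lemma sec_add0 E : left_id (sec_zero E) (@sec_add E).
Proof. by move=> x; apply: secE => p /=; rewrite add0r. Qed.
Lemma sec_addN E : left_inverse (sec_zero E) (@sec_opp E) (@sec_add E).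
Proof. by move=> x; apply: secE => p /=; rewrite addNr. Qed.

HB.instance Definition _ E :=
  GRing.isZmodule.Build (sec E) (@sec_addA E) (@sec_addC E) (@sec_add0 E)
                        (@sec_addN E).

Lemma sec_scaleA E f g (s : sec E) :
  sec_scale f (sec_scale g s) = sec_scale (f * g) s.
Proof. by apply: secE => p /=; rewrite scalerA. Qed.
Lemma sec_scale1 E : left_id 1 (@sec_scale E).
Proof. by move=> s; apply: secE => p /=; rewrite scale1r. Qed.
Lemma sec_scaleDr E : right_distributive (@sec_scale E) +%R.
Proof. by move=> f s t; apply: secE => p /=; rewrite scalerDr. Qed.
Lemma sec_scaleDl E (s : sec E) :
  {morph (@sec_scale E)^~ s : f g / f + g >-> f + g}.
Proof. by move=> f g; apply: secE => p /=; rewrite scalerDl. Qed.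

HB.instance Definition _ E :=
  GRing.Zmodule_isLmodule.Build (Cinf M) (sec E) (@sec_scaleA E)
    (@sec_scale1 E) (@sec_scaleDr E) (@sec_scaleDl E).

End Sections.

Section FrameLemmas.
Context {R : realType} {M : manifold R}.
Implicit Types E F : vbundle M.

Lemma dual_basis (V : vectType R) n (X : n.-tuple V) (c : 'I_n -> V -> R) :
  (forall k a v w, c k (a *: v + w) = a * c k v + c k w) ->
  (forall k l, c k (tnth X l) = (k == l)%:R) ->
  (forall v, v = \sum_k c k v *: tnth X k) ->
  basis_of fullv X /\ forall k v, coord X k v = c k v.
Proof.
move=> cl cX cE.
have c0 k : c k 0 = 0.
  have := cl k 1 0 0; rewrite scale1r addr0 mul1r.
  by move=> /(congr1 (fun z => z - c k 0)); rewrite subrr addrK => <-.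
have csum k (a : 'I_n -> R) : c k (\sum_l a l *: tnth X l) = a k.
  have -> : c k (\sum_l a l *: tnth X l) = \sum_l a l * c k (tnth X l).
    by elim/big_rec2: _ => [|l y1 y2 _ IH]; rewrite ?c0 // cl IH.
  rewrite (bigD1 k) //= cX eqxx mulr1 big1 ?addr0 // => l lk.
  by rewrite cX eq_sym (negbTE lk) mulr0.
have fX : free X.
  apply/freeP => a a0 k; rewrite -(csum k a).
  rewrite (eq_bigr (fun l => a l *: X`_l)) ?a0 ?c0 // => l _.
  by rewrite (tnth_nth 0).
split=> [|k v].
  apply/andP; split=> //; rewrite eqEsubv subvf /=; apply/subvP => v _.
  rewrite (cE v); apply: memv_suml => k _; apply/memvZ/memv_span/mem_tnth.
rewrite {1}(cE v) (eq_bigr (fun l => c l v *: X`_l)) ?coord_sum_free // => l _.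
by rewrite (tnth_nth 0).
Qed.

Lemma coord_frame E (i : vtriv E) p k l : vdom i p ->
  coord (vframe i p) k (tnth (vframe i p) l) = (k == l)%:R.
Proof.
move=> ip; rewrite (tnth_nth 0) coord_free 1?eq_sym //.
exact: basis_free (vframe_basis ip).
Qed.

Lemma smooth_lin E (L : forall p, E p -> R) (i : vtriv E) W (s : sec E) :
  (forall p a v w, L p (a *: v + w) = a * L p v + L p w) ->
  open W -> W `<=` vdom i ->
  (forall k, smooth_in W (fun p => L p (tnth (vframe i p) k))) ->
  smooth_in W (fun p => L p (s p)).
Proof.
move=> Ll oW Wi sL.
have sc k : smooth_in W (fun p => coord (vframe i p) k (s p)).
  exact: smooth_sub (secP s i k).
have H := smooth_sum (index_enum _) oW (fun k => smoothM oW (sc k) (sL k)).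
apply: (smooth_eq oW _ H) => p Wp; rewrite [in RHS](frame_expand (s p) (Wi _ Wp)).
have L0 : L p 0 = 0.
  have := Ll p 1 0 0; rewrite scale1r addr0 mul1r.
  by move=> /(congr1 (fun z => z - L p 0)); rewrite subrr addrK => <-.
by elim/big_rec2: _ => [|k y1 y2 _ IH]; rewrite ?L0 // Ll -IH.
Qed.

Lemma frame_cover E W (f : M -> R) :
  (forall i : vtriv E, smooth_in (W `&` vdom i) f) -> smooth_in W f.
Proof.
move=> H; apply: smooth_glue => p Wp; have [i ip] := vdom_cover E p.
by exists (W `&` vdom i).
Qed.

End FrameLemmas.

Section BundleConstructions.
Context {R : realType} {M : manifold R}.
Implicit Types E F : vbundle M.

Record bundle_map E F := BundleMap {
  bmap :> forall p, 'Hom(E p, F p);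
  (* smooth matrix entries in the local frames *)
  bmap_smooth : forall (i : vtriv E) (j : vtriv F) k l,
    smooth_in (vdom i `&` vdom j)
              (fun p => coord (vframe j p) k (bmap p (tnth (vframe i p) l)))
}.

Lemma bmap_sec_subproof E F (phi : bundle_map E F) (s : sec E) :
  smooth_section (fun p => phi p (s p)).
Proof.
move=> j k; apply: (@frame_cover _ _ E) => i.
apply: (smooth_lin (i := i) (L := fun p v => coord (vframe j p) k (phi p v))).
- by move=> p a v w; rewrite !linearP.
- by apply: openI; exact: vdom_open.
- exact: subIsetr.
- by move=> l; rewrite setIC; exact: bmap_smooth.
Qed.

Definition bmap_sec E F (phi : bundle_map E F) (s : sec E) : sec F :=
  Sec (bmap_sec_subproof phi s).

Definition dual_frame E (i : vtriv E) p : (vrank E).-tuple 'Hom(E p, R^o) :=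
  [tuple linfun (coord (vframe i p) k : E p -> R^o) | k < vrank E].

Lemma dual_frameP E (i : vtriv E) p : vdom i p ->
  basis_of fullv (dual_frame i p) /\
  forall k eps, coord (dual_frame i p) k eps = eps (tnth (vframe i p) k).
Proof.
move=> ip.
apply: (@dual_basis _ 'Hom(E p, R^o) _ _
         (fun k (eps : 'Hom(E p, R^o)) => eps (tnth (vframe i p) k))).
- by move=> k a v w; rewrite add_lfunE scale_lfunE.
- by move=> k l; rewrite tnth_mktuple lfunE /= coord_frame // eq_sym.
- move=> eps; apply/lfunP => v; rewrite sum_lfunE {1}(frame_expand v ip).
  rewrite linear_sum; apply: eq_bigr => k _.
  by rewrite linearZ /= scale_lfunE tnth_mktuple lfunE; exact: mulrC.
Qed.

Lemma dual_smooth E (i j : vtriv E) k l :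
  smooth_in (vdom i `&` vdom j)
    (fun p => coord (dual_frame i p) k (tnth (dual_frame j p) l)).
Proof.
have o : open (vdom i `&` vdom j) by apply: openI; exact: vdom_open.
rewrite setIC in o *.
have H := @vframe_smooth R M E j i l k. apply: (smooth_eq o _ H) => p [jp ip].
by rewrite (dual_frameP ip).2 tnth_mktuple lfunE.
Qed.

Definition dual E : vbundle M :=
  @VBundle R M (fun p => 'Hom(E p, R^o)) (vrank E) (vtriv E) (@vdom _ _ E)
    (@dual_frame E) (@vdom_open _ _ E) (@vdom_cover _ _ E)
    (fun i p ip => (dual_frameP ip).1) (@dual_smooth E).

Definition neg_transpose_fun E F (phi : bundle_map E F) p :
    'Hom('Hom(F p, R^o), 'Hom(E p, R^o)) :=
  linfun (fun eps : 'Hom(F p, R^o) => - (eps \o phi p)%VF).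

Lemma neg_transposeE E F (phi : bundle_map E F) p (eps : 'Hom(F p, R^o)) v :
  neg_transpose_fun phi p eps v = - eps (phi p v).
Proof.
have lin : linear (fun eps : 'Hom(F p, R^o) => - (eps \o phi p)%VF).
  move=> a u w; apply/lfunP => x.
  by rewrite !(add_lfunE, scale_lfunE, opp_lfunE, comp_lfunE) scalerN opprD.
pose h := GRing.isLinear.Build _ _ _ _ _ lin.
pose g : {linear _ -> _} := HB.pack (fun eps : 'Hom(F p, R^o) => - (eps \o phi p)%VF) h.
by rewrite /neg_transpose_fun (lfunE g) /= opp_lfunE comp_lfunE.
Qed.

Lemma neg_transpose_smooth E F (phi : bundle_map E F)
    (i : vtriv (dual F)) (j : vtriv (dual E)) k l :
  smooth_in (vdom i `&` vdom j)
    (fun p => coord (vframe j p) k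
                (neg_transpose_fun phi p (tnth (vframe i p) l))).
Proof.
have o : open (vdom i `&` vdom j) by apply: openI; exact: vdom_open.
rewrite setIC in o *.
have H := smoothN o (@bmap_smooth E F phi j i l k).
apply: (smooth_eq o _ H) => p [jp ip].
by rewrite (@dual_frameP E j p jp).2 neg_transposeE tnth_mktuple lfunE.
Qed.

(* phi^T = - phi^* *)
Definition neg_transpose E F (phi : bundle_map E F) :
    bundle_map (dual F) (dual E) :=
  BundleMap (@neg_transpose_smooth E F phi).

Definition dsum_frame E F (ij : vtriv E * vtriv F) p :
    (vrank E + vrank F).-tuple (E p * F p)%type :=
  [tuple of [seq (v, 0) | v <- vframe ij.1 p] ++ [seq (0, w) | w <- vframe ij.2 p]].

Definition dsum_dom E F (ij : vtriv E * vtriv F) : set M :=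
  vdom ij.1 `&` vdom ij.2.

Definition dsum_coord E F (ij : vtriv E * vtriv F) p
    (k : 'I_(vrank E + vrank F)) (v : (E p * F p)%type) : R :=
  match fintype.split k with
  | inl l => coord (vframe ij.1 p) l v.1
  | inr l => coord (vframe ij.2 p) l v.2
  end.

Lemma dsum_frameP E F (ij : vtriv E * vtriv F) p : dsum_dom ij p ->
  basis_of fullv (dsum_frame ij p) /\
  forall k v, coord (dsum_frame ij p) k v = dsum_coord ij k v.
Proof.
case: ij => i j [/= ip jp]; apply: dual_basis.
- by move=> k a v w; rewrite /dsum_coord; case: (fintype.split k) => l /=; rewrite linearP.
- move=> k l; rewrite /dsum_coord -[k]fintype.splitK -[l]fintype.splitK.
  case: (fintype.split k) => k'; case: (fintype.split l) => l'; rewrite unsplitK /=.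
  + by rewrite tnth_lshift tnth_map coord_frame // eq_lshift.
  + by rewrite tnth_rshift tnth_map linear0 eq_lrshift.
  + by rewrite tnth_lshift tnth_map linear0 eq_rlshift.
  + by rewrite tnth_rshift tnth_map coord_frame // eq_rshift.
- move=> [v w]; rewrite big_split_ord /=.
  under eq_bigr do rewrite /dsum_coord (unsplitK (inl _)) tnth_lshift tnth_map /=.
  under [X in _ + X]eq_bigr do
    rewrite /dsum_coord (unsplitK (inr _)) tnth_rshift tnth_map /=.
  rewrite {1}(frame_expand v ip) {1}(frame_expand w jp).
  apply: injective_projections; rewrite /= !raddf_sum /=.
  + by rewrite [X in _ + X]big1 ?addr0 // => l _; rewrite scaler0.
  + by rewrite [X in X + _]big1 ?add0r // => l _; rewrite scaler0.
Qed.

Lemma dsum_open E F (ij : vtriv E * vtriv F) : open (dsum_dom ij).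
Proof. by apply: openI; exact: vdom_open. Qed.

Lemma dsum_cover E F p : exists ij : vtriv E * vtriv F, dsum_dom ij p.
Proof.
have [i ip] := vdom_cover E p; have [j jp] := vdom_cover F p.
by exists (i, j).
Qed.

Lemma dsum_smooth E F (ij ij' : vtriv E * vtriv F) k l :
  smooth_in (dsum_dom ij `&` dsum_dom ij')
    (fun p => coord (dsum_frame ij p) k (tnth (dsum_frame ij' p) l)).
Proof.
have o : open (dsum_dom ij `&` dsum_dom ij') by apply: openI; exact: dsum_open.
have H : smooth_in (dsum_dom ij `&` dsum_dom ij')
    (fun p => dsum_coord ij k (tnth (dsum_frame ij' p) l)).
  case: ij ij' o => i j [i' j'] o; rewrite /dsum_coord -[l]fintype.splitK.
  case: (fintype.split k) => k'; case: (fintype.split l) => l' /=.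
  + apply: (smooth_eq o _ (smooth_sub _ (@vframe_smooth R M E i i' k' l'))).
      by move=> p _; rewrite tnth_lshift tnth_map.
    by move=> p [[? _] [? _]].
  + apply: (smooth_eq o _ (smooth_cst _ 0)) => p _.
    by rewrite tnth_rshift tnth_map linear0.
  + apply: (smooth_eq o _ (smooth_cst _ 0)) => p _.
    by rewrite tnth_lshift tnth_map linear0.
  + apply: (smooth_eq o _ (smooth_sub _ (@vframe_smooth R M F j j' k' l'))).
      by move=> p _; rewrite tnth_rshift tnth_map.
    by move=> p [[_ ?] [_ ?]].
by apply: (smooth_eq o _ H) => p [ip _]; rewrite (dsum_frameP ip).2.
Qed.

Definition dsum E F : vbundle M :=
  @VBundle R M (fun p => (E p * F p)%type) (vrank E + vrank F)
    (vtriv E * vtriv F)%type (@dsum_dom E F) (@dsum_frame E F)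
    (@dsum_open E F) (@dsum_cover E F)
    (fun ij p ijp => (dsum_frameP ijp).1) (@dsum_smooth E F).

Lemma sec_pair_subproof E F (x : sec E) (y : sec F) :
  @smooth_section R M (dsum E F) (fun p => (x p, y p)).
Proof.
move=> ij k; have o : open (vdom (v := dsum E F) ij) by exact: vdom_open.
have H : smooth_in (dsum_dom ij) (fun p => dsum_coord ij k (x p, y p)).
  rewrite /dsum_coord; case: (fintype.split k) => l /=.
  + by apply: smooth_sub (secP x ij.1 l) => p [].
  + by apply: smooth_sub (secP y ij.2 l) => p [].
by apply: (smooth_eq o _ H) => p ip; rewrite (dsum_frameP ip).2.
Qed.
Definition sec_pair E F (x : sec E) (y : sec F) : sec (dsum E F) :=
  Sec (sec_pair_subproof x y).

Lemma sec_fst_subproof E F (z : sec (dsum E F)) :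
  smooth_section (fun p => (z p).1 : E p).
Proof.
move=> i k; apply: (@frame_cover _ _ F) => j.
have o : open (vdom i `&` vdom j) by apply: openI; exact: vdom_open.
apply: (smooth_eq o _ (secP z (i, j) (lshift _ k))) => p ip.
by rewrite (dsum_frameP (ij := (i, j)) ip).2 /dsum_coord (unsplitK (inl _)).
Qed.
Definition sec_fst E F (z : sec (dsum E F)) : sec E := Sec (sec_fst_subproof z).

Lemma sec_snd_subproof E F (z : sec (dsum E F)) :
  smooth_section (fun p => (z p).2 : F p).
Proof.
move=> j k; apply: (@frame_cover _ _ E) => i; rewrite setIC.
have o : open (vdom i `&` vdom j) by apply: openI; exact: vdom_open.
apply: (smooth_eq o _ (secP z (i, j) (rshift _ k))) => p ip.
by rewrite (dsum_frameP (ij := (i, j)) ip).2 /dsum_coord (unsplitK (inr _)).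
Qed.
Definition sec_snd E F (z : sec (dsum E F)) : sec F := Sec (sec_snd_subproof z).

End BundleConstructions.

Section LieAlgebroids.
Context {R : realType} {M : manifold R}.
Implicit Types A B E F : vbundle M.

(* T_p M as the space of point derivations of C^oo(M) at p. *)
Record tangent_vector (p : M) := TangentVector {
  tv :> Cinf M -> R;
  tv_linear : forall a f g, tv (cinf_cst a * f + g) = a * tv f + tv g;
  tv_leibniz : forall f g, tv (f * g) = tv f * g p + f p * tv g
}.

(* A bundle map A -> TM over the identity, fibre by fibre; smoothness is read
   in the local frames. *)
Record anchor_map A := AnchorMap {
  anc :> forall p, A p -> tangent_vector p;
  anc_linear : forall p a (v w : A p) f,
    anc (a *: v + w) f = a * anc v f + anc w f;
  anc_smooth : forall (i : vtriv A) k f,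
    smooth_in (vdom i) (fun p => anc (tnth (vframe i p) k) f)
}.

Lemma anc_act_subproof A (rho : anchor_map A) (x : sec A) (f : Cinf M) :
  smooth_in setT (fun p => rho p (x p) f).
Proof.
apply: (@frame_cover _ _ A) => i; rewrite setTI.
apply: (smooth_lin (i := i) (L := fun p v => rho p v f)) => //.
- by move=> p a v w; exact: anc_linear.
- exact: vdom_open.
- by move=> k; exact: anc_smooth.
Qed.

Definition anc_act A (rho : anchor_map A) (x : sec A) (f : Cinf M) : Cinf M :=
  mkCinf (anc_act_subproof rho x f).

Record lieAlgebroid A := LieAlgebroid {
  la_anchor : anchor_map A;
  la_br : sec A -> sec A -> sec A;
  la_linear : forall a x y z,
    la_br (cinf_cst a *: x + y) z = cinf_cst a *: la_br x z + la_br y z;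
  la_anti : forall x y, la_br x y = - la_br y x;
  la_jacobi : forall x y z,
    la_br x (la_br y z) + la_br y (la_br z x) + la_br z (la_br x y) = 0;
  la_leibniz : forall x y f,
    la_br x (f *: y) = f *: la_br x y + anc_act la_anchor x f *: y;
  la_anchor_br : forall x y f,
    anc_act la_anchor (la_br x y) f =
    anc_act la_anchor x (anc_act la_anchor y f) -
    anc_act la_anchor y (anc_act la_anchor x f)
}.

Record lieAlgebraBundle E := LieAlgebraBundle {
  lab_br : forall p, E p -> E p -> E p;
  lab_linear : forall p a (u v w : E p),
    lab_br (a *: u + v) w = a *: lab_br u w + lab_br v w;
  lab_anti : forall p (u v : E p), lab_br u v = - lab_br v u;
  lab_jacobi : forall p (u v w : E p),
    lab_br u (lab_br v w) + lab_br v (lab_br w u) + lab_br w (lab_br u v) = 0;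
  lab_smooth : forall (i : vtriv E) k l m,
    smooth_in (vdom i) (fun p =>
      coord (vframe i p) m
            (lab_br (tnth (vframe i p) k) (tnth (vframe i p) l)))
}.

Lemma lab_linear_r E (L : lieAlgebraBundle E) p a (u v w : E p) :
  lab_br L w (a *: u + v) = a *: lab_br L w u + lab_br L w v.
Proof.
by rewrite lab_anti lab_linear (lab_anti L w u) (lab_anti L w v) scalerN opprD.
Qed.

Lemma lab_zero_r E (L : lieAlgebraBundle E) p (w : E p) : lab_br L w 0 = 0.
Proof.
have := lab_linear_r L 1 0 0 w; rewrite !scale1r addr0.
by move=> /(congr1 (fun z => z - lab_br L w 0)); rewrite subrr addrK.
Qed.

Lemma lab_sec_subproof E (L : lieAlgebraBundle E) (u v : sec E) :
  smooth_section (fun p => lab_br L (u p) (v p)).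
Proof.
move=> i m; have oi := vdom_open i.
apply: (smooth_lin (i := i)
  (L := fun p w => coord (vframe i p) m (lab_br L w (v p)))) => //.
  by move=> p a x y; rewrite lab_linear linearP.
move=> k; apply: (smooth_lin (i := i)
  (L := fun p w => coord (vframe i p) m (lab_br L (tnth (vframe i p) k) w))) => //.
  by move=> p a x y; rewrite lab_linear_r linearP.
by move=> l; exact: lab_smooth.
Qed.

Definition lab_sec E (L : lieAlgebraBundle E) (u v : sec E) : sec E :=
  Sec (lab_sec_subproof L u v).

Definition zero_tangent (p : M) : tangent_vector p.
Proof.
refine (@TangentVector p (fun _ => 0) _ _) => /=.
- by move=> a _ _; rewrite mulr0 addr0.
- by move=> f g; rewrite mulr0 mul0r addr0.
Defined.

Definition zero_anchor A : anchor_map A.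
Proof.
refine (@AnchorMap A (fun p _ => zero_tangent p) _ _) => /= *.
- by rewrite mulr0 addr0.
- exact: smooth_cst.
Defined.

Lemma anc_act0 A (x : sec A) f : anc_act (zero_anchor A) x f = 0.
Proof. exact: cinfE. Qed.

(* A Lie algebra bundle, viewed as a Lie algebroid with zero anchor. *)
Definition lab_algebroid E (L : lieAlgebraBundle E) : lieAlgebroid E.
Proof.
refine (@LieAlgebroid E (zero_anchor E) (lab_sec L) _ _ _ _ _).
- by move=> a x y z; apply: secE => p /=; rewrite lab_linear.
- by move=> x y; apply: secE => p /=; rewrite lab_anti.
- by move=> x y z; apply: secE => p /=; rewrite lab_jacobi.
- move=> x y f; rewrite anc_act0 scale0r addr0; apply: secE => p /=.
  by rewrite -[f p *: y p]addr0 lab_linear_r lab_zero_r addr0.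
- by move=> x y f; rewrite !anc_act0 subr0.
Defined.

Definition is_algebroid_morphism A B (LA : lieAlgebroid A) (LB : lieAlgebroid B)
    (phi : bundle_map A B) : Prop :=
  (forall x f, anc_act (la_anchor LB) (bmap_sec phi x) f =
               anc_act (la_anchor LA) x f) /\
  (forall x y, bmap_sec phi (la_br LA x y) =
               la_br LB (bmap_sec phi x) (bmap_sec phi y)).

Record is_representation A E (L : lieAlgebroid A)
    (act : sec A -> sec E -> sec E) : Prop := IsRepresentation {
  rep_linear_l : forall f x y e, act (f *: x + y) e = f *: act x e + act y e;
  rep_linear_r : forall a x e e',
    act x (cinf_cst a *: e + e') = cinf_cst a *: act x e + act x e';
  rep_leibniz : forall f x e,
    act x (f *: e) = f *: act x e + anc_act (la_anchor L) x f *: e;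
  rep_flat : forall x y e,
    act (la_br L x y) e = act x (act y e) - act y (act x e)
}.

Record crossed_module E A (phi : bundle_map E A) := CrossedModule {
  cm_bundle : lieAlgebraBundle E;
  cm_algebroid : lieAlgebroid A;
  cm_act : sec A -> sec E -> sec E;
  cm_morphism :
    is_algebroid_morphism (lab_algebroid cm_bundle) cm_algebroid phi;
  cm_rep : is_representation cm_algebroid cm_act;
  cm_peiffer : forall u v, cm_act (bmap_sec phi u) v = lab_sec cm_bundle u v;
  cm_equivariant : forall x u,
    bmap_sec phi (cm_act x u) = la_br cm_algebroid x (bmap_sec phi u)
}.

Definition fst_anchor A E (rho : anchor_map A) : anchor_map (dsum A E).
Proof.
refine (@AnchorMap (dsum A E) (fun p (v : dsum A E p) => rho p v.1) _ _).
- by move=> p a v w f; exact: anc_linear.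
- move=> ij k f; have o := dsum_open ij; rewrite -[k]fintype.splitK.
  case: (fintype.split k) => l /=.
  + apply: (smooth_eq o _ (smooth_sub _ (@anc_smooth A rho ij.1 l f))).
      by move=> p _; rewrite tnth_lshift tnth_map.
    by move=> p [].
  + apply: (smooth_eq o _ (smooth_cst _ 0)) => p _; rewrite tnth_rshift tnth_map /=.
    have := anc_linear rho 1 (0 : A p) 0 f; rewrite scale1r addr0 mul1r.
    by move=> /(congr1 (fun z => z - rho p 0 f)); rewrite subrr addrK.
Defined.

Lemma fst_anchorE A E (rho : anchor_map A) (z : sec (dsum A E)) f :
  anc_act (fst_anchor E rho) z f = anc_act rho (sec_fst z) f.
Proof. exact: cinfE. Qed.

Lemma hom_sep (V : vectType R) (v w : V) :
  (forall eps : 'Hom(V, R^o), eps v = eps w) -> v = w.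
Proof.
move=> H; rewrite (coord_vbasis (memvf v)) (coord_vbasis (memvf w)).
apply: eq_bigr => k _; congr (_ *: _).
by have := H (linfun (coord (vbasis fullv) k : V -> R^o)); rewrite !lfunE.
Qed.

End LieAlgebroids.

Section AssociatedAlgebroid.
Context {R : realType} {M : manifold R} {E A : vbundle M} {phi : bundle_map E A}.
Context (X : crossed_module phi).
Local Notation "x |> u" := (cm_act X x u) (at level 40).
Local Notation "[[ u , v ]]" := (lab_sec (cm_bundle X) u v).

Definition assoc_br (z w : sec (dsum A E)) : sec (dsum A E) :=
  sec_pair (la_br (cm_algebroid X) (sec_fst z) (sec_fst w))
    ([[sec_snd z, sec_snd w]] + sec_fst z |> sec_snd w - sec_fst w |> sec_snd z).

Lemma dsum_secE (z w : sec (dsum A E)) :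
  sec_fst z = sec_fst w -> sec_snd z = sec_snd w -> z = w.
Proof.
move=> e1 e2; apply: secE => p.
have := congr1 (fun s : sec A => s p) e1; have := congr1 (fun s : sec E => s p) e2.
by move=> /= ? ?; apply: injective_projections.
Qed.

Lemma sec_fst_pair (x : sec A) (u : sec E) : sec_fst (sec_pair x u) = x.
Proof. exact: secE. Qed.
Lemma sec_snd_pair (x : sec A) (u : sec E) : sec_snd (sec_pair x u) = u.
Proof. exact: secE. Qed.
Lemma sec_fst_lin f (z w : sec (dsum A E)) :
  sec_fst (f *: z + w) = f *: sec_fst z + sec_fst w.
Proof. exact: secE. Qed.
Lemma sec_snd_lin f (z w : sec (dsum A E)) :
  sec_snd (f *: z + w) = f *: sec_snd z + sec_snd w.
Proof. exact: secE. Qed.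

Lemma cm_act_br x u v : x |> [[u, v]] = [[x |> u, v]] + [[u, x |> v]].
Proof.
have rep := cm_rep X; rewrite -!(cm_peiffer X) (cm_equivariant X) (rep_flat rep).
by rewrite subrK.
Qed.

Definition eval_at p (eps : 'Hom(E p, R^o)) (u : sec E) : R := eps (u p).
Lemma eval_atP (u v : sec E) :
  (forall p eps, @eval_at p eps u = @eval_at p eps v) -> u = v.
Proof. by move=> H; apply: secE => p; apply: hom_sep => eps; exact: H. Qed.
Lemma eval_atD p eps u v : @eval_at p eps (u + v) = eval_at eps u + eval_at eps v.
Proof. by rewrite /eval_at /= linearD. Qed.
Lemma eval_atN p eps u : @eval_at p eps (- u) = - eval_at eps u.
Proof. by rewrite /eval_at /= linearN. Qed.
Lemma eval_atZ p eps f u : @eval_at p eps (f *: u) = f p * eval_at eps u.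
Proof. by rewrite /eval_at /= linearZ. Qed.
Lemma eval_at0 p eps : @eval_at p eps 0 = 0.
Proof. by rewrite /eval_at /= linear0. Qed.
Definition eval_atE := (eval_atD, eval_atN, eval_atZ, eval_at0).

Lemma cm_actDr x u v : x |> (u + v) = x |> u + x |> v.
Proof.
have := rep_linear_r (cm_rep X) 1 x u v.
have -> : cinf_cst 1 = 1 :> Cinf M by exact: cinfE.
by rewrite !scale1r.
Qed.
Lemma cm_actNr x u : x |> (- u) = - (x |> u).
Proof.
have a0 : x |> 0 = 0.
  have := cm_actDr x 0 0; rewrite addr0 => /(congr1 (fun z => z - x |> 0)).
  by rewrite subrr addrK.
by apply/eqP; rewrite -addr_eq0 addrC -cm_actDr subrr a0.
Qed.
Lemma lab_secDr (u v w : sec E) : [[u, v + w]] = [[u, v]] + [[u, w]].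
Proof.
apply: secE => p /=.
by have := lab_linear_r (cm_bundle X) 1 (v p) (w p) (u p); rewrite !scale1r.
Qed.
Lemma lab_secNr (u v : sec E) : [[u, - v]] = - [[u, v]].
Proof.
apply: secE => p /=.
have := lab_linear_r (cm_bundle X) (-1) (v p) 0 (u p).
by rewrite !scaleN1r lab_zero_r !addr0.
Qed.

Lemma assoc_linear a z z' w :
  assoc_br (cinf_cst a *: z + z') w =
  cinf_cst a *: assoc_br z w + assoc_br z' w.
Proof.
apply: dsum_secE; rewrite ?sec_fst_lin ?sec_snd_lin !(sec_fst_pair, sec_snd_pair).
  by rewrite sec_fst_lin la_linear.
rewrite sec_fst_lin sec_snd_lin (rep_linear_l (cm_rep X)).
rewrite (rep_linear_r (cm_rep X)).
have -> u v w' : [[cinf_cst a *: u + v, w']] = cinf_cst a *: [[u, w']] + [[v, w']].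
  by apply: secE => p /=; rewrite lab_linear.
by apply: eval_atP => p eps; rewrite !eval_atE; ring.
Qed.

Lemma assoc_anti z w : assoc_br z w = - assoc_br w z.
Proof.
have fstN (v : sec (dsum A E)) : sec_fst (- v) = - sec_fst v by exact: secE.
have sndN (v : sec (dsum A E)) : sec_snd (- v) = - sec_snd v by exact: secE.
apply: dsum_secE; rewrite ?fstN ?sndN !(sec_fst_pair, sec_snd_pair).
  exact: la_anti.
have -> : [[sec_snd z, sec_snd w]] = - [[sec_snd w, sec_snd z]].
  by apply: secE => p /=; exact: lab_anti.
by apply: eval_atP => p eps; rewrite !eval_atE; ring.
Qed.

Lemma assoc_jacobi x y z :
  assoc_br x (assoc_br y z) + assoc_br y (assoc_br z x) +
  assoc_br z (assoc_br x y) = 0.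
Proof.
have fstD (v w : sec (dsum A E)) : sec_fst (v + w) = sec_fst v + sec_fst w.
  exact: secE.
have sndD (v w : sec (dsum A E)) : sec_snd (v + w) = sec_snd v + sec_snd w.
  exact: secE.
have fst0 : sec_fst (0 : sec (dsum A E)) = 0 by exact: secE.
have snd0 : sec_snd (0 : sec (dsum A E)) = 0 by exact: secE.
apply: dsum_secE; rewrite ?fstD ?sndD ?fst0 ?snd0 !(sec_fst_pair, sec_snd_pair).
  exact: la_jacobi.
set u := sec_snd x; set v := sec_snd y; set w := sec_snd z.
set a := sec_fst x; set b := sec_fst y; set c := sec_fst z.
rewrite !(lab_secDr, lab_secNr, cm_actDr, cm_actNr, cm_act_br).
rewrite !(rep_flat (cm_rep X)).
have anti s t : [[s, t]] = - [[t, s]] by apply: secE => p /=; exact: lab_anti.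
rewrite (anti (a |> v) w) (anti (b |> w) u) (anti (c |> u) v).
have J := la_jacobi (lab_algebroid (cm_bundle X)) u v w.
apply: eval_atP => p eps; have := congr1 (eval_at eps) J; rewrite !eval_atE => J'.
by rewrite -[RHS]J'; rewrite /=; ring.
Qed.

Lemma assoc_leibniz z w f :
  assoc_br z (f *: w) =
  f *: assoc_br z w + anc_act (fst_anchor E (la_anchor (cm_algebroid X))) z f *: w.
Proof.
have fstZ g (v : sec (dsum A E)) : sec_fst (g *: v) = g *: sec_fst v.
  exact: secE.
have sndZ g (v : sec (dsum A E)) : sec_snd (g *: v) = g *: sec_snd v.
  exact: secE.
rewrite fst_anchorE.
apply: dsum_secE; rewrite ?sec_fst_lin ?sec_snd_lin ?fstZ ?sndZ
  !(sec_fst_pair, sec_snd_pair) ?fstZ ?sndZ.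
  by rewrite la_leibniz.
rewrite (rep_leibniz (cm_rep X)).
have -> : [[sec_snd z, f *: sec_snd w]] = f *: [[sec_snd z, sec_snd w]].
  have := la_leibniz (lab_algebroid (cm_bundle X)) (sec_snd z) (sec_snd w) f.
  by rewrite /= anc_act0 scale0r addr0.
have -> : (f *: sec_fst w) |> sec_snd z = f *: (sec_fst w |> sec_snd z).
  have := rep_linear_l (cm_rep X) f (sec_fst w) 0 (sec_snd z).
  have := rep_linear_l (cm_rep X) 1 0 0 (sec_snd z); rewrite !scale1r !addr0.
  move=> /(congr1 (fun s => s - 0 |> sec_snd z)); rewrite subrr addrK => <-.
  by rewrite addr0.
by apply: eval_atP => p eps; rewrite !eval_atE; ring.
Qed.

Lemma assoc_anchor_br z w f :
  let rho := anc_act (fst_anchor E (la_anchor (cm_algebroid X))) in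
  rho (assoc_br z w) f = rho z (rho w f) - rho w (rho z f).
Proof. by rewrite /= !fst_anchorE sec_fst_pair la_anchor_br. Qed.

(* A_{g |> theta} : the vector bundle A (+) E with bracket
   [x + u, y + v] = [x, y] + [u, v] + x |> v - y |> u. *)
Definition assoc_algebroid : lieAlgebroid (dsum A E) :=
  LieAlgebroid assoc_linear assoc_anti assoc_jacobi assoc_leibniz
    assoc_anchor_br.

End AssociatedAlgebroid.

Section Pairings.
Context {R : realType} {M : manifold R}.
Implicit Types A B E F : vbundle M.

(* B is the dual vector bundle of A through the pairing. *)
Record perfect_pairing A B := PerfectPairing {
  pp :> forall p, B p -> A p -> R;
  pp_linear_l : forall p a (xi eta : B p) (x : A p),
    pp (a *: xi + eta) x = a * pp xi x + pp eta x;
  pp_linear_r : forall p a (xi : B p) (x y : A p),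
    pp xi (a *: x + y) = a * pp xi x + pp xi y;
  pp_nondeg_l : forall p (xi : B p), (forall x : A p, pp xi x = 0) -> xi = 0;
  pp_nondeg_r : forall p (x : A p), (forall xi : B p, pp xi x = 0) -> x = 0;
  pp_smooth : forall (i : vtriv B) (j : vtriv A) k l,
    smooth_in (vdom i `&` vdom j)
              (fun p => pp (tnth (vframe i p) k) (tnth (vframe j p) l))
}.

Lemma pair_sec_subproof A B (pr : perfect_pairing A B) (xi : sec B) (x : sec A) :
  smooth_in setT (fun p => pr p (xi p) (x p)).
Proof.
apply: (@frame_cover _ _ B) => i; rewrite setTI.
apply: (@frame_cover _ _ A) => j.
have o : open (vdom i `&` vdom j) by apply: openI; exact: vdom_open.
apply: (smooth_lin (i := i) (L := fun p v => pr p v (x p))) => //.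
  by move=> p a v w; exact: pp_linear_l.
move=> k; apply: (smooth_lin (i := j)
   (L := fun p v => pr p (tnth (vframe i p) k) v)) => //.
  by move=> p a v w; exact: pp_linear_r.
by move=> l; exact: pp_smooth.
Qed.

Definition pair_sec A B (pr : perfect_pairing A B) (xi : sec B) (x : sec A) :
  Cinf M := mkCinf (pair_sec_subproof pr xi x).

Lemma eval_smooth E (i : vtriv (dual E)) (j : vtriv E) k l :
  smooth_in (vdom i `&` vdom j)
    (fun p => (tnth (vframe i p) k : 'Hom(E p, R^o)) (tnth (vframe j p) l)).
Proof.
have o : open (vdom i `&` vdom j) by apply: openI; exact: vdom_open.
apply: (smooth_eq o _ (@vframe_smooth R M E i j k l)) => p _.
by rewrite tnth_mktuple lfunE.
Qed.

Definition dual_pairing E : perfect_pairing E (dual E).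
Proof.
refine (@PerfectPairing E (dual E)
          (fun p (eps : 'Hom(E p, R^o)) (e : E p) => eps e) _ _ _ _ _).
- by move=> p a xi eta x; rewrite add_lfunE scale_lfunE.
- by move=> p a xi x y; rewrite linearP.
- by move=> p xi H; apply/lfunP => x; rewrite H zero_lfunE.
- by move=> p x H; apply: hom_sep => eps; rewrite H linear0.
- exact: eval_smooth.
Defined.

(* (A (+) E)^* = E^* (+) A^* :  <(tau, gam), (x, u)> = <gam, x> + <tau, u>. *)
Definition dsum_pairing A E :
  perfect_pairing (dsum A E) (dsum (dual E) (dual A)).
Proof.
refine (@PerfectPairing (dsum A E) (dsum (dual E) (dual A))
          (fun p (xi : ('Hom(E p, R^o) * 'Hom(A p, R^o))%type)
                 (x : (A p * E p)%type) => xi.2 x.1 + xi.1 x.2) _ _ _ _ _).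
- move=> p a xi eta x /=; rewrite !add_lfunE !scale_lfunE mulrDr.
  by rewrite addrACA.
- by move=> p a xi x y /=; rewrite !linearP /= mulrDr addrACA.
- move=> p [xi eta] H; apply: injective_projections; apply/lfunP => /= x.
    by have := H (0, x); rewrite /= linear0 add0r => ->; rewrite zero_lfunE.
  by have := H (x, 0); rewrite /= linear0 addr0 => ->; rewrite zero_lfunE.
- move=> p [x u] H; apply: injective_projections; apply: hom_sep => eps /=.
    by have := H (0, eps); rewrite /= zero_lfunE addr0 linear0.
  by have := H (eps, 0); rewrite /= zero_lfunE add0r linear0.
- move=> ij ij' k l.
  have o : open (vdom ij `&` vdom ij') by apply: openI; exact: vdom_open.
  case: ij ij' o => i j [i' j'] o; rewrite -[k]fintype.splitK -[l]fintype.splitK.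
  case: (fintype.split k) => k'; case: (fintype.split l) => l' /=.
  + apply: (smooth_eq o _ (smooth_cst _ 0)) => p _.
    by rewrite !tnth_lshift !tnth_map /= zero_lfunE linear0 addr0.
  + apply: (smooth_eq o _ (smooth_sub _ (@eval_smooth E i j' k' l'))).
      move=> p _; rewrite tnth_lshift tnth_rshift !tnth_map /=.
      by rewrite zero_lfunE add0r.
    by move=> p [[? _] [_ ?]].
  + apply: (smooth_eq o _ (smooth_sub _ (@eval_smooth A j i' k' l'))).
      move=> p _; rewrite tnth_lshift tnth_rshift !tnth_map /=.
      by rewrite zero_lfunE addr0.
    by move=> p [[_ ?] [? _]].
  + apply: (smooth_eq o _ (smooth_cst _ 0)) => p _.
    by rewrite !tnth_rshift !tnth_map /= zero_lfunE linear0 addr0.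
Defined.

End Pairings.

Section LieBialgebroids.
Context {R : realType} {M : manifold R}.
Implicit Types A B E F : vbundle M.

(* For B dual to A, a section of wedge^k A is encoded as an alternating
   C^oo(M)-multilinear form of k arguments in Gamma(B). Forms of all degrees
   share one type: a form of degree k vanishes on lists of length other
   than k. *)
Definition form B := seq (sec B) -> Cinf M.

Record is_form B (k : nat) (u : form B) : Prop := IsForm {
  form_deg : forall s, size s <> k -> u s = 0;
  form_linear : forall s1 s2 f x y,
    u (s1 ++ (f *: x + y) :: s2) = f * u (s1 ++ x :: s2) + u (s1 ++ y :: s2);
  form_alt : forall s1 s2 s3 x, u (s1 ++ x :: s2 ++ x :: s3) = 0
}.

Definition form_fun B (f : Cinf M) : form B :=
  fun s => if s is [::] then f else 0.

Definition form_sec A B (pr : perfect_pairing A B) (x : sec A) : form B :=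
  fun s => if s is [:: xi] then pair_sec pr xi x else 0.

Definition form_lin B (a : R) (u v : form B) : form B :=
  fun s => cinf_cst a * u s + v s.

(* The arguments selected by the mask m go to u, the others to v, in order;
   the sign is that of the corresponding shuffle. *)
Definition wedge B (u v : form B) : form B := fun s =>
  \sum_(m : (size s).-tuple bool)
    (-1) ^+ (\sum_(j < size s) \sum_(i < size s | (i < j)%N)
               (~~ tnth m i && tnth m j : nat))
    * (u (mask m s) * v (mask (map negb m) s)).

Definition del T (i : nat) (s : seq T) := take i s ++ drop i.+1 s.

(* The Lie algebroid differential of B, on sections of wedge B^*. *)
Definition la_diff B (L : lieAlgebroid B) (u : form B) : form B := fun s =>
  \sum_(i < size s) (-1) ^+ i * anc_act (la_anchor L) s`_i (u (del i s)) +
  \sum_(j < size s) \sum_(i < size s | (i < j)%N)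
    (-1) ^+ (i + j) * u (la_br L s`_i s`_j :: del i (del j s)).

(* br is the Schouten bracket of A: the extension of the bracket and anchor of
   A to a graded biderivation of degree -1. These properties determine br on
   homogeneous elements; its values elsewhere are irrelevant. The exponents
   k.+1 and l.+1 stand for k - 1 and l - 1. *)
Record is_schouten A B (pr : perfect_pairing A B) (L : lieAlgebroid A)
    (br : form B -> form B -> form B) : Prop := IsSchouten {
  sch_deg : forall k l m u v, is_form k u -> is_form l v -> (k + l)%N = m.+1 ->
    is_form m (br u v);
  sch_deg0 : forall u v, is_form 0 u -> is_form 0 v -> br u v =1 (fun=> 0);
  sch_linear : forall k l a u u' v, is_form k u -> is_form k u' -> is_form l v ->
    br (form_lin a u u') v =1 form_lin a (br u v) (br u' v);
  sch_anti : forall k l u v, is_form k u -> is_form l v ->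
    br u v =1 (fun s => - (-1) ^+ (k.+1 * l.+1) * br v u s);
  sch_fun : forall x f,
    br (form_sec pr x) (form_fun f) =1 form_fun (anc_act (la_anchor L) x f);
  sch_sec : forall x y,
    br (form_sec pr x) (form_sec pr y) =1 form_sec pr (la_br L x y);
  sch_leibniz : forall k l m u v w, is_form k u -> is_form l v -> is_form m w ->
    br u (wedge v w) =1
    (fun s => wedge (br u v) w s + (-1) ^+ (k.+1 * l) * wedge v (br u w) s)
}.

Definition lie_bialgebroid A B (pr : perfect_pairing A B)
    (LA : lieAlgebroid A) (LB : lieAlgebroid B) : Prop :=
  exists2 br, is_schouten pr LA br &
    forall k l u v, is_form k u -> is_form l v ->
      la_diff LB (br u v) =1
      (fun s => br (la_diff LB u) v s + (-1) ^+ k.+1 * br u (la_diff LB v) s).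

Definition lie_bialgebroid_crossed_module E A (phi : bundle_map E A)
    (X : crossed_module phi) (Y : crossed_module (neg_transpose phi)) : Prop :=
  lie_bialgebroid (dsum_pairing A E) (assoc_algebroid X) (assoc_algebroid Y).

(* actd on E^* and act on E are dual to each other:
   rho(x)<eps | e> = <x |> eps | e> + <eps | x |> e>. *)
Definition dual_actions A E (rho : anchor_map A)
    (actd : sec A -> sec (dual E) -> sec (dual E))
    (act : sec A -> sec E -> sec E) : Prop :=
  forall x eps e,
    anc_act rho x (pair_sec (dual_pairing E) eps e) =
    pair_sec (dual_pairing E) (actd x eps) e +
    pair_sec (dual_pairing E) eps (act x e).

Record matched_pair (P Q : vbundle M) (LP : lieAlgebroid P) (LQ : lieAlgebroid Q)
    (aPQ : sec P -> sec Q -> sec Q) (aQP : sec Q -> sec P -> sec P) : Prop :=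
  MatchedPair {
  mp_repP : is_representation LP aPQ;
  mp_repQ : is_representation LQ aQP;
  mp_anchor : forall X Y f,
    let rP := anc_act (la_anchor LP) in let rQ := anc_act (la_anchor LQ) in
    rP X (rQ Y f) - rQ Y (rP X f) = - rP (aQP Y X) f + rQ (aPQ X Y) f;
  mp_brQ : forall X Y1 Y2,
    aPQ X (la_br LQ Y1 Y2) =
    la_br LQ (aPQ X Y1) Y2 + la_br LQ Y1 (aPQ X Y2)
    + aPQ (aQP Y2 X) Y1 - aPQ (aQP Y1 X) Y2;
  mp_brP : forall Y X1 X2,
    aQP Y (la_br LP X1 X2) =
    la_br LP (aQP Y X1) X2 + la_br LP X1 (aQP Y X2)
    + aQP (aPQ X2 Y) X1 - aQP (aPQ X1 Y) X2
}.

End LieBialgebroids.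

(* Main.v *)
Require Import Defs.
From mathcomp Require Import all_boot all_order all_algebra.
From mathcomp Require Import all_classical all_reals all_analysis.
From mathcomp Require Import ring lra.
(* Imported again: the libraries above shadow [form]. *)
Require Import Defs.

(** A Schouten bracket of an algebroid A is constructed on alternating forms on
    the dual bundle B by recursion on the list of arguments, from
      i_xi [u, v] = [i_xi u, v] - (-1)^k [u, i_xi v] + T_(d xi)(u, v),
    where T_om is the C^oo-bilinear operation which in dual frames reads
    - sum om(e_a, e_b) i_(eps^a) u /\ i_(eps^b) v.  Graded antisymmetry, the
    Leibniz rule and tensoriality follow by induction on the arguments.  Cut-off
    functions give global sections that are local frames, so by Euler's identity
    sum e_a /\ i_(eps^a) v = k v every biderivation of forms is determined by its
    values on functions and sections.  This shows that the Schouten bracket is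
    unique, and that (A, B) is a Lie bialgebroid as soon as the defect
      d_*[u, v] - [d_*u, v] - (-1)^(k-1) [u, d_*v]
    vanishes on functions and sections.

    For A = g (+) theta and B = theta^* (+) g^* , the defect vanishes on pairs of
    functions, its value on (x + u, f) at (tau, gamma) is minus the anchor
    condition for (x, tau) applied to f, and its value on (x1 + u1, x2 + u2) at
    (tau + gamma, tau' + gamma') is
      <gamma', P(tau + phi^T gamma; x1, x2)> - <gamma, P(tau'; x1, x2)>
      + Q(x1 + phi u1, u2; tau, tau') - Q(x2, u1; tau, tau'),
    where P and Q are the failures of the two remaining conditions of a matched
    pair, Q being taken modulo the anchor condition.  The crossed module
    identities are what makes the other terms cancel. *)

Set Implicit Arguments.
Unset Strict Implicit.
Unset Printing Implicit Defensive.
Import Order.TTheory GRing.Theory Num.Theory numFieldNormedType.Exports.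
Local Open Scope classical_set_scope.
Local Open Scope ring_scope.

(** * Cut-off functions *)

Section Flat.
Context {R : realType}.
Implicit Types (n : nat) (t : R).

(** The powers of 1/t are carried along so that all derivatives of exp(-1/t) stay in the span of the
    family. *)
Definition flat n t : R := if 0 < t then t^-1 ^+ n * expR (- t^-1) else 0.

Lemma flat_ge0 n t : 0 <= flat n t.
Proof.
rewrite /flat; case: ifP => // t0.
by rewrite mulr_ge0 ?expR_ge0 // exprn_ge0 // invr_ge0 ltW.
Qed.

(** The Taylor term of order n+1 of the exponential at 1/t gives t^-(n+1) <= (n+1)! exp(1/t). The
    bound controls the difference quotient of [flat] at 0. *)
Lemma flat_le n t : 0 < t -> flat n t <= (n.+1)`!%:R * t.
Proof.
move=> t0; rewrite /flat t0 expRN ler_pdivrMr ?expR_gt0 //.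
have s0 : 0 < t^-1 by rewrite invr_gt0.
have := expR_ge1Dxn n (ltW s0); set e := expR _ => h.
have he : t^-1 ^+ n.+1 <= (n.+1)`!%:R * e.
  rewrite -ler_pdivrMl ?ltr0n ?fact_gt0 // mulrC; apply: le_trans h.
  by rewrite lerDr ler01.
have -> : t^-1 ^+ n = t * t^-1 ^+ n.+1.
  by rewrite exprS mulrA divff ?mul1r // gt_eqF.
by rewrite mulrAC [leRHS]mulrC ler_pM2l.
Qed.

Lemma is_derive_flat n t :
  is_derive t 1 (flat n) (flat n.+2 t - n%:R * flat n.+1 t).
Proof.
have [t0|t0|->] := ltgtP t 0.
- have -> : flat n.+2 t - n%:R * flat n.+1 t = 0.
    by rewrite /flat ltNge (ltW t0) /= mulr0 subr0.
  apply: (@near_eq_is_derive _ R R (cst 0)).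
  near=> s; rewrite /flat; case: ifP => // s0; suff : s < 0 by rewrite ltNge (ltW s0).
  near: s; exact: lt_nbhsl.
- apply: (@near_eq_is_derive _ R R (fun s => s^-1 ^+ n * expR (- s^-1))).
    near=> s; rewrite /flat ifT //; near: s; exact: lt_nbhsr.
  have tn0 : t != 0 by rewrite gt_eqF.
  have dV : is_derive t 1 (fun s : R => s^-1) (- t ^- 2 *: 1).
    exact: (@is_deriveV _ id).
  have dE : is_derive t 1 (fun s : R => expR (- s^-1)) (expR (- t^-1) * (- (- t ^- 2 *: 1))).
    exact: (@is_derive1_comp _ expR).
  have dX := is_deriveX n dV.
  rewrite (_ : (fun s : R => _) = (fun s : R => s^-1) ^+ n * (fun s : R => expR (- s^-1))); last first.
    by apply/funext => s; rewrite !fctE.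
  apply: (is_derive_eq (is_deriveM dX dE)).
  rewrite !fctE /GRing.scale /= !mulr1.
  rewrite /flat t0; case: n {dX} => [|n] /=.
    by rewrite expr0; field.
  by rewrite !exprS; field.
- have -> : flat n.+2 0 - n%:R * flat n.+1 0 = 0 :> R.
    by rewrite /flat ltxx mulr0 subr0.
  (* At 0 the difference quotient is [flat n.+1 h] for h > 0 and 0 for h < 0, so the linear bound
     sends it to 0. *)
  have H : (fun h => h^-1 *: ((flat n \o shift 0) (h *: (1 : R)) - flat n 0)) @ 0^' --> (0 : R).
    apply/cvgr0Pnorm_lt => e e0; near=> h.
    have h0 : h != 0 by near: h; exact: nbhs_dnbhs_neq.
    rewrite /= addr0 [_ *: 1]mulr1 {2}/flat ltxx subr0.
    have [hpos|hneg] := ltP 0 h; last by rewrite /flat (ltNge 0 h) hneg scaler0 normr0.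
    rewrite (_ : h^-1 *: flat n h = flat n.+1 h); last first.
      by rewrite /flat hpos exprS -mulrA.
    rewrite ger0_norm ?flat_ge0 //; apply: le_lt_trans (flat_le _ hpos) _.
    rewrite mulrC -ltr_pdivlMr ?ltr0n ?fact_gt0 // -[ltLHS]gtr0_norm //.
    near: h; apply: dnbhs0_lt; by rewrite divr_gt0 // ltr0n fact_gt0.
  by apply: DeriveDef; [apply/cvg_ex; exists 0|exact: cvg_lim].
Unshelve. all: by end_near.
Qed.

End Flat.

(** * Calculus of functions of class C^k in a chart *)

Section CkComposition.
Context {R : realType} {n : nat}.
Implicit Types (D : set 'rV[R]_n) (f : 'rV[R]_n -> R).

(** The two difference quotients coincide; directional derivatives thus inherit the chain rule of
    one variable. *)
Lemma is_derive_line (f : 'rV[R]_n -> R) x v df :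
  is_derive (0 : R) 1 (fun h : R => f (h *: v + x)) df <-> is_derive x v f df.
Proof.
suff E : (fun h : R => h^-1 *: (((fun h' : R => f (h' *: v + x)) \o shift 0) (h *: 1)
            - f ((0 : R) *: v + x)))
         = (fun h : R => h^-1 *: ((f \o shift x) (h *: v) - f x)).
  by split=> -[d1 d2]; split; move: d1 d2; rewrite /derivable /derive E.
by apply/funext => h /=; rewrite addr0 scale0r add0r [_%:A]mulr1.
Qed.

Lemma is_derive_comp1 (g : R -> R) f x v a b :
  is_derive (f x) 1 g a -> is_derive x v f b ->
  is_derive x v (fun y => g (f y)) (a * b).
Proof.
move=> dg /is_derive_line df; apply/is_derive_line.
apply: (@is_derive1_comp _ g (fun h : R => f (h *: v + x))) => //.
by rewrite scale0r add0r.
Qed.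

(** Induction on [k] for all [m] at once, since differentiating [flat m] brings in [flat m.+1] and
    [flat m.+2]. *)
Lemma Ck_flat k m D f : open D -> Ck k D f -> Ck k D (fun x => flat m (f x)).
Proof.
move=> oD; have cflat j t : {for t, continuous (@flat R j)}.
  have [/derivable1_diffP + _] := is_derive_flat j t.
  exact: differentiable_continuous.
elim: k m f => [|k IH] m f Hf; have [cf df] := Hf.
  by split=> // x Dx; apply: (@continuous_comp _ _ _ f (flat m)); [exact: cf|exact: cflat].
split=> [x Dx|i].
  by apply: (@continuous_comp _ _ _ f (flat m)); [exact: cf|exact: cflat].
have [f1 f2] := df i.
have dd x : D x -> is_derive x (delta_mx 0 i) (fun y => flat m (f y))
    ((flat m.+2 (f x) - m%:R * flat m.+1 (f x)) * 'D_(delta_mx 0 i) f x).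
  move=> Dx; apply: is_derive_comp1; first exact: is_derive_flat.
  exact/derivableP/f1.
split=> [x /dd[]//|].
have H := CkM oD (CkD oD (IH m.+2 _ (CkW Hf))
  (CkM oD (Ck_cst k D (- m%:R)) (IH m.+1 _ (CkW Hf)))) f2.
apply: (Ck_eq oD _ H) => x Dx; have [_ ->] := dd _ Dx.
by rewrite !fctE mulNr.
Qed.

Lemma CkV k D f : open D -> (forall x, D x -> f x != 0) -> Ck k D f ->
  Ck k D (fun x => (f x)^-1).
Proof.
move=> oD f0; elim: k => [|k IH] Hf; have [cf df] := Hf.
  by split=> // x Dx; apply: continuousV; [exact: f0|exact: cf].
split=> [x Dx|i]; first by apply: continuousV; [exact: f0|exact: cf].
have [f1 f2] := df i; split=> [x Dx|].
  by apply: derivableV; [exact: f0|exact: f1].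
have V := IH (CkW Hf).
apply: (Ck_eq oD _ (CkM oD (CkM oD (CkM oD V V) (Ck_cst k D (-1))) f2)) => x Dx.
rewrite deriveV; [|exact: f0|exact: f1].
by rewrite !fctE /GRing.scale /= expr2 invfM mulrN1.
Qed.

End CkComposition.

(** * Smooth functions and bump functions on the manifold *)

Section SmoothComposition.
Context {R : realType} {M : manifold R}.
Implicit Types (W : set M) (f : M -> R).

Lemma smooth_flat m W f : open W -> smooth_in W f ->
  smooth_in W (fun p => flat m (f p)).
Proof. by move=> oW sf c k; apply: (Ck_flat m _ (sf c k)); exact: chart_image_open. Qed.

Lemma smooth_inv W f : open W -> smooth_in W f -> (forall p, W p -> f p != 0) ->
  smooth_in W (fun p => (f p)^-1).
Proof.
move=> oW sf f0 c k; apply: (CkV _ _ (sf c k)); first exact: chart_image_open.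
by move=> _ [p [dp Wp] <-] /=; rewrite mcoordK //; exact: f0.
Qed.

Lemma smooth_prod W (I : Type) (r : seq I) (F : I -> M -> R) : open W ->
  (forall i, smooth_in W (F i)) -> smooth_in W (fun p => \prod_(i <- r) F i p).
Proof.
move=> oW sF; elim: r => [|i r IH].
  by apply: (smooth_eq oW _ (smooth_cst W 1)) => p _; rewrite big_nil.
by apply: (smooth_eq oW _ (smoothM oW (sF i) IH)) => p _; rewrite big_cons.
Qed.

Lemma smooth_continuous f p : smooth_in setT f -> {for p, continuous f}.
Proof.
move=> sf; have [c cp] := mdom_cover p.
have [+ _] := sf c 0%N; move=> /(_ (mcoord c p)); rewrite setIT => /(_ (ex_intro2 _ _ p cp erefl)) cf.
have cc : {for p, continuous (mcoord c)}.
  have := @mcoord_continuous R M c; rewrite continuous_open_subspace; last exact: mdom_open.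
  by move=> /(_ p); rewrite inE; apply.
have H : {for p, continuous (f \o mparam c \o mcoord c)} by apply: continuous_comp.
move: H; rewrite /prop_for /continuous_at /= mcoordK //; apply: cvg_trans.
apply: (@near_eq_cvg _ _ (nbhs p)).
by apply: filterS (open_nbhs_nbhs (conj (mdom_open c) cp)) => q cq /=; rewrite mcoordK.
Qed.

Lemma open_neq0 (f : Cinf M) : open [set p | f p != 0].
Proof.
have cf : continuous f.
  by move=> p; apply: smooth_continuous; exact: cinf_smooth.
have -> : [set p | f p != 0] = f @^-1` [set x | x != 0].
  by [].
by move/continuousP : cf; apply; exact: open_neq.
Qed.

Lemma smooth_coord (c : mchart M) k : smooth_in (mdom c) (fun p => mcoord c p 0 k).
Proof.
move=> d j; have := @mtransition_smooth R M d c k j.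
by apply: Ck_eq => //; apply: chart_image_open; exact: mdom_open.
Qed.

(* [N] is the complement of a compact set carrying [chi]. *)
Lemma bump_function W p : open W -> W p -> exists (chi : Cinf M) (N : set M),
  [/\ chi p != 0, open N, N `|` W = setT & forall q, N q -> chi q = 0].
Proof.
move=> oW Wp; have [c cp] := mdom_cover p.
set x0 := mcoord c p; set U := mcoord c @` (mdom c `&` W).
have oU : open U by exact: chart_image_open.
have /nbhs_ballP[e /= e0 eU] : nbhs x0 U.
  by apply: open_nbhs_nbhs; split=> //; exists p.
(* The closed cube of half-side e/2 around [x0] lies in the sup-norm ball of radius e, hence in
   [U]. *)
pose r := e / 2.
have r0 : 0 < r by rewrite divr_gt0.
pose K0 := [set x : 'rV[R]_(mdim M) | forall k, `[x0 0 k - r, x0 0 k + r]%classic (x 0 k)].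
have K0U : K0 `<=` U.
  move=> x Kx; apply: eU; split=> // i k; rewrite (ord1 i).
  have := Kx k; rewrite /= in_itv /= => /andP[h1 h2].
  rewrite /ball /= -normrN opprB.
  apply: (@le_lt_trans _ _ r).
    by rewrite ler_norml lerBrDr lerBlDl addrC h1 h2.
  by rewrite ltr_pdivrMr // ltr_pMr // ltr1n.
have cK0 : compact K0 by apply: (@rV_compact R _ (fun k => `[x0 0 k - r, x0 0 k + r]%classic)) => k; exact: segment_compact.
pose K := mparam c @` K0.
have cK : closed K.
  apply: compact_closed; first exact: m_hausdorff.
  apply: continuous_compact => //.
  apply: (continuous_subspaceW _ (@mparam_continuous R M c)) => x /K0U[q [cq _] <-].
  by exists q.
have KW : K `<=` W by move=> _ [x /K0U[q [cq Wq] <-] <-]; rewrite mcoordK.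
have oN : open (~` K) by exact: closed_openC.
(* Each factor is positive exactly where |x_k - x0_k| < r, so the product vanishes off the open cube
   and not at its centre. *)
pose psi q := \prod_k flat 0 (r ^+ 2 - (mcoord c q 0 k - x0 0 k) ^+ 2).
pose chi0 q := if q \in mdom c then psi q else 0.
have chiN q : (~` K) q -> chi0 q = 0.
  move=> Kq; rewrite /chi0; case: ifPn => // /set_mem cq.
  apply: contrapT => /eqP/prodf_neq0 h; apply: Kq; exists (mcoord c q); last exact: mcoordK.
  move=> k; have := h k isT; rewrite /flat; case: ifP => [d0 _|_]; last by rewrite eqxx.
  have : `|mcoord c q 0 k - x0 0 k| <= r.
    rewrite -(@ler_pXn2r _ 2) ?nnegrE ?normr_ge0 ?(ltW r0) // real_normK ?num_real //.
    by rewrite -subr_ge0 ltW.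
  by rewrite ler_norml /= in_itv /= => /andP[h1 h2]; apply/andP; split; lra.
(* Two open sets cover the manifold: the chart domain, where [psi] is smooth, and the complement of
   [K], where the function is 0. *)
have schi : smooth_in setT chi0.
  apply: smooth_glue => q _; have [cq|cq] := pselect (mdom c q).
    exists (mdom c) => //; have oc := @mdom_open R M c.
    have : smooth_in (mdom c) psi.
      apply: smooth_prod => // k; apply: smooth_flat => //.
      have sd := smoothD oc (@smooth_coord c k) (smooth_cst (mdom c) (- x0 0 k)).
      apply: (smooth_eq oc _ (smoothD oc (smooth_cst _ (r ^+ 2)) (smoothN oc (smoothM oc sd sd)))).
      by move=> q' _ /=; rewrite expr2.
    by apply: smooth_eq => // q' cq'; rewrite /chi0 mem_set.
  exists (~` K); last first.
    by apply: (smooth_eq oN _ (smooth_cst _ 0)) => q' /chiN ->.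
  by move=> [x /K0U[q' [cq' _] <-]]; rewrite mcoordK // => qq'; apply: cq; rewrite -qq'.
exists (mkCinf schi), (~` K); split=> //=.
  rewrite /chi0 mem_set //; apply/prodf_neq0 => k _.
  by rewrite subrr expr0n subr0 /flat exprn_gt0 // expr0 mul1r gt_eqF // expR_gt0.
by apply/seteqP; split=> // q _; have [/KW|] := pselect (K q); [right|left].
Qed.

End SmoothComposition.

(** * Alternating forms *)

Section FormCalculus.
Context {R : realType} {M : manifold R} {B : vbundle M}.
Implicit Types (u v w : form B) (s : seq (sec B)) (xi eta : sec B).
Implicit Types (f g : Cinf M) (b c : bool).

Definition contract xi u : form B := fun s => u (xi :: s).
Definition zform : form B := fun=> 0.
Definition fscale f u : form B := fun s => f * u s.
Definition comb f u v : form B := fun s => f * u s + v s.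
(** The grading involution: it supplies the sign (-1)^k of a form of degree k without reference to
    k. *)
Definition altsgn u : form B := fun s => (-1) ^+ size s * u s.

Definition has_parity b u := forall s, odd (size s) != b -> u s = 0.

(* Only the parity of the degree is fixed: contraction then maps [pform b] to
   [pform (~~ b)] without an exception in degree 0. *)
Record pform b u : Prop := PForm {
  pform_par : has_parity b u;
  pform_linear : forall s1 s2 f x y,
    u (s1 ++ (f *: x + y) :: s2) = f * u (s1 ++ x :: s2) + u (s1 ++ y :: s2);
  pform_alt : forall s1 s2 s3 x, u (s1 ++ x :: s2 ++ x :: s3) = 0
}.

Lemma is_form_pform k u : is_form k u -> pform (odd k) u.
Proof.
by case=> d l a; split=> // s h; apply: d => e; rewrite e eqxx in h.
Qed.

Lemma pform_is_form k b u : pform b u ->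
  (forall s, size s <> k -> u s = 0) -> is_form k u.
Proof. by case=> _ l a d; split. Qed.

Lemma pform0 b : pform b zform.
Proof. by split=> // *; rewrite /zform mulr0 addr0. Qed.

Lemma pform_comb b f u v : pform b u -> pform b v -> pform b (comb f u v).
Proof.
case=> [pu lu au] [pv lv av]; split=> [s h|s1 s2 g x y|s1 s2 s3 x];
  rewrite /comb ?(pu _ h, pv _ h) ?(au, av) ?mulr0 ?addr0 // lu lv; ring.
Qed.

Lemma fscaleE f u : fscale f u = comb f u zform.
Proof. by apply/funext => s; rewrite /fscale /comb /zform addr0. Qed.

Lemma is_form_comb k f u v : is_form k u -> is_form k v -> is_form k (comb f u v).
Proof.
move=> hu hv; apply: pform_is_form (pform_comb f (is_form_pform hu) (is_form_pform hv)) _.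
by move=> s h; rewrite /comb (form_deg hu h) (form_deg hv h) mulr0 addr0.
Qed.

Lemma pform_scale b f u : pform b u -> pform b (fscale f u).
Proof. by rewrite fscaleE => /pform_comb; apply; exact: pform0. Qed.

Lemma par_contract b xi u : has_parity b u -> has_parity (~~ b) (contract xi u).
Proof. by move=> h s hs; apply: h; move: hs => /=; case: odd; case: b. Qed.

Lemma pform_contract b xi u : pform b u -> pform (~~ b) (contract xi u).
Proof.
case=> p l a; split=> [|s1 s2 f x y|s1 s2 s3 x]; first exact: par_contract.
  exact: (l (xi :: s1)).
exact: (a (xi :: s1)).
Qed.

Lemma altsgn_par b u : has_parity b u -> altsgn u = fscale ((-1) ^+ b) u.
Proof.
move=> h; apply/funext => s; rewrite /altsgn /fscale.
by have [<-|/h ->] := eqVneq (odd (size s)) b; rewrite ?signr_odd ?mulr0.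
Qed.

Lemma contract_linear b f xi eta u : pform b u ->
  contract (f *: xi + eta) u = comb f (contract xi u) (contract eta u).
Proof. by move=> h; apply/funext => s; exact: (pform_linear h [::] s). Qed.

Lemma contract_contract b xi u : pform b u ->
  contract xi (contract xi u) = zform.
Proof. by move=> h; apply/funext => s; exact: (pform_alt h [::] [::]). Qed.

(** Polarisation of the alternating condition at xi + eta, the sum being written [1 *: xi + eta] to
    fit [pform_linear]. *)
Lemma pform_swap b u s1 s2 xi eta : pform b u ->
  u (s1 ++ xi :: eta :: s2) = - u (s1 ++ eta :: xi :: s2).
Proof.
case=> _ l a; have := a s1 [::] s2 (1 *: xi + eta); rewrite /= l.
set z := 1 *: xi + eta.
rewrite -(cat_rcons xi s1 (z :: _)) -(cat_rcons eta s1 (z :: _)) !l !cat_rcons.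
have := a s1 [::] s2 xi; have := a s1 [::] s2 eta => /= -> ->.
by rewrite mulr0 add0r addr0 !mul1r => /eqP; rewrite addr_eq0 => /eqP.
Qed.

Lemma pform_linear0 b u f x y s : pform b u ->
  u ((f *: x + y) :: s) = f * u (x :: s) + u (y :: s).
Proof. by move=> h; exact: (pform_linear h [::]). Qed.

Lemma contract_swap b xi eta u : pform b u ->
  contract xi (contract eta u) = fscale (-1) (contract eta (contract xi u)).
Proof.
move=> h; apply/funext => s; rewrite /fscale mulN1r.
exact: (pform_swap [::] s eta xi h).
Qed.

(** Adjacent repetitions suffice: polarised, they give the sign under adjacent transpositions, and
    these bring two equal arguments next to each other. *)
Lemma pform_intro b u : has_parity b u ->
  (forall s1 s2 f x y,
    u (s1 ++ (f *: x + y) :: s2) = f * u (s1 ++ x :: s2) + u (s1 ++ y :: s2)) ->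
  (forall s1 s2 x, u (s1 ++ x :: x :: s2) = 0) -> pform b u.
Proof.
move=> p l a; split=> // s1 s2 s3 x.
have swap s1' s2' y z : u (s1' ++ y :: z :: s2') = - u (s1' ++ z :: y :: s2').
  have := a s1' s2' (1 *: y + z); rewrite l; set t := 1 *: y + z.
  rewrite -(cat_rcons y s1' (t :: _)) -(cat_rcons z s1' (t :: _)) !l !cat_rcons.
  by rewrite !a mulr0 add0r addr0 !mul1r => /eqP; rewrite addr_eq0 => /eqP.
elim: s2 s1 => [|y s2 IH] s1 //=.
by rewrite swap -cat_rcons IH oppr0.
Qed.

Lemma sum_tupleS n (F : n.+1.-tuple bool -> Cinf M) :
  \sum_m F m = \sum_(m : n.-tuple bool) F (cons_tuple true m) +
               \sum_(m : n.-tuple bool) F (cons_tuple false m).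
Proof.
rewrite (reindex (fun p : bool * n.-tuple bool => cons_tuple p.1 p.2)) /=.
  by rewrite -(pair_bigA _ (fun b m => F (cons_tuple b m))) big_bool.
exists (fun m => (thead m, behead_tuple m)) => [[b m] _|m _] /=.
  by rewrite theadE; congr pair; exact: val_inj.
by apply: val_inj; case/tupleP: m => b m; rewrite theadE.
Qed.

(** The masks are split according to whether the first argument goes to [u] or to [v]. In the second
    case it is inverted with every later argument given to [u], and these inversions make up the
    sign in [altsgn u]. *)
Lemma wedge_cons u v xi s : wedge u v (xi :: s) =
  wedge (contract xi u) v s + wedge (altsgn u) (contract xi v) s.
Proof.
rewrite /wedge /= sum_tupleS; congr (_ + _); apply: eq_bigr => m _ /=.
  congr (_ ^+ _ * _); rewrite big_ord_recl big_pred0 // add0n.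
  apply: eq_bigr => j _; rewrite big_mkcond big_ord_recl /= add0n.
  rewrite -big_mkcond; apply: eq_bigr => i _.
  by rewrite !(tnth_nth false) /=.
rewrite /altsgn /contract -!mulrA [RHS]mulrA -exprD; congr (_ ^+ _ * _).
rewrite big_ord_recl big_pred0 // add0n addnC.
have -> : size (mask m s) = (\sum_(j < size s) tnth m j)%N.
  rewrite size_mask ?size_tuple // -sumn_count sumnE big_map.
  by rewrite big_tuple.
rewrite -big_split; apply: eq_bigr => j _ /=.
rewrite big_mkcond big_ord_recl /= -big_mkcond; congr (_ + _)%N.
  by rewrite !(tnth_nth false).
by apply: eq_bigr => i _; rewrite !(tnth_nth false).
Qed.

Lemma wedge_nil u v : wedge u v [::] = u [::] * v [::].
Proof.
rewrite /wedge /= (big_pred1 [tuple]) => [|m]; last exact/esym/eqP/tuple0.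
by rewrite big_ord0 expr0 mul1r.
Qed.

Lemma wedge_combl f u u' v :
  wedge (comb f u u') v = comb f (wedge u v) (wedge u' v).
Proof.
apply/funext => s; rewrite /wedge /comb big_distrr -big_split /=.
by apply: eq_bigr => m _; ring.
Qed.

Lemma wedge_combr f u v v' :
  wedge u (comb f v v') = comb f (wedge u v) (wedge u v').
Proof.
apply/funext => s; rewrite /wedge /comb big_distrr -big_split /=.
by apply: eq_bigr => m _; ring.
Qed.

Lemma wedge0l v : wedge zform v = zform.
Proof.
by apply/funext => s; rewrite /wedge big1 // => m _; rewrite mul0r mulr0.
Qed.

Lemma wedge0r u : wedge u zform = zform.
Proof.
by apply/funext => s; rewrite /wedge big1 // => m _; rewrite !mulr0.
Qed.

Lemma wedge_scalel f u v : wedge (fscale f u) v = fscale f (wedge u v).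
Proof. by rewrite !fscaleE wedge_combl wedge0l. Qed.

Lemma wedge_scaler f u v : wedge u (fscale f v) = fscale f (wedge u v).
Proof. by rewrite !fscaleE wedge_combr wedge0r. Qed.

Lemma contract_wedge b u v xi : has_parity b u -> contract xi (wedge u v) =
  comb ((-1) ^+ b) (wedge u (contract xi v)) (wedge (contract xi u) v).
Proof.
move=> pu; apply/funext => s; rewrite /contract wedge_cons (altsgn_par pu).
by rewrite wedge_scalel addrC.
Qed.

Lemma form_fun_par f : has_parity false (form_fun f).
Proof. by case. Qed.

Lemma contract_fun f xi : contract xi (form_fun f) = zform.
Proof. by []. Qed.

Lemma is_form_fun f : is_form 0 (@form_fun _ _ B f).
Proof. by split=> [[]|[|? ?] *|[]] //=; rewrite mulr0 addr0. Qed.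

Lemma wedge_fun f u : wedge (form_fun f) u = fscale f u.
Proof.
apply/funext => s; elim: s u => [|xi s IH] u; first by rewrite wedge_nil.
rewrite wedge_cons contract_fun wedge0l (altsgn_par (@form_fun_par f)).
by rewrite wedge_scalel /fscale IH /zform add0r mul1r.
Qed.

Lemma par_wedge b c u v : has_parity b u -> has_parity c v -> has_parity (b (+) c) (wedge u v).
Proof.
move=> + + s; elim: s b c u v => [|xi s IH] b c u v pu pv h.
  rewrite wedge_nil; case: b pu h => pu; first by rewrite pu ?mul0r.
  by case: c pv => // pv _; rewrite (pv [::]) ?mulr0.
rewrite wedge_cons (altsgn_par pu) wedge_scalel /fscale.
rewrite (IH (~~ b) c) ?(IH b (~~ c)) ?mulr0 ?addr0 //; try exact: par_contract.
  by move: h => /=; case: odd b c {pu pv} => [] [] [].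
by move: h => /=; case: odd b c {pu pv} => [] [] [].
Qed.

(** The graded Leibniz rule of contraction as a recursion on the arguments. Together with
    [wedge_nil] it carries the inductions below without shuffle signs. *)
Lemma wedge_cons_par b u v xi s : has_parity b u -> wedge u v (xi :: s) =
  wedge (contract xi u) v s + (-1) ^+ b * wedge u (contract xi v) s.
Proof. by move=> pu; rewrite wedge_cons (altsgn_par pu) wedge_scalel. Qed.

Lemma pform_wedge b c u v : pform b u -> pform c v ->
  pform (b (+) c) (wedge u v).
Proof.
move=> hu hv; apply: pform_intro; first exact: par_wedge (pform_par hu) (pform_par hv).
  move=> + s2 f x y; move=> s1; elim: s1 b c u v hu hv => [|z s1 IH] b c u v hu hv /=;
    rewrite !(wedge_cons_par _ _ _ (pform_par hu)).
    rewrite (contract_linear _ _ _ hu) (contract_linear _ _ _ hv).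
    by rewrite wedge_combl wedge_combr /comb; ring.
  by rewrite !(IH _ _ _ _ (pform_contract _ hu) hv)
    !(IH _ _ _ _ hu (pform_contract _ hv)); ring.
move=> s1 s2 x; elim: s1 b c u v hu hv => [|z s1 IH] b c u v hu hv /=;
  rewrite !(wedge_cons_par _ _ _ (pform_par hu)).
  rewrite !(wedge_cons_par _ _ _ (pform_par (pform_contract _ hu))).
  rewrite (contract_contract _ hu) (contract_contract _ hv) wedge0l wedge0r.
  by rewrite /zform; case: b {hu} => /=; ring.
by rewrite (IH _ _ _ _ (pform_contract _ hu) hv)
  (IH _ _ _ _ hu (pform_contract _ hv)); ring.
Qed.

Lemma wedge_comm b c u v : has_parity b u -> has_parity c v ->
  wedge u v = fscale ((-1) ^+ (b && c)) (wedge v u).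
Proof.
move=> pu pv; apply/funext => s; rewrite /fscale.
elim: s b c u v pu pv => [|xi s IH] b c u v pu pv.
  rewrite !wedge_nil; case: b pu => pu; last by rewrite /= mul1r mulrC.
  by rewrite (pu [::]) // mul0r !mulr0.
rewrite (wedge_cons_par _ _ _ pu) (wedge_cons_par _ _ _ pv).
rewrite (IH _ _ _ _ (par_contract xi pu) pv) (IH _ _ _ _ pu (par_contract xi pv)).
by case: b c {pu pv IH} => [] [] /=; ring.
Qed.

Lemma contract_deg k xi u : (forall s, size s <> k -> u s = 0) ->
  forall s, size s <> k.-1 -> contract xi u s = 0.
Proof. by move=> h s hs; apply: h => /= e; apply: hs; rewrite -e. Qed.

Lemma is_form_contract k xi u : is_form k u -> is_form k.-1 (contract xi u).
Proof.
case: k => [|k] hu; last first.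
  apply: (@pform_is_form _ (~~ odd k.+1)); first exact: pform_contract (is_form_pform hu).
  exact: contract_deg (form_deg hu).
(* In degree 0 the contraction is the zero form, which counts as a form of any degree, so the
   truncation in [k.-1] does no harm. *)
rewrite (_ : contract xi u = zform); last by apply/funext => s; exact: (form_deg hu).
by apply: (@pform_is_form _ false) => //; exact: pform0.
Qed.

Lemma contract_form0 xi u : is_form 0 u -> contract xi u = zform.
Proof. by move=> hu; apply/funext => s; exact: (form_deg hu). Qed.

Lemma wedge_deg k l u v : (forall s, size s <> k -> u s = 0) ->
  (forall s, size s <> l -> v s = 0) ->
  forall s, size s <> (k + l)%N -> wedge u v s = 0.
Proof.
move=> du dv s hs; rewrite /wedge big1 // => m _.
(* A mask and its complement share out all arguments, so one of the two factors is evaluated off its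
   degree. *)
have E : (size (mask m s) + size (mask (map negb m) s))%N = size s.
  rewrite !size_mask ?size_map ?size_tuple // count_map.
  by rewrite -[X in _ = X](size_tuple m) -(count_predC id).
have [ek|/eqP/du->] := eqVneq (size (mask m s)) k; last by rewrite mul0r mulr0.
have [el|/eqP/dv->] := eqVneq (size (mask (map negb m) s)) l; last by rewrite !mulr0.
by case: hs; rewrite -E ek el.
Qed.

Lemma is_form_wedge k l u v : is_form k u -> is_form l v ->
  is_form (k + l) (wedge u v).
Proof.
move=> hu hv; apply: (@pform_is_form _ (odd (k + l))).
  by rewrite oddD; apply: pform_wedge; exact: is_form_pform.
exact: wedge_deg (form_deg hu) (form_deg hv).
Qed.

End FormCalculus.

(** * The differential of an algebroid *)

Section AlgebroidRules.
Context {R : realType} {M : manifold R}.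

Lemma sign_cst (b : bool) : (-1) ^+ b = cinf_cst ((-1) ^+ b) :> Cinf M.
Proof. by case: b; apply: cinfE => p /=; rewrite ?expr1 ?expr0. Qed.

Section Anchor.
Context {A : vbundle M} (rho : anchor_map A).
Implicit Types (x y : sec A) (f g h : Cinf M).

Lemma anc_act_linear_l f x y h :
  anc_act rho (f *: x + y) h = f * anc_act rho x h + anc_act rho y h.
Proof. by apply: cinfE => p /=; rewrite anc_linear. Qed.

Lemma anc_act_linear_r a x f g : anc_act rho x (cinf_cst a * f + g) =
  cinf_cst a * anc_act rho x f + anc_act rho x g.
Proof. by apply: cinfE => p /=; rewrite tv_linear. Qed.

Lemma anc_actM x f g :
  anc_act rho x (f * g) = anc_act rho x f * g + f * anc_act rho x g.
Proof. by apply: cinfE => p /=; rewrite tv_leibniz. Qed.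

Lemma cinf_cst1 : cinf_cst 1 = 1 :> Cinf M. Proof. exact: cinfE. Qed.
Lemma cinf_cstN1 : cinf_cst (-1) = -1 :> Cinf M. Proof. exact: cinfE. Qed.

Lemma anc_actD x f g : anc_act rho x (f + g) = anc_act rho x f + anc_act rho x g.
Proof. by have := anc_act_linear_r 1 x f g; rewrite cinf_cst1 !mul1r. Qed.

Lemma anc_act_f0 x : anc_act rho x 0 = 0.
Proof. by apply: (addrI (anc_act rho x 0)); rewrite -anc_actD !addr0. Qed.

Lemma anc_actN x f : anc_act rho x (- f) = - anc_act rho x f.
Proof.
by have := anc_act_linear_r (-1) x f 0; rewrite cinf_cstN1 !mulN1r anc_act_f0 !addr0.
Qed.

Lemma anc_actDl x y f : anc_act rho (x + y) f = anc_act rho x f + anc_act rho y f.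
Proof. by have := anc_act_linear_l 1 x y f; rewrite scale1r mul1r. Qed.

Lemma anc_act0l f : anc_act rho 0 f = 0.
Proof. by apply: (addrI (anc_act rho 0 f)); rewrite -anc_actDl !addr0. Qed.

End Anchor.

Section Bracket.
Context {A : vbundle M} (L : lieAlgebroid A).
Implicit Types (x y z : sec A) (f g h : Cinf M).

Lemma la_brDl x y z : la_br L (x + y) z = la_br L x z + la_br L y z.
Proof. by have := la_linear L 1 x y z; rewrite cinf_cst1 !scale1r. Qed.

Lemma la_brDr x y z : la_br L z (x + y) = la_br L z x + la_br L z y.
Proof. by rewrite !(la_anti L z) la_brDl opprD. Qed.

Lemma la_br_linear_l f x y z : la_br L (f *: x + y) z =
  f *: la_br L x z + ((- anc_act (la_anchor L) z f) *: x + la_br L y z).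
Proof.
by rewrite la_brDl la_anti la_leibniz opprD -scalerN -la_anti scaleNr addrA.
Qed.

Lemma la_br_linear_r f x y z : la_br L z (f *: x + y) =
  f *: la_br L z x + (anc_act (la_anchor L) z f *: x + la_br L z y).
Proof. by rewrite la_brDr la_leibniz addrA. Qed.

Lemma la_brxx x : la_br L x x = 0.
Proof.
apply: secE => p /=; have := congr1 (fun s : sec A => s p) (la_anti L x x).
move=> /= /eqP; rewrite -addr_eq0 -mulr2n -scaler_nat scaler_eq0 pnatr_eq0 /=.
by move/eqP.
Qed.
End Bracket.
End AlgebroidRules.

Section Differential.
Context {R : realType} {M : manifold R} {B : vbundle M} (L : lieAlgebroid B).
Implicit Types (u v w : form B) (s : seq (sec B)) (xi eta : sec B).
Implicit Types (f g : Cinf M) (b c : bool).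
Local Notation rho := (anc_act (la_anchor L)).

(** The Lie derivative along [xi]. Each bracket is moved from its place [j] to the front, which
    costs (-1)^j. *)
Definition lie xi u : form B := fun s => rho xi (u s) -
  \sum_(j < size s) (-1) ^+ j * u (la_br L xi s`_j :: del j s).

Lemma del0 T (x : T) t : del 0 (x :: t) = t.
Proof. by rewrite /del /= drop0. Qed.

Lemma delS T i (x : T) t : del i.+1 (x :: t) = x :: del i t.
Proof. by []. Qed.

(** Commutator of contraction and Lie derivative: the bracket with [eta] is the term [j = 0], and in
    the other terms [eta] changes places with the bracket. *)
Lemma lie_cons b u xi eta s : pform b u -> lie xi u (eta :: s) =
  lie xi (contract eta u) s - u (la_br L xi eta :: s).
Proof.
move=> hu; rewrite /lie /= big_ord_recl expr0 mul1r /= del0 opprD addrA addrAC.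
congr (_ - _ - _); apply: eq_bigr => j _; rewrite /= /bump /= add1n delS.
by rewrite /contract (pform_swap [::] _ _ _ hu) exprS /= mulrN mulN1r mulNr opprK.
Qed.

(** Cartan's formula: the terms of d that single out the first argument make up L_xi. With
    [diff_nil] it opens d to induction on the arguments. *)
Lemma diff_cons b u xi s : pform b u -> la_diff L u (xi :: s) =
  lie xi u s - la_diff L (contract xi u) s.
Proof.
move=> hu; rewrite /la_diff /lie /= big_ord_recl expr0 mul1r /= del0.
rewrite [X in _ + X]big_ord_recl [X in _ + (X + _)]big_pred0 // [X in _ + X]add0r.
(* In each inner sum the term [i = 0] belongs to L_xi; in the others the bracket changes places with
   [xi], which gives a term of - d i_xi u. *)
rewrite [X in _ + X = _](eq_bigr (fun j : 'I_(size s) =>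
   - ((-1) ^+ j * u (la_br L xi s`_j :: del j s))
   - \sum_(i < size s | (i < j)%N) (-1) ^+ (i + j) *
     contract xi u (la_br L s`_i s`_j :: del i (del j s)))); last first.
  move=> j _; rewrite big_mkcond big_ord_recl /= -big_mkcond /bump /= !add1n.
  congr (_ + _); first by rewrite add0n exprS mulN1r mulNr delS del0.
  rewrite -sumrN; apply: eq_bigr => i _; rewrite /bump /= !add1n addSn addnS !delS.
  rewrite /contract (pform_swap [::] _ _ _ hu) /= !exprS; ring.
rewrite [X in _ + X + _ = _](eq_bigr (fun j : 'I_(size s) =>
   - ((-1) ^+ j * rho s`_j (contract xi u (del j s))))); last first.
  by move=> i _; rewrite /bump /= add1n exprS delS /contract mulN1r mulNr.
by rewrite big_split /= !sumrN opprD; ring.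
Qed.

Lemma diff_nil u : la_diff L u [::] = 0.
Proof. by rewrite /la_diff !big_ord0 addr0. Qed.

Lemma lie_nil xi u : lie xi u [::] = rho xi (u [::]).
Proof. by rewrite /lie big_ord0 subr0. Qed.

Lemma lie_comb f xi u v s : lie xi (comb f u v) s =
  f * lie xi u s + rho xi f * u s + lie xi v s.
Proof.
rewrite /lie /comb anc_actD anc_actM.
under eq_bigr do rewrite mulrDr mulrCA.
by rewrite big_split /= -big_distrr /=; ring.
Qed.

Lemma anc_act_sign (A : vbundle M) (a : anchor_map A) (x : sec A) b :
  anc_act a x ((-1) ^+ b) = 0.
Proof.
have a1 : anc_act a x 1 = 0.
  by have := anc_actM a x 1 1; rewrite !mul1r mulr1 => e; apply: (addrI (anc_act a x 1)); rewrite addr0 -e.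
by case: b; rewrite /= ?expr1 ?expr0 ?anc_actN a1 ?oppr0.
Qed.

Lemma lie_sign b xi u v :
  lie xi (comb ((-1) ^+ b) u v) = comb ((-1) ^+ b) (lie xi u) (lie xi v).
Proof.
by apply/funext => s; rewrite lie_comb anc_act_sign mul0r addr0.
Qed.

(** The last sum is df /\ u evaluated on [s], the failure of d to be C^oo-linear. *)
Lemma diff_comb f u v s : la_diff L (comb f u v) s =
  f * la_diff L u s + la_diff L v s +
  \sum_(i < size s) (-1) ^+ i * rho s`_i f * u (del i s).
Proof.
rewrite /la_diff.
rewrite [X in X + _ = _](eq_bigr (fun i : 'I_(size s) =>
  f * ((-1) ^+ i * rho s`_i (u (del i s))) + (-1) ^+ i * rho s`_i (v (del i s))
  + (-1) ^+ i * rho s`_i f * u (del i s))); last first.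
  by move=> i _; rewrite /comb anc_actD anc_actM; ring.
rewrite [X in _ + X = _](eq_bigr (fun j : 'I_(size s) =>
  f * (\sum_(i < size s | (i < j)%N)
    (-1) ^+ (i + j) * u (la_br L s`_i s`_j :: del i (del j s))) +
  \sum_(i < size s | (i < j)%N)
    (-1) ^+ (i + j) * v (la_br L s`_i s`_j :: del i (del j s)))); last first.
  move=> j _; rewrite big_distrr -big_split /=; apply: eq_bigr => i _.
  by rewrite /comb; ring.
by rewrite !big_split /= -!big_distrr /=; ring.
Qed.

Lemma diff_sign b u v :
  la_diff L (comb ((-1) ^+ b) u v) = comb ((-1) ^+ b) (la_diff L u) (la_diff L v).
Proof.
apply/funext => s; rewrite diff_comb big1 ?addr0 // => i _.
by rewrite anc_act_sign mulr0 mul0r.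
Qed.

Lemma diff0 : la_diff L zform = zform.
Proof.
apply/funext => s; rewrite /la_diff big1 => [|i _]; last by rewrite anc_act_f0 mulr0.
by rewrite add0r big1 // => j _; rewrite big1 // => i _; rewrite mulr0.
Qed.

Lemma diff_scale_signN b u :
  la_diff L (fscale (- (-1) ^+ b) u) = fscale (- (-1) ^+ b) (la_diff L u).
Proof.
have -> : - (-1) ^+ b = (-1) ^+ (~~ b) :> Cinf M by case: b; rewrite /= ?expr0 ?expr1 ?opprK.
by rewrite !fscaleE diff_sign diff0.
Qed.

Lemma size_del T i (t : seq T) : (i < size t)%N -> size (del i t) = (size t).-1.
Proof.
move=> h; rewrite size_cat size_takel ?size_drop; last exact: ltnW.
by rewrite subnS -!subn1 addnBA ?subn_gt0 // subnKC // ltnW.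
Qed.

(** d evaluates [u] only on lists one entry shorter. Stated for a predicate on lengths, this serves
    degree and parity alike. *)
Lemma diff_vanish (P : pred nat) u : (forall s, P (size s) -> u s = 0) ->
  forall s, P (size s).-1 -> la_diff L u s = 0.
Proof.
move=> h s hs; rewrite /la_diff big1 => [|i _]; last first.
  by rewrite h ?anc_act_f0 ?mulr0 // size_del.
rewrite add0r big1 // => j _; rewrite big1 // => i ij; rewrite h ?mulr0 //=.
have ij' : (i < (size s).-1)%N.
  apply: leq_trans ij _; rewrite -ltnS prednK //.
  exact: leq_ltn_trans (leq0n _) (ltn_ord j).
by rewrite !size_del // prednK // (leq_ltn_trans (leq0n _) ij').
Qed.

Lemma diff_deg k u : (forall s, size s <> k -> u s = 0) ->
  forall s, size s <> k.+1 -> la_diff L u s = 0.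
Proof.
move=> h [_|x s hs]; first exact: diff_nil.
by apply: (@diff_vanish (fun n => n != k)) => [t /eqP|]; [exact: h|apply/eqP => /= e; apply: hs; rewrite /= e].
Qed.

Lemma par_diff b u : has_parity b u -> has_parity (~~ b) (la_diff L u).
Proof.
move=> h [_|x s hs]; first exact: diff_nil.
apply: (@diff_vanish (fun n => odd n != b)) => [t|/=]; first exact: h.
by move: hs => /=; case: odd; case: b {h}.
Qed.

Lemma par_lie b xi u : has_parity b u -> has_parity b (lie xi u).
Proof.
move=> h s hs; rewrite /lie h // anc_act_f0 sub0r big1 ?oppr0 // => j _.
rewrite h ?mulr0 //= size_del //.
by case: s j hs => [[]//|y s] j /=.
Qed.

Lemma contract_lie b eta xi u : pform b u -> contract eta (lie xi u) =
  comb (-1) (contract (la_br L xi eta) u) (lie xi (contract eta u)).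
Proof.
move=> hu; apply/funext => s.
by rewrite /contract (lie_cons _ _ _ hu) /comb mulN1r addrC.
Qed.

Lemma pform_lie b xi u : pform b u -> pform b (lie xi u).
Proof.
move=> hu; apply: pform_intro; first exact: par_lie (pform_par hu).
  move=> + s2 f x y; move=> s1; elim: s1 b u hu => [|z s1 IH] b u hu /=;
    rewrite !(lie_cons _ _ _ hu).
    rewrite (contract_linear _ _ _ hu) lie_comb la_br_linear_r.
    by rewrite !(pform_linear0 _ _ _ _ hu) /contract /=; ring.
  rewrite !(IH _ _ (pform_contract _ hu)).
  by rewrite (pform_linear hu (la_br L xi z :: s1)) /=; ring.
move=> s1 s2 x; elim: s1 b u hu => [|z s1 IH] b u hu /=; rewrite !(lie_cons _ _ _ hu).
  rewrite !(lie_cons _ _ _ (pform_contract _ hu)) (contract_contract _ hu).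
  rewrite [contract x u _](pform_swap [::] s2 x (la_br L xi x) hu) /=.
  rewrite /lie /zform anc_act_f0 big1 => [|j _]; [by ring|exact: mulr0].
by rewrite (IH _ _ (pform_contract _ hu)) (pform_alt hu (_ :: s1) [::]) subr0.
Qed.

Lemma pform_diff b u : pform b u -> pform (~~ b) (la_diff L u).
Proof.
move=> hu; apply: pform_intro; first exact: par_diff (pform_par hu).
  move=> + s2 f x y; move=> s1; elim: s1 b u hu => [|z s1 IH] b u hu /=;
    rewrite !(diff_cons _ _ hu); last first.
    rewrite !(IH _ _ (pform_contract _ hu)) (pform_linear (pform_lie z hu)); ring.
  rewrite (contract_linear _ _ _ hu) diff_comb /lie.
  (* The derivatives of [f] produced by the brackets [f x, -] cancel the df-term of [diff_comb]. *)
  rewrite [X in _ - X - _](eq_bigr (fun j : 'I_(size s2) =>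
    f * ((-1) ^+ j * u (la_br L x s2`_j :: del j s2)) +
    (-1) ^+ j * u (la_br L y s2`_j :: del j s2)
    - (-1) ^+ j * rho s2`_j f * contract x u (del j s2))); last first.
    by move=> j _; rewrite la_br_linear_l !(pform_linear0 _ _ _ _ hu) /contract /=; ring.
  by rewrite !big_split /= sumrN -big_distrr /= anc_act_linear_l; ring.
move=> s1 s2 x; elim: s1 b u hu => [|z s1 IH] b u hu /=; rewrite !(diff_cons _ _ hu).
  rewrite (lie_cons _ _ _ hu) (diff_cons _ _ (pform_contract _ hu)).
  rewrite (contract_contract _ hu) diff0 la_brxx /zform subr0.
  have := pform_linear0 (-1) 0 0 s2 hu.
  by rewrite addr0 scaler0 mulN1r addNr => ->; ring.
rewrite (IH _ _ (pform_contract _ hu)) (pform_alt (pform_lie z hu) s1 [::]).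
by rewrite subr0.
Qed.

Lemma is_form_diff k u : is_form k u -> is_form k.+1 (la_diff L u).
Proof.
move=> hu; apply: (@pform_is_form _ _ _ _ (odd k.+1)).
  exact: pform_diff (is_form_pform hu).
exact: diff_deg (form_deg hu).
Qed.

Lemma lie_wedge b c xi u v : pform b u -> pform c v ->
  lie xi (wedge u v) = comb 1 (wedge (lie xi u) v) (wedge u (lie xi v)).
Proof.
move=> hu hv; apply/funext => s; rewrite /comb mul1r.
elim: s b c u v hu hv => [|eta s IH] b c u v hu hv.
  by rewrite !(lie_nil, wedge_nil) anc_actM.
have pu := pform_par hu.
rewrite (lie_cons _ _ _ (pform_wedge hu hv)) (contract_wedge _ _ pu) lie_sign.
rewrite !(wedge_cons_par _ _ _ pu) (wedge_cons_par _ _ _ (par_lie xi pu)) /comb.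
rewrite (IH _ _ _ _ hu (pform_contract _ hv)) (IH _ _ _ _ (pform_contract _ hu) hv).
rewrite (contract_lie _ _ hu) (contract_lie _ _ hv) wedge_combl wedge_combr /comb.
ring.
Qed.

(** Cartan's formula reduces the Leibniz rule of d, by induction on the arguments, to those of
    contraction and Lie derivative. *)
Lemma diff_wedge b c u v : pform b u -> pform c v ->
  la_diff L (wedge u v) =
  comb ((-1) ^+ b) (wedge u (la_diff L v)) (wedge (la_diff L u) v).
Proof.
move=> hu hv; apply/funext => s; rewrite /comb.
elim: s b c u v hu hv => [|xi s IH] b c u v hu hv.
  by rewrite !(diff_nil, wedge_nil) mul0r !mulr0 addr0.
have pu := pform_par hu.
rewrite (diff_cons _ _ (pform_wedge hu hv)) (contract_wedge _ _ pu) diff_sign.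
rewrite (lie_wedge _ hu hv) !(wedge_cons_par _ _ _ pu).
rewrite (wedge_cons_par _ _ _ (par_diff pu)) /comb.
rewrite (IH _ _ _ _ hu (pform_contract _ hv)) (IH _ _ _ _ (pform_contract _ hu) hv).
have cd b' w : pform b' w -> contract xi (la_diff L w) =
    comb (-1) (la_diff L (contract xi w)) (lie xi w).
  move=> hw; apply/funext => t.
  by rewrite /contract (diff_cons _ _ hw) /comb mulN1r addrC.
rewrite (cd _ _ hu) (cd _ _ hv) wedge_combl wedge_combr /comb.
by case: b {hu pu} => /=; ring.
Qed.

End Differential.

(** * Pairings with local frames *)

Record cut_frame (R : realType) (M : manifold R) (A B : vbundle M) := CutFrame {
  cf_index : finType;
  cf_vec : cf_index -> sec A;
  cf_cov : cf_index -> sec B;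
  cf_cut : Cinf M
}.
Arguments cf_vec {R M A B}.
Arguments cf_cov {R M A B}.

Section FramedPairings.
Context {R : realType} {M : manifold R}.
Implicit Types A B : vbundle M.

(* Near every point there are dual local frames of A and B; multiplying them
   with a cut-off function makes them global sections. *)
Definition framed A B (pr : perfect_pairing A B) :=
  forall p : M, exists F : cut_frame A B,
  [/\ cf_cut F p != 0,
      forall q (v : A q),
        cf_cut F q *: v = \sum_a pr q (cf_cov F a q) v *: cf_vec F a q &
      forall q (xi : B q),
        cf_cut F q *: xi = \sum_a pr q xi (cf_vec F a q) *: cf_cov F a q].

Lemma sec_sum A (I : finType) (s : I -> sec A) p :
  (\sum_a s a) p = \sum_a s a p.
Proof. by elim/big_rec2: _ => // a x y _ <-. Qed.

Section Flip.
Context {A B : vbundle M} (pr : perfect_pairing A B).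

Lemma flip_smooth (i : vtriv A) (j : vtriv B) k l :
  smooth_in (vdom i `&` vdom j)
    (fun p => pr p (tnth (vframe j p) l) (tnth (vframe i p) k)).
Proof. rewrite setIC; exact: pp_smooth. Qed.

Definition flip_pairing : perfect_pairing B A :=
  @PerfectPairing R M B A (fun p x xi => pr p xi x)
    (fun p a x y xi => pp_linear_r pr a xi x y)
    (fun p a x xi eta => pp_linear_l pr a xi eta x)
    (@pp_nondeg_r _ _ _ _ pr) (@pp_nondeg_l _ _ _ _ pr) flip_smooth.

Lemma flip_pair_sec x xi : pair_sec flip_pairing x xi = pair_sec pr xi x.
Proof. exact: cinfE. Qed.

Lemma flip_framed : framed pr -> framed flip_pairing.
Proof. by move=> fr p; have [[I e eps chi] [? ? ?]] := fr p; exists (CutFrame eps e chi). Qed.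
End Flip.

Section Pairing.
Context {A B : vbundle M} (pr : perfect_pairing A B).
Local Notation pair := (pair_sec pr).

Lemma pair_linear_l f xi eta x : pair (f *: xi + eta) x = f * pair xi x + pair eta x.
Proof. by apply: cinfE => p; exact: pp_linear_l. Qed.

Lemma pair_linear_r f xi x y : pair xi (f *: x + y) = f * pair xi x + pair xi y.
Proof. by apply: cinfE => p; exact: pp_linear_r. Qed.

Lemma pairDl xi eta x : pair (xi + eta) x = pair xi x + pair eta x.
Proof. by have := pair_linear_l 1 xi eta x; rewrite scale1r mul1r. Qed.

Lemma pairDr xi x y : pair xi (x + y) = pair xi x + pair xi y.
Proof. by have := pair_linear_r 1 xi x y; rewrite scale1r mul1r. Qed.

Lemma pair0l x : pair 0 x = 0.
Proof. by apply: (addrI (pair 0 x)); rewrite -pairDl !addr0. Qed.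

Lemma pair0r xi : pair xi 0 = 0.
Proof. by apply: (addrI (pair xi 0)); rewrite -pairDr !addr0. Qed.

Lemma pairNl xi x : pair (- xi) x = - pair xi x.
Proof. by apply/eqP; rewrite -addr_eq0 -pairDl addNr pair0l. Qed.

Lemma pairNr xi x : pair xi (- x) = - pair xi x.
Proof. by apply/eqP; rewrite -addr_eq0 -pairDr addNr pair0r. Qed.

Lemma pairZl f xi x : pair (f *: xi) x = f * pair xi x.
Proof. by have := pair_linear_l f xi 0 x; rewrite pair0l !addr0. Qed.

Lemma pairZr f xi x : pair xi (f *: x) = f * pair xi x.
Proof. by have := pair_linear_r f xi x 0; rewrite pair0r !addr0. Qed.

Hypothesis fr : framed pr.

Lemma framed_sep q (v : A q) : (forall xi : sec B, pr q (xi q) v = 0) -> v = 0.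
Proof.
move=> h; have [F [c0 cA _]] := fr q.
have /eqP : cf_cut F q *: v = 0 by rewrite cA big1 // => a _; rewrite h scale0r.
by rewrite scaler_eq0 (negbTE c0) /= => /eqP.
Qed.

Lemma pair_inj_r (x y : sec A) : (forall xi, pair xi x = pair xi y) -> x = y.
Proof.
move=> h; apply: secE => q; apply/eqP; rewrite -subr_eq0; apply/eqP.
apply: framed_sep => xi; have := congr1 (fun f : Cinf M => f q) (h xi) => /= e.
have := pp_linear_r pr (-1) (xi q) (y q) (x q); rewrite scaleN1r addrC => ->.
by rewrite e mulN1r addNr.
Qed.

Lemma framed_sec p : exists F : cut_frame A B,
  [/\ cf_cut F p != 0,
    forall x, cf_cut F *: x = \sum_a pair (cf_cov F a) x *: cf_vec F a &
    forall xi, cf_cut F *: xi = \sum_a pair xi (cf_vec F a) *: cf_cov F a].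
Proof.
have [F [c0 cA cB]] := fr p.
exists F; split=> // [x|xi]; apply: secE => q; rewrite sec_sum /=.
  exact: cA.
exact: cB.
Qed.

(** Near a point the section must be the sum of F(eps^a) e_a divided by the cut-off. As [F] is
    tensorial, these local sections agree and glue to a smooth one. *)
Lemma framed_riesz (F : sec B -> Cinf M) :
  (forall f xi eta, F (f *: xi + eta) = f * F xi + F eta) ->
  exists x, forall xi, pair xi x = F xi.
Proof.
move=> Fl.
have F0 : F 0 = 0.
  by have := Fl (-1) 0 0; rewrite scaler0 addr0 mulN1r addNr.
have Fsum (I : finType) (f : I -> Cinf M) (z : I -> sec B) :
    F (\sum_a f a *: z a) = \sum_a f a * F (z a).
  by elim/big_rec2: _ => // a x y _ <-; rewrite Fl.
have [c H] := choice fr.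
pose chi p := cf_cut (c p); pose e p := cf_vec (c p); pose eps p := cf_cov (c p).
pose z p : sec A := \sum_a F (eps p a) *: e p a.
have zE p xi : pair xi (z p) = chi p * F xi.
  have [_ _ cB] := H p.
  have -> : chi p * F xi = F (chi p *: xi) by rewrite -[_ *: _]addr0 Fl F0 addr0.
  have -> : chi p *: xi = \sum_a pair xi (e p a) *: eps p a.
    by apply: secE => q; rewrite sec_sum; exact: cB.
  rewrite Fsum /z; elim/big_rec2: _ => [|a x y _ IH]; first exact: pair0r.
  by rewrite pair_linear_r IH mulrC.
(* The value at [q] uses the frame chosen for [q] itself. By [x0E] it equals the quotient formed
   with any other chosen frame wherever the cut-off of that frame is nonzero, whence smoothness. *)
pose x0 q : A q := (chi q q)^-1 *: z q q.
have x0E p q : z p q = chi p q *: x0 q.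
  have [c0 _ _] := H q; rewrite /x0 scalerA.
  apply/eqP; rewrite -subr_eq0; apply/eqP; apply: framed_sep => xi.
  have := pp_linear_r pr (- (chi p q / chi q q)) (xi q) (z q q) (z p q).
  rewrite scaleNr addrC => ->.
  have := congr1 (fun f : Cinf M => f q) (zE p xi) => /= ->.
  have := congr1 (fun f : Cinf M => f q) (zE q xi) => /= ->.
  by rewrite mulNr mulrA divfK // addNr.
have x0s : smooth_section x0.
  move=> i k; apply: smooth_glue => p ip; have [c0 _ _] := H p.
  have o : open (vdom i `&` [set q | chi p q != 0]).
    by apply: openI; [exact: vdom_open|exact: open_neq0].
  exists (vdom i `&` [set q | chi p q != 0]) => //.
  have s1 : smooth_in (vdom i `&` [set q | chi p q != 0])
      (fun q => coord (vframe i q) k (z p q)).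
    by apply: smooth_sub (secP (z p) i k); exact: subIsetl.
  have s2 : smooth_in (vdom i `&` [set q | chi p q != 0]) (fun q => (chi p q)^-1).
    by apply: smooth_inv => //; [exact: cinf_smooth|move=> q []].
  apply: (smooth_eq o _ (smoothM o s2 s1)) => q [iq cq].
  by rewrite x0E linearZ /= mulrA mulVf // mul1r.
exists (Sec x0s) => xi; apply: cinfE => q /=; have [c0 _ _] := H q.
have := congr1 (fun f : Cinf M => f q) (zE q xi) => /=; rewrite x0E.
have := pp_linear_r pr (chi q q) (xi q) (x0 q) 0; rewrite addr0 => ->.
have -> : pr q (xi q) 0 = 0.
  by have := pp_linear_r pr (-1) (xi q) 0 0; rewrite scaler0 addr0 mulN1r addNr.
by rewrite addr0 => /mulfI; exact.
Qed.

End Pairing.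

Lemma pair_inj_l A B (pr : perfect_pairing A B) (fr : framed pr) (xi eta : sec B) :
  (forall x, pair_sec pr xi x = pair_sec pr eta x) -> xi = eta.
Proof.
move=> h; apply: (pair_inj_r (flip_framed fr)) => x.
by rewrite !flip_pair_sec.
Qed.

Lemma framed_riesz_l A B (pr : perfect_pairing A B) (fr : framed pr)
    (F : sec A -> Cinf M) :
  (forall f x y, F (f *: x + y) = f * F x + F y) ->
  exists xi, forall x, pair_sec pr xi x = F x.
Proof.
move=> /(framed_riesz (flip_framed fr))[xi h].
by exists xi => x; rewrite -h flip_pair_sec.
Qed.

End FramedPairings.

(** * Global sections from local frames *)

Section CutOff.
Context {R : realType} {M : manifold R}.
Implicit Types A E F : vbundle M.

Lemma cut_smooth F (W N : set M) (chi : Cinf M) (s : forall q, F q) :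
  open W -> open N -> N `|` W = setT -> (forall q, N q -> chi q = 0) ->
  (forall i k, smooth_in (vdom i `&` W) (fun q => coord (vframe i q) k (s q))) ->
  smooth_section (fun q => chi q *: s q).
Proof.
move=> oW oN NW chi0 ss i k; apply: smooth_glue => q iq.
have oi := @vdom_open _ _ F i.
have [Nq|Wq] : (N `|` W) q by rewrite NW.
  exists (vdom i `&` N) => //; apply: (smooth_eq _ _ (smooth_cst _ 0)); first exact: openI.
  by move=> q' [_ /chi0 ->]; rewrite scale0r linear0.
have o : open (vdom i `&` W) by exact: openI.
exists (vdom i `&` W) => //.
apply: (smooth_eq o _ (smoothM o (cinf_smooth chi _) (ss i k))) => q' _.
by rewrite linearZ.
Qed.

Lemma cut_frame_exists F (i : vtriv F) (W N : set M) (chi : Cinf M) :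
  open W -> open N -> N `|` W = setT -> (forall q, N q -> chi q = 0) -> W `<=` vdom i ->
  exists e : 'I_(vrank F) -> sec F,
    forall k q, e k q = chi q *: tnth (vframe i q) k.
Proof.
move=> oW oN NW chi0 Wi.
have H k : smooth_section (fun q => chi q *: tnth (vframe i q) k).
  apply: (cut_smooth oW oN NW chi0) => j l; apply: smooth_sub (@vframe_smooth _ _ F j i l k).
  by move=> q [jq /Wi].
by exists (fun k => Sec (H k)).
Qed.

Lemma framed_dsum A E : framed (dsum_pairing A E).
Proof.
move=> p; have [i ip] := vdom_cover A p; have [j jp] := vdom_cover E p.
pose W := vdom i `&` vdom j.
have oW : open W by apply: openI; exact: vdom_open.
have [chi [N [chip oN NW chi0]]] := bump_function oW (conj ip jp : W p).
have Wi : W `<=` vdom i by move=> q [].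
have Wj : W `<=` vdom j by move=> q [].
have [e eE] := cut_frame_exists oW oN NW chi0 Wi.
have [f fE] := cut_frame_exists oW oN NW chi0 Wj.
have [e' e'E] := @cut_frame_exists (dual A) i _ _ _ oW oN NW chi0 Wi.
have [f' f'E] := @cut_frame_exists (dual E) j _ _ _ oW oN NW chi0 Wj.
(* Frame and dual frame each carry one factor [chi], so the expansion on [W] acquires its square; on
   [N] both sides vanish. *)
have expand (F : vbundle M) (l : vtriv F) (h : 'I_(vrank F) -> sec F)
    (h' : 'I_(vrank F) -> sec (dual F)) :
    (forall k q, h k q = chi q *: tnth (vframe l q) k) ->
    (forall k q, h' k q = chi q *: tnth (@vframe _ _ (dual F) l q) k) ->
    W `<=` vdom l -> forall q,
    (forall v : F q, (chi q * chi q) *: v = \sum_k (h' k q : 'Hom(F q, R^o)) v *: h k q) /\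
    (forall eps : dual F q,
      (chi q * chi q) *: eps = \sum_k (eps : 'Hom(F q, R^o)) (h k q) *: h' k q).
  move=> hE h'E Wl q; have [Nq|Wq] : (N `|` W) q by rewrite NW.
    split=> v; rewrite (chi0 _ Nq) mulr0 scale0r big1 // => k _.
      by rewrite hE chi0 // scale0r scaler0.
    by rewrite h'E chi0 // scale0r scaler0.
  split=> [v|eps].
    rewrite {1}(frame_expand v (Wl _ Wq)) scaler_sumr; apply: eq_bigr => k _.
    rewrite hE h'E scale_lfunE tnth_mktuple lfunE /= !scalerA.
    by congr (_ *: _); rewrite /GRing.scale /=; ring.
  rewrite {1}(@frame_expand _ _ (dual F) l q eps (Wl _ Wq)) scaler_sumr.
  apply: eq_bigr => k _; rewrite (dual_frameP (Wl _ Wq)).2 hE h'E.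
  rewrite (linearZ_LR (eps : 'Hom(F q, R^o))) !scalerA.
  by congr (_ *: _); exact: mulrAC.
pose vec (a : 'I_(vrank A) + 'I_(vrank E)) : sec (dsum A E) :=
  match a with inl k => sec_pair (e k) 0 | inr l => sec_pair 0 (f l) end.
pose cov (a : 'I_(vrank A) + 'I_(vrank E)) : sec (dsum (dual E) (dual A)) :=
  match a with inl k => sec_pair 0 (e' k) | inr l => sec_pair (f' l) 0 end.
exists (CutFrame vec cov (chi * chi)); split=> /=.
- by rewrite mulf_neq0.
- move=> q [x u]; rewrite big_sumType /=.
  have [Ax _] := expand _ _ _ _ eE e'E Wi q; have [Eu _] := expand _ _ _ _ fE f'E Wj q.
  apply: injective_projections; rewrite /= !raddf_sum /=.
    rewrite [X in _ + X]big1 ?addr0 => [|l _]; last by rewrite scaler0.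
    by rewrite Ax; apply: eq_bigr => k _; rewrite zero_lfunE addr0.
  rewrite [X in X + _]big1 ?add0r => [|l _]; last by rewrite scaler0.
  by rewrite Eu; apply: eq_bigr => k _; rewrite zero_lfunE add0r.
- move=> q [x u]; rewrite big_sumType /=.
  have [_ Ax] := expand _ _ _ _ eE e'E Wi q; have [_ Eu] := expand _ _ _ _ fE f'E Wj q.
  apply: injective_projections; rewrite /= !raddf_sum /=.
    rewrite [X in X + _]big1 ?add0r => [|l _]; last by rewrite scaler0.
    by rewrite Eu; apply: eq_bigr => k _; rewrite linear0 add0r.
  rewrite [X in _ + X]big1 ?addr0 => [|l _]; last by rewrite scaler0.
  by rewrite Ax; apply: eq_bigr => k _; rewrite linear0 addr0.
Qed.

End CutOff.

(** * The Schouten bracket *)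

Section SchoutenBracket.
Context {R : realType} {M : manifold R} {A B : vbundle M}.
Context (pr : perfect_pairing A B) (LA : lieAlgebroid A) (fr : framed pr).
Implicit Types (u v w : form B) (s : seq (sec B)) (xi eta : sec B) (x y z : sec A).
Implicit Types (f g : Cinf M) (b c : bool).
Local Notation pair := (pair_sec pr).
Local Notation rho := (anc_act (la_anchor LA)).

(* Junk value 0 when the values on singletons are not represented by a section. *)
Definition sharp u : sec A := xget 0 [set x | forall xi, pair xi x = u [:: xi]].
Definition dsec f : sec B := xget 0 [set xi | forall x, pair xi x = rho x f].

Lemma sharpE b u xi : pform b u -> pair xi (sharp u) = u [:: xi].
Proof.
move=> hu; rewrite /sharp; case: xgetP => [x _ //|h].
have [x hx] := framed_riesz fr (fun f xi eta => pform_linear0 f xi eta [::] hu).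
by case: (h x).
Qed.

Lemma dsecE f x : pair (dsec f) x = rho x f.
Proof.
rewrite /dsec; case: xgetP => [xi _ //|h].
have [xi hx] := framed_riesz_l fr (fun g y z => anc_act_linear_l (la_anchor LA) g y z f).
by case: (h xi).
Qed.

Lemma sharp_comb b f u v : pform b u -> pform b v ->
  sharp (comb f u v) = f *: sharp u + sharp v.
Proof.
move=> hu hv; apply: (pair_inj_r fr) => xi.
by rewrite (sharpE _ (pform_comb f hu hv)) pair_linear_r (sharpE _ hu) (sharpE _ hv).
Qed.

Lemma sharp0 : sharp zform = 0.
Proof. by apply: (pair_inj_r fr) => xi; rewrite (sharpE _ (pform0 false)) pair0r. Qed.

Lemma sharp_vanish b u : pform b u -> (forall xi, u [:: xi] = 0) -> sharp u = 0.
Proof. by move=> hu h; apply: (pair_inj_r fr) => xi; rewrite (sharpE _ hu) h pair0r. Qed.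

Lemma sharp_even u : pform false u -> sharp u = 0.
Proof. by move=> hu; apply: (sharp_vanish hu) => xi; exact: (pform_par hu). Qed.

Lemma sharp_sec x : sharp (form_sec pr x) = x.
Proof.
rewrite /sharp; case: xgetP => [y _ h|h]; last by case: (h x).
by apply: (pair_inj_r fr) => xi; rewrite h.
Qed.

Lemma is_form_sec x : is_form 1 (form_sec pr x).
Proof.
split=> [[|xi [|eta s]]|[|? [|? ?]] [|? ?] *|[|? [|? ?]] [|? [|? ?]] [|? ?] *] //=;
  rewrite ?mulr0 ?addr0 //; exact: pair_linear_l.
Qed.

Lemma dsec_linear a f g : dsec (cinf_cst a * f + g) = cinf_cst a *: dsec f + dsec g.
Proof.
apply: (pair_inj_l fr) => x.
by rewrite pair_linear_l !dsecE anc_act_linear_r.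
Qed.

Lemma dsecM f g : dsec (f * g) = g *: dsec f + f *: dsec g.
Proof.
by apply: (pair_inj_l fr) => x; rewrite pairDl !pairZl !dsecE anc_actM mulrC.
Qed.

Lemma dsec0 : dsec 0 = 0.
Proof. by apply: (pair_inj_l fr) => x; rewrite dsecE anc_act_f0 pair0l. Qed.

Record altbil (om : sec A -> sec A -> Cinf M) : Prop := AltBil {
  altbil_linear : forall f x y z, om (f *: x + y) z = f * om x z + om y z;
  altbil_anti : forall x y, om x y = - om y x
}.

(** The differential of [xi] as a 1-form on the algebroid A, the d xi in the recursion for the
    bracket. *)
Definition dcov xi x y : Cinf M :=
  rho x (pair xi y) - rho y (pair xi x) - pair xi (la_br LA x y).

Lemma altbil_dcov xi : altbil (dcov xi).
Proof.
split=> [f x y z|x y]; rewrite /dcov.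
  rewrite la_br_linear_l !pair_linear_r anc_act_linear_l anc_actD anc_actM; ring.
by rewrite (la_anti LA x y) pairNr; ring.
Qed.

Lemma altbil0l om : altbil om -> forall z, om 0 z = 0.
Proof.
by move=> h z; have := altbil_linear h (-1) 0 0 z; rewrite scaler0 addr0 mulN1r addNr.
Qed.

Lemma altbil_linear_r om : altbil om ->
  forall f x y z, om z (f *: x + y) = f * om z x + om z y.
Proof.
move=> h f x y z; rewrite (altbil_anti h) (altbil_linear h) (altbil_anti h x).
by rewrite (altbil_anti h y); ring.
Qed.

Lemma altbil0r om : altbil om -> forall z, om z 0 = 0.
Proof. by move=> h z; rewrite (altbil_anti h) (altbil0l h) oppr0. Qed.

(* The operation T_om of the header. As the recursion does not know the degree
   of [u], [altsgn] supplies the sign (-1)^k; the same holds for [schouten]. *)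
Fixpoint tor (om : sec A -> sec A -> Cinf M) u v s {struct s} : Cinf M :=
  if s is xi :: s' then
    tor om (altsgn u) (contract xi v) s' - tor om (contract xi u) v s'
  else - om (sharp u) (sharp v).

Lemma altsgn_comb f u v : altsgn (comb f u v) = comb f (altsgn u) (altsgn v).
Proof. by apply/funext => s; rewrite /altsgn /comb; ring. Qed.

Lemma altsgn0 : altsgn zform = zform :> form B.
Proof. by apply/funext => s; rewrite /altsgn /zform mulr0. Qed.

Lemma pform_altsgn b u : pform b u -> pform b (altsgn u).
Proof. by move=> hu; rewrite (altsgn_par (pform_par hu)); exact: pform_scale. Qed.

(** * The bilinear operation attached to an alternating 2-form *)

Section Torsion.
Context (om : sec A -> sec A -> Cinf M) (hom : altbil om).

Lemma tor_combl b c f u u' v : pform b u -> pform b u' -> pform c v ->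
  tor om (comb f u u') v = comb f (tor om u v) (tor om u' v).
Proof.
move=> hu hu' hv; apply/funext => s; rewrite /comb.
elim: s b c u u' v hu hu' hv => [|xi s IH] b c u u' v hu hu' hv /=.
  by rewrite (sharp_comb _ hu hu') (altbil_linear hom); ring.
rewrite altsgn_comb.
rewrite (IH _ _ _ _ _ (pform_altsgn hu) (pform_altsgn hu') (pform_contract xi hv)).
rewrite (IH _ _ _ _ _ (pform_contract xi hu) (pform_contract xi hu') hv); ring.
Qed.

Lemma tor_combr b c f u v v' : pform b u -> pform c v -> pform c v' ->
  tor om u (comb f v v') = comb f (tor om u v) (tor om u v').
Proof.
move=> hu hv hv'; apply/funext => s; rewrite /comb.
elim: s b c u v v' hu hv hv' => [|xi s IH] b c u v v' hu hv hv' /=.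
  by rewrite (sharp_comb _ hv hv') (altbil_linear_r hom); ring.
rewrite (IH _ _ _ _ _ (pform_altsgn hu) (pform_contract xi hv) (pform_contract xi hv')).
rewrite (IH _ _ _ _ _ (pform_contract xi hu) hv hv'); ring.
Qed.

Lemma tor0l v : tor om zform v = zform.
Proof.
apply/funext => s; rewrite /zform; elim: s v => [|xi s IH] v /=.
  by rewrite sharp0 (altbil0l hom) oppr0.
have -> : contract xi zform = zform by [].
by rewrite altsgn0 !IH subr0.
Qed.

Lemma tor0r u : tor om u zform = zform.
Proof.
apply/funext => s; rewrite /zform; elim: s u => [|xi s IH] u /=.
  by rewrite sharp0 (altbil0r hom) oppr0.
have -> : contract xi zform = zform by [].
by rewrite !IH subr0.
Qed.

Lemma tor_cons b c u v xi s : pform b u -> pform c v ->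
  tor om u v (xi :: s) =
  (-1) ^+ b * tor om u (contract xi v) s - tor om (contract xi u) v s.
Proof.
move=> hu hv /=; rewrite (altsgn_par (pform_par hu)) fscaleE.
by rewrite (tor_combl _ hu (pform0 b) (pform_contract xi hv)) tor0l /comb /zform addr0.
Qed.

Lemma par_tor b c u v : pform b u -> pform c v -> has_parity (b (+) c) (tor om u v).
Proof.
move=> + + s; elim: s b c u v => [|xi s IH] b c u v hu hv h.
  rewrite /=; case: b c hu hv h => [] [] // hu hv _.
    by rewrite (sharp_even hv) (altbil0r hom) oppr0.
  by rewrite (sharp_even hu) (altbil0l hom) oppr0.
rewrite (tor_cons _ _ hu hv) (IH _ _ _ _ hu (pform_contract xi hv)).
  rewrite (IH _ _ _ _ (pform_contract xi hu) hv) ?mulr0 ?subr0 //.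
  by move: h => /=; case: odd b c {hu hv} => [] [] [].
by move: h => /=; case: odd b c {hu hv} => [] [] [].
Qed.

Lemma contract_tor b c u v xi : pform b u -> pform c v ->
  contract xi (tor om u v) =
  comb ((-1) ^+ b) (tor om u (contract xi v)) (fscale (-1) (tor om (contract xi u) v)).
Proof.
move=> hu hv; apply/funext => s.
by rewrite /contract (tor_cons _ _ hu hv) /comb /fscale mulN1r.
Qed.

Lemma tor_anti b c u v : pform b u -> pform c v ->
  tor om u v = fscale (- (-1) ^+ (~~ b && ~~ c)) (tor om v u).
Proof.
move=> hu hv; apply/funext => s; rewrite /fscale.
elim: s b c u v hu hv => [|xi s IH] b c u v hu hv.
  rewrite /= (altbil_anti hom); case: b c hu hv => [] [] hu hv /=; try ring.
  by rewrite (sharp_even hu) (altbil0r hom); ring.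
rewrite (tor_cons _ _ hu hv) (tor_cons _ _ hv hu).
rewrite (IH _ _ _ _ hu (pform_contract xi hv)) (IH _ _ _ _ (pform_contract xi hu) hv).
by case: b c {hu hv} => [] [] /=; ring.
Qed.

(** T_om contracts once into each of its arguments, and contractions are graded derivations. *)
Lemma tor_wedge b c d u v w : pform b u -> pform c v -> pform d w ->
  tor om u (wedge v w) =
  comb ((-1) ^+ (b && c)) (wedge v (tor om u w)) (wedge (tor om u v) w).
Proof.
move=> hu hv hw; apply/funext => s; rewrite /comb.
elim: s b c d u v w hu hv hw => [|xi s IH] b c d u v w hu hv hw.
  (* The sign (-1)^c is invisible on a single argument: for odd [v] the factor [v [::]] vanishes. *)
  have -> : tor om u (wedge v w) [::] = - om (sharp u) (w [::] *: sharp v + v [::] *: sharp w).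
    rewrite /=; congr (- om _ _); apply: (pair_inj_r fr) => xi.
    rewrite (sharpE _ (pform_wedge hv hw)) (wedge_cons_par _ _ _ (pform_par hv)).
    rewrite pair_linear_r pairZr (sharpE _ hv) (sharpE _ hw) !wedge_nil /contract.
    case: c hv => hv; last by rewrite expr0; ring.
    by rewrite (pform_par hv (s := [::])) //; ring.
  rewrite (altbil_linear_r hom) -[_ *: sharp w]addr0 (altbil_linear_r hom).
  rewrite (altbil0r hom) !wedge_nil /=.
  case: c hv => hv; last by rewrite andbF; ring.
  by rewrite (pform_par hv (s := [::])) //; ring.
have pv := pform_par hv.
rewrite (tor_cons _ _ hu (pform_wedge hv hw)) (contract_wedge _ _ pv).
rewrite (tor_combr _ hu (pform_wedge hv (pform_contract xi hw))); last first.
  by have := pform_wedge (pform_contract xi hv) hw; rewrite addbN addNb.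
rewrite (wedge_cons_par _ _ _ pv) (wedge_cons_par _ _ _ (par_tor hu hv)).
rewrite (contract_tor _ hu hv) (contract_tor _ hu hw).
rewrite wedge_combl wedge_combr wedge_scalel wedge_scaler /comb /fscale.
rewrite (IH _ _ _ _ _ _ hu hv (pform_contract xi hw)).
rewrite (IH _ _ _ _ _ _ hu (pform_contract xi hv) hw).
rewrite (IH _ _ _ _ _ _ (pform_contract xi hu) hv hw).
by case: b c {hu hv pv} => [] [] /=; ring.
Qed.

Lemma pform_tor b c u v : pform b u -> pform c v -> pform (b (+) c) (tor om u v).
Proof.
move=> hu hv; apply: pform_intro; first exact: par_tor hu hv.
  move=> + s2 f x y; move=> s1; elim: s1 b c u v hu hv => [|z s1 IH] b c u v hu hv;
    rewrite ?cat0s ?cat_cons !(tor_cons _ _ hu hv).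
    rewrite (contract_linear _ _ _ hu) (contract_linear _ _ _ hv).
    rewrite (tor_combl _ (pform_contract x hu) (pform_contract y hu) hv).
    by rewrite (tor_combr _ hu (pform_contract x hv) (pform_contract y hv)) /comb; ring.
  rewrite (IH _ _ _ _ hu (pform_contract z hv)).
  by rewrite (IH _ _ _ _ (pform_contract z hu) hv); ring.
move=> s1 s2 x; elim: s1 b c u v hu hv => [|z s1 IH] b c u v hu hv;
  rewrite ?cat0s ?cat_cons !(tor_cons _ _ hu hv).
  rewrite (tor_cons _ _ hu (pform_contract x hv)) (tor_cons _ _ (pform_contract x hu) hv).
  rewrite (contract_contract _ hu) (contract_contract _ hv) tor0l tor0r /zform.
  by case: b {hu} => /=; ring.
rewrite (IH _ _ _ _ hu (pform_contract z hv)).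
by rewrite (IH _ _ _ _ (pform_contract z hu) hv); ring.
Qed.

Lemma tor_deg k l u v : is_form k u -> is_form l v ->
  forall s, (size s).+2 <> (k + l)%N -> tor om u v s = 0.
Proof.
move=> + + s; elim: s k l u v => [|xi s IH] k l u v hu hv h.
  rewrite /=; have pu := is_form_pform hu; have pv := is_form_pform hv.
  have [k1|k1] := eqVneq k 1%N; last first.
    rewrite (sharp_vanish pu) ?(altbil0l hom) ?oppr0 // => xi.
    by apply: (form_deg hu) => /esym/eqP; apply/negP.
  rewrite (sharp_vanish pv) ?(altbil0r hom) ?oppr0 // => xi.
  by apply: (form_deg hv) => /= l1; apply: h; rewrite k1 -l1.
rewrite (tor_cons _ _ (is_form_pform hu) (is_form_pform hv)).
have -> : tor om (contract xi u) v s = 0.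
  case: k hu h => [|k] hu h; first by rewrite (contract_form0 xi hu) tor0l.
  by apply: (IH _ _ _ _ (is_form_contract xi hu) hv) => e; apply: h; rewrite addSn -e.
have -> : tor om u (contract xi v) s = 0.
  case: l hv h => [|l] hv h; first by rewrite (contract_form0 xi hv) tor0r.
  by apply: (IH _ _ _ _ hu (is_form_contract xi hv)) => e; apply: h; rewrite addnS -e.
by rewrite mulr0 subr0.
Qed.

End Torsion.

Lemma tor_lin_form f om om' u v s :
  tor (fun x y => f * om x y + om' x y) u v s = f * tor om u v s + tor om' u v s.
Proof.
by elim: s u v => [|xi s IH] u v /=; rewrite ?IH; ring.
Qed.

Lemma tor_eq om om' u v s : (forall x y, om x y = om' x y) ->
  tor om u v s = tor om' u v s.
Proof. by move=> h; elim: s u v => [|xi s IH] u v /=; rewrite ?h ?IH. Qed.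

Lemma altbil_wedge2 xi eta : altbil (fun x y => pair xi x * pair eta y - pair xi y * pair eta x).
Proof. by split=> [f x y z|x y]; rewrite ?pair_linear_r; ring. Qed.

(** For a decomposable 2-form the operation becomes a difference of products of contractions. Such a
    form, df /\ xi, occurs in d(f xi), so this evaluates the correction in the tensoriality of the
    bracket. *)
Lemma tor_wedge2 b c xi eta u v s : pform b u -> pform c v ->
  tor (fun x y => pair xi x * pair eta y - pair xi y * pair eta x) u v s =
  wedge (contract eta u) (contract xi v) s - wedge (contract xi u) (contract eta v) s.
Proof.
elim: s b c u v => [|z s IH] b c u v hu hv.
  by rewrite /= !wedge_nil !(sharpE _ hu) !(sharpE _ hv) /contract; ring.
have h t := par_contract t (pform_par hu).
rewrite (tor_cons (altbil_wedge2 xi eta) _ _ hu hv) !(wedge_cons_par _ _ _ (h _)).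
rewrite (IH _ _ _ _ hu (pform_contract z hv)) (IH _ _ _ _ (pform_contract z hu) hv).
rewrite !(contract_swap _ z hv) !(contract_swap z _ hu) !wedge_scalel !wedge_scaler /fscale.
by case: b {hu h} => /=; ring.
Qed.

(** On the empty list homogeneous forms contribute only in degrees (1, 0) and (0, 1), with the
    values [x, f] = rho(x) f and [f, x] = - rho(x) f. *)
Fixpoint schouten u v s {struct s} : Cinf M :=
  if s is xi :: s' then
    schouten (contract xi u) v s' - schouten (altsgn u) (contract xi v) s'
    + tor (dcov xi) u v s'
  else u [:: dsec (v [::])] - v [:: dsec (u [::])].

Lemma schouten_combl b c a u u' v : pform b u -> pform b u' -> pform c v ->
  schouten (comb (cinf_cst a) u u') v =
  comb (cinf_cst a) (schouten u v) (schouten u' v).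
Proof.
move=> hu hu' hv; apply/funext => s; rewrite /comb.
elim: s b c u u' v hu hu' hv => [|xi s IH] b c u u' v hu hu' hv /=.
  by rewrite /comb dsec_linear (pform_linear0 _ _ _ _ hv); ring.
rewrite altsgn_comb (tor_combl (altbil_dcov xi) _ hu hu' hv) /comb.
rewrite (IH _ _ _ _ _ (pform_altsgn hu) (pform_altsgn hu') (pform_contract xi hv)).
rewrite (IH _ _ _ _ _ (pform_contract xi hu) (pform_contract xi hu') hv); ring.
Qed.

Lemma schouten_combr b c a u v v' : pform b u -> pform c v -> pform c v' ->
  schouten u (comb (cinf_cst a) v v') =
  comb (cinf_cst a) (schouten u v) (schouten u v').
Proof.
move=> hu hv hv'; apply/funext => s; rewrite /comb.
elim: s b c u v v' hu hv hv' => [|xi s IH] b c u v v' hu hv hv' /=.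
  by rewrite /comb dsec_linear (pform_linear0 _ _ _ _ hu); ring.
rewrite (tor_combr (altbil_dcov xi) _ hu hv hv') /comb.
rewrite (IH _ _ _ _ _ (pform_altsgn hu) (pform_contract xi hv) (pform_contract xi hv')).
rewrite (IH _ _ _ _ _ (pform_contract xi hu) hv hv'); ring.
Qed.

Lemma schouten_combr_sign b c (d : bool) u v v' :
  pform b u -> pform c v -> pform c v' ->
  schouten u (comb ((-1) ^+ d) v v') =
  comb ((-1) ^+ d) (schouten u v) (schouten u v').
Proof. by rewrite sign_cst; exact: schouten_combr. Qed.

Lemma schouten0l c v : pform c v -> schouten zform v = zform.
Proof.
move=> hv; have := schouten_combl (-1) (pform0 c) (pform0 c) hv.
rewrite (_ : comb _ _ _ = zform) => [->|]; apply/funext => s; rewrite /comb /zform ?mulr0 ?addr0 //.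
by rewrite cinf_cstN1 mulN1r addNr.
Qed.

Lemma schouten0r b u : pform b u -> schouten u zform = zform.
Proof.
move=> hu; have := schouten_combr (-1) hu (pform0 b) (pform0 b).
rewrite (_ : comb _ _ _ = zform) => [->|]; apply/funext => s; rewrite /comb /zform ?mulr0 ?addr0 //.
by rewrite cinf_cstN1 mulN1r addNr.
Qed.

Lemma schouten_cons b c u v xi s : pform b u -> pform c v ->
  schouten u v (xi :: s) = schouten (contract xi u) v s
  - (-1) ^+ b * schouten u (contract xi v) s + tor (dcov xi) u v s.
Proof.
move=> hu hv /=; rewrite (altsgn_par (pform_par hu)) fscaleE sign_cst.
rewrite (schouten_combl _ hu (pform0 b) (pform_contract xi hv)).
by rewrite (schouten0l (pform_contract xi hv)) /comb /zform addr0.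
Qed.

Lemma contract_schouten b c u v xi : pform b u -> pform c v ->
  contract xi (schouten u v) = comb (- (-1) ^+ b) (schouten u (contract xi v))
    (comb 1 (schouten (contract xi u) v) (tor (dcov xi) u v)).
Proof.
move=> hu hv; apply/funext => s.
by rewrite /contract (schouten_cons _ _ hu hv) /comb; ring.
Qed.

Lemma par_schouten b c u v : pform b u -> pform c v -> has_parity (~~ (b (+) c)) (schouten u v).
Proof.
move=> + + s; elim: s b c u v => [|xi s IH] b c u v hu hv h.
  rewrite /=; case: b c hu hv h => [] [] // hu hv _.
    rewrite (pform_par hv (s := [::])) // (pform_par hu (s := [::])) // dsec0.
    have z b w : pform b w -> w [:: 0] = 0.
      move=> hw; have := pform_linear0 (-1) 0 0 [::] hw.
      by rewrite scaler0 addr0 mulN1r addNr.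
    by rewrite (z _ _ hu) (z _ _ hv) subrr.
  by rewrite (pform_par hu) // (pform_par hv) // subrr.
rewrite (schouten_cons _ _ hu hv) (IH _ _ _ _ hu (pform_contract xi hv)); last first.
  by move: h => /=; case: odd b c {hu hv} => [] [] [].
rewrite (IH _ _ _ _ (pform_contract xi hu) hv); last first.
  by move: h => /=; case: odd b c {hu hv} => [] [] [].
rewrite (par_tor (altbil_dcov xi) hu hv) ?mulr0 ?subr0 ?addr0 //.
by move: h => /=; case: odd b c {hu hv} => [] [] [].
Qed.

Lemma schouten_anti b c u v : pform b u -> pform c v ->
  schouten u v = fscale (- (-1) ^+ (~~ b && ~~ c)) (schouten v u).
Proof.
move=> hu hv; apply/funext => s; rewrite /fscale.
elim: s b c u v hu hv => [|xi s IH] b c u v hu hv.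
  case: b c hu hv => [] [] hu hv /=; try ring.
  by rewrite (pform_par hu (s := [:: _])) // (pform_par hv (s := [:: _])) //; ring.
rewrite (schouten_cons _ _ hu hv) (schouten_cons _ _ hv hu).
rewrite (IH _ _ _ _ hu (pform_contract xi hv)) (IH _ _ _ _ (pform_contract xi hu) hv).
rewrite (tor_anti (altbil_dcov xi) hu hv) /fscale.
by case: b c {hu hv} => [] [] /=; ring.
Qed.

Lemma schouten_wedge b c d u v w : pform b u -> pform c v -> pform d w ->
  schouten u (wedge v w) =
  comb ((-1) ^+ (~~ b && c)) (wedge v (schouten u w)) (wedge (schouten u v) w).
Proof.
move=> hu hv hw; apply/funext => s; rewrite /comb.
elim: s b c d u v w hu hv hw => [|xi s IH] b c d u v w hu hv hw.
  rewrite /= !wedge_nil (wedge_cons_par _ _ _ (pform_par hv)) !wedge_nil dsecM.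
  rewrite (pform_linear0 _ _ _ _ hu) -[_ *: dsec (w _)]addr0 (pform_linear0 _ _ _ _ hu).
  have -> : u [:: 0] = 0.
    have := pform_linear0 (-1) 0 0 [::] hu.
    by rewrite scaler0 addr0 mulN1r addNr.
  rewrite /contract /=; case: c hv => hv; last by rewrite andbF; ring.
  by rewrite (pform_par hv (s := [::])) //; ring.
have pv := pform_par hv.
have hvw := pform_wedge hv hw.
rewrite (schouten_cons _ _ hu hvw) (contract_wedge _ _ pv).
rewrite (schouten_combr_sign _ hu (pform_wedge hv (pform_contract xi hw))); last first.
  by have := pform_wedge (pform_contract xi hv) hw; rewrite addbN addNb.
rewrite (wedge_cons_par _ _ _ pv) (wedge_cons_par _ _ _ (par_schouten hu hv)).
rewrite (contract_schouten _ hu hv) (contract_schouten _ hu hw).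
rewrite !wedge_combl !wedge_combr (tor_wedge (altbil_dcov xi) hu hv hw) /comb.
rewrite (IH _ _ _ _ _ _ hu hv (pform_contract xi hw)).
rewrite (IH _ _ _ _ _ _ hu (pform_contract xi hv) hw).
rewrite (IH _ _ _ _ _ _ (pform_contract xi hu) hv hw).
by case: b c {hu hv pv hvw} => [] [] /=; ring.
Qed.

(** The contraction of a function and its T with any form vanish, so the recursion only contracts
    [v] until, on the empty list, df is inserted. *)
Lemma schouten_fun c f v : pform c v ->
  schouten (form_fun f) v = fscale (-1) (contract (dsec f) v).
Proof.
move=> hv; apply/funext => s; rewrite /fscale /contract mulN1r.
have hf := is_form_pform (@is_form_fun _ _ B f).
elim: s c v hv => [|xi s IH] c v hv; first by rewrite /= sub0r.
rewrite (schouten_cons _ _ hf hv) (IH _ _ (pform_contract xi hv)) contract_fun.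
rewrite (schouten0l hv) [tor _ _ _ _](_ : _ = 0).
  by rewrite /contract /= (pform_swap [::] _ _ _ hv) /zform /=; ring.
elim: s c v hv {IH} => [|eta s IH] c v hv.
  by rewrite /= (sharp_even hf) (altbil0l (altbil_dcov _)) oppr0.
rewrite (tor_cons (altbil_dcov xi) _ _ hf hv) contract_fun (tor0l (altbil_dcov xi)).
by rewrite (IH _ _ (pform_contract eta hv)) mulr0 subr0.
Qed.

(** f u is the product of a function and [u]. Antisymmetry moves it to the second slot, where the
    Leibniz rule and [schouten_fun] produce the correction by df. *)
Lemma schouten_scalel b c f u v : pform b u -> pform c v ->
  schouten (fscale f u) v = comb f (schouten u v)
    (fscale (- (-1) ^+ (b && ~~ c)) (wedge (contract (dsec f) v) u)).
Proof.
move=> hu hv; have hf := is_form_pform (@is_form_fun _ _ B f).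
rewrite (schouten_anti (pform_scale f hu) hv) -(wedge_fun f u) (schouten_wedge hv hf hu).
rewrite (schouten_anti hv hf) (schouten_fun _ hv) !wedge_scalel wedge_fun.
rewrite (schouten_anti hu hv) /comb /fscale; apply/funext => s.
by case: b c {hu hv} => [] [] /=; ring.
Qed.

(** The middle term is df /\ xi; its factor 1 puts the sum into the shape of [tor_lin_form]. *)
Lemma dcov_linear f xi eta x y : dcov (f *: xi + eta) x y =
  f * dcov xi x y + (1 * (pair (dsec f) x * pair xi y - pair (dsec f) y * pair xi x)
  + dcov eta x y).
Proof.
by rewrite /dcov !dsecE !pair_linear_l !anc_actD !anc_actM; ring.
Qed.

Lemma schouten_combf b c f u u' v : pform b u -> pform b u' -> pform c v ->
  schouten (comb f u u') v = comb 1 (schouten (fscale f u) v) (schouten u' v).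
Proof.
move=> hu hu' hv; rewrite -cinf_cst1 -(schouten_combl _ (pform_scale f hu) hu' hv).
by congr schouten; apply/funext => s; rewrite /comb /fscale cinf_cst1 mul1r.
Qed.

(** Tensoriality in an argument: when [x] is replaced by f x, both contracted brackets pick up terms
    with df, and T of df /\ x cancels them. *)
Lemma pform_schouten b c u v : pform b u -> pform c v ->
  pform (~~ (b (+) c)) (schouten u v).
Proof.
move=> hu hv; apply: pform_intro; first exact: par_schouten hu hv.
  move=> + s2 f x y; move=> s1; elim: s1 b c u v hu hv => [|z s1 IH] b c u v hu hv;
    rewrite ?cat0s ?cat_cons !(schouten_cons _ _ hu hv).
    have [hxu hyu] := (pform_contract x hu, pform_contract y hu).
    have [hxv hyv] := (pform_contract x hv, pform_contract y hv).
    rewrite (tor_eq _ _ _ (dcov_linear f x y)) tor_lin_form tor_lin_form.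
    rewrite (tor_wedge2 _ _ _ hu hv).
    rewrite (contract_linear _ _ _ hu) (contract_linear _ _ _ hv).
    rewrite (schouten_combf f hxu hyu hv) (schouten_scalel f hxu hv).
    have hc := pform_comb f hxv hyv.
    rewrite (schouten_anti hu hc) (schouten_combf f hxv hyv hu) (schouten_scalel f hxv hu).
    rewrite (schouten_anti hu hxv) (schouten_anti hu hyv) /comb /fscale.
    rewrite (wedge_comm (par_contract (dsec f) (pform_par hv)) (pform_par hxu)) /fscale.
    by case: b c {hu hv hxu hxv hyu hyv hc} => [] [] /=; ring.
  rewrite (IH _ _ _ _ hu (pform_contract z hv)) (IH _ _ _ _ (pform_contract z hu) hv).
  by rewrite (pform_linear (pform_tor (altbil_dcov z) hu hv)); ring.
move=> s1 s2 x; elim: s1 b c u v hu hv => [|z s1 IH] b c u v hu hv;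
  rewrite ?cat0s ?cat_cons !(schouten_cons _ _ hu hv).
  have [hxu hxv] := (pform_contract x hu, pform_contract x hv).
  rewrite (schouten_cons _ _ hu hxv) (schouten_cons _ _ hxu hv).
  rewrite (tor_cons (altbil_dcov x) _ _ hu hv).
  rewrite (contract_contract _ hu) (contract_contract _ hv).
  rewrite (schouten0l hv) (schouten0r hu) /zform.
  by case: b {hu hxu} => /=; ring.
rewrite (IH _ _ _ _ hu (pform_contract z hv)) (IH _ _ _ _ (pform_contract z hu) hv).
by rewrite (pform_alt (pform_tor (altbil_dcov z) hu hv) s1 [::]); ring.
Qed.

Lemma schouten_deg k l u v : is_form k u -> is_form l v ->
  forall s, (size s).+1 <> (k + l)%N -> schouten u v s = 0.
Proof.
move=> + + s; elim: s k l u v => [|xi s IH] k l u v hu hv h.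
  (* A nonzero value on the empty list requires degrees 1 and 0 in some order, whose sum 1 is
     excluded by [h]. *)
  have E k' l' u' v' : is_form k' u' -> is_form l' v' -> (k' + l')%N <> 1%N ->
      u' [:: dsec (v' [::])] = 0.
    move=> hu' hv' h'; have [k1|k1] := eqVneq k' 1%N; last first.
      by rewrite (form_deg hu') // => /esym/eqP; apply/negP.
    have [l0|l0] := eqVneq l' 0%N; first by case: h'; rewrite k1 l0.
    rewrite (form_deg hv') => [|/= /esym/eqP]; last exact/negP.
    rewrite dsec0; have := pform_linear0 (-1) 0 0 [::] (is_form_pform hu').
    by rewrite scaler0 addr0 mulN1r addNr.
  rewrite /= (E _ _ _ _ hu hv) ?(E _ _ _ _ hv hu) ?subrr //.
    by rewrite addnC => e; apply: h; rewrite e.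
  by move=> e; apply: h; rewrite e.
have [pu pv] := (is_form_pform hu, is_form_pform hv).
rewrite (schouten_cons _ _ pu pv) (tor_deg (altbil_dcov xi) hu hv) //.
have -> : schouten (contract xi u) v s = 0.
  case: k hu h {pu} => [|k] hu h; first by rewrite (contract_form0 xi hu) (schouten0l pv).
  by apply: (IH _ _ _ _ (is_form_contract xi hu) hv) => e; apply: h; rewrite addSn -e.
have -> : schouten u (contract xi v) s = 0.
  case: l hv h {pv} => [|l] hv h; first by rewrite (contract_form0 xi hv) (schouten0r pu).
  by apply: (IH _ _ _ _ hu (is_form_contract xi hv)) => e; apply: h; rewrite addnS -e.
by rewrite mulr0 subrr addr0.
Qed.

Lemma is_form_schouten k l m u v : is_form k u -> is_form l v ->
  (k + l)%N = m.+1 -> is_form m (schouten u v).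
Proof.
move=> hu hv e; apply: pform_is_form.
  exact: pform_schouten (is_form_pform hu) (is_form_pform hv).
by move=> s h; apply: (schouten_deg hu hv); rewrite e => -[].
Qed.

Lemma sign_parity n : (-1) ^+ n = (-1) ^+ odd n :> Cinf M.
Proof. by rewrite signr_odd. Qed.

Lemma is_schouten_schouten : is_schouten pr LA schouten.
Proof.
split.
- exact: is_form_schouten.
- by move=> u v hu hv s; rewrite (schouten_deg hu hv).
- move=> k l a u u' v hu hu' hv s.
  exact: (congr1 (fun w => w s) (schouten_combl a (is_form_pform hu) (is_form_pform hu') (is_form_pform hv))).
- move=> k l u v hu hv s.
  rewrite (schouten_anti (is_form_pform hu) (is_form_pform hv)) /fscale.
  by rewrite (sign_parity (_ * _)) oddM /=.
- move=> x f s; have [hx hf] := (is_form_sec x, @is_form_fun _ _ B f).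
  case: s => [|xi s]; last by rewrite (schouten_deg hx hf).
  by rewrite /= dsecE subr0.
- move=> x y s; have [hx hy] := (is_form_sec x, is_form_sec y).
  case: s => [|xi [|eta s]]; [by rewrite (schouten_deg hx hy)| |
    by rewrite (schouten_deg hx hy)].
  (* The derivatives rho(x)<xi, y> and rho(y)<xi, x> cancel those in [dcov xi x y], which leaves
     <xi, [x, y]>. *)
  by rewrite /= /altsgn /contract /= !sharp_sec /dcov !dsecE; ring.
- move=> k l m u v w hu hv hw s.
  rewrite (schouten_wedge (is_form_pform hu) (is_form_pform hv) (is_form_pform hw)).
  by rewrite /comb (sign_parity (_ * _)) oddM /= addrC.
Qed.

End SchoutenBracket.

(** * Generators *)

Section Generators.
Context {R : realType} {M : manifold R} {A B : vbundle M}.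
Context (pr : perfect_pairing A B) (fr : framed pr).
Implicit Types (u v w : form B) (s : seq (sec B)) (xi eta : sec B) (x y z : sec A).
Implicit Types (f g : Cinf M) (b c : bool).
Local Notation pair := (pair_sec pr).

Lemma contract_sec xi x : contract xi (form_sec pr x) = form_fun (pair xi x).
Proof. by apply/funext => -[|? ?]. Qed.

Lemma form_fun0 : form_fun 0 = zform :> form B.
Proof. by apply/funext => -[]. Qed.

Lemma is_form0_fun u : is_form 0 u -> u = form_fun (u [::]).
Proof. by move=> hu; apply/funext => -[|xi s] //=; exact: (form_deg hu). Qed.

Lemma is_form1_sec u : is_form 1 u -> u = form_sec pr (sharp pr u).
Proof.
move=> hu; apply/funext => -[|xi [|eta s]] /=; try exact: (form_deg hu).
by rewrite (sharpE fr _ (is_form_pform hu)).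
Qed.

(** The first argument either goes to e_a, where the sum over the frame restores [cf_cut F *: xi],
    or is contracted into [v], where the induction hypothesis counts the remaining arguments.
    Counting arguments instead of the degree lets [v] be a mere [pform]. *)
Lemma euler_frame (F : cut_frame A B) b v s :
  (forall xi, cf_cut F *: xi = \sum_a pair xi (cf_vec F a) *: cf_cov F a) ->
  pform b v ->
  \sum_a wedge (form_sec pr (cf_vec F a)) (contract (cf_cov F a) v) s =
  (size s)%:R * cf_cut F * v s.
Proof.
move=> FB; elim: s b v => [|xi s IH] b v hv.
  by rewrite big1 ?mul0r // => a _; rewrite wedge_nil /= mul0r.
have vsum (I : finType) (f : I -> Cinf M) (z : I -> sec B) :
    v (\sum_a f a *: z a :: s) = \sum_a f a * v (z a :: s).
  elim/big_rec2: _ => [|a c x _ <-]; last exact: pform_linear0 hv.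
  by have := pform_linear0 (-1) 0 0 s hv; rewrite scaler0 addr0 mulN1r addNr.
have step a : wedge (form_sec pr (cf_vec F a)) (contract (cf_cov F a) v) (xi :: s) =
    pair xi (cf_vec F a) * v (cf_cov F a :: s) +
    wedge (form_sec pr (cf_vec F a)) (contract (cf_cov F a) (contract xi v)) s.
  rewrite (wedge_cons_par _ _ _ (pform_par (is_form_pform (is_form_sec pr _)))).
  rewrite contract_sec wedge_fun (contract_swap _ _ hv) wedge_scaler /fscale.
  by rewrite /contract /=; ring.
rewrite (eq_bigr _ (fun a _ => step a)) big_split /= (IH _ _ (pform_contract xi hv)).
rewrite -vsum -FB -[_ *: xi]addr0 (pform_linear0 _ _ _ _ hv).
have -> : v (0 :: s) = 0.
  by have := pform_linear0 (-1) 0 0 s hv; rewrite scaler0 addr0 mulN1r addNr.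
by rewrite /contract -natr1; ring.
Qed.

Lemma cinf_natr n p : (n%:R : Cinf M) p = n%:R.
Proof. by elim: n => // n IH; rewrite -natr1 -[RHS]natr1 -IH. Qed.

(** By Euler's identity a multiple of [v] is a sum of products of sections with contractions of [v],
    which [P] kills by induction on the degree. The factor, k+1 times the cut-off, is nonzero at the
    chosen point and passes through [P], since [P] kills functions. The boolean [e] is the parity of
    [P]. *)
Lemma derivation_generators (P : form B -> form B) (e : bool) :
  (forall k u v, is_form k u -> is_form k v -> P (comb 1 u v) = comb 1 (P u) (P v)) ->
  (forall k l u v, is_form k u -> is_form l v ->
    P (wedge u v) = comb ((-1) ^+ (e && odd k)) (wedge u (P v)) (wedge (P u) v)) ->
  (forall f, P (form_fun f) = zform) -> (forall x, P (form_sec pr x) = zform) ->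
  forall k v, is_form k v -> P v = zform.
Proof.
move=> Padd Pwedge Pfun Psec; elim=> [|k IH] v hv; first by rewrite (is_form0_fun hv).
apply/funext => s; apply: cinfE => p.
have [F [c0 _ FB]] := framed_sec fr p.
pose W a : form B := wedge (form_sec pr (cf_vec F a)) (contract (cf_cov F a) v).
have hW a : is_form k.+1 (W a).
  exact: is_form_wedge (is_form_sec pr _) (is_form_contract _ hv).
have PW a : P (W a) = zform.
  rewrite (Pwedge _ _ _ _ (is_form_sec pr _) (is_form_contract _ hv)) Psec.
  rewrite (IH _ (is_form_contract _ hv)) wedge0l wedge0r.
  by apply/funext => t; rewrite /comb mulr0 addr0.
have Psum (r : seq (cf_index F)) : P (fun t => \sum_(a <- r) W a t) = zform /\
    is_form k.+1 (fun t => \sum_(a <- r) W a t).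
  elim: r => [|a r [IHr hr]].
    rewrite (_ : (fun _ => _) = zform); last by apply/funext => t; rewrite big_nil.
    split; first by rewrite -[X in P X]form_fun0 Pfun.
    by apply: (pform_is_form (pform0 false)).
  rewrite (_ : (fun _ => _) = comb 1 (W a) (fun t => \sum_(a <- r) W a t)); last first.
    by apply/funext => t; rewrite big_cons /comb mul1r.
  split; last by apply: is_form_comb; [exact: hW|exact: hr].
  by rewrite (Padd _ _ _ (hW a) hr) PW IHr; apply/funext => t; rewrite /comb mulr0 addr0.
have E : (fun t => \sum_a W a t) = wedge (form_fun (k.+1%:R * cf_cut F)) v.
  apply/funext => t; rewrite (euler_frame _ FB (is_form_pform hv)) wedge_fun /fscale.
  by have [->//|/eqP h] := eqVneq (size t) k.+1; rewrite (form_deg hv h) !mulr0.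
have [] := Psum (index_enum _); rewrite E.
rewrite (Pwedge _ _ _ _ (@is_form_fun _ _ B _) hv) Pfun wedge0l wedge_fun andbF.
move=> /(congr1 (fun w => w s p)); rewrite /comb /fscale /zform addr0 expr0 mul1r => h.
have {h} /eqP : (k.+1%:R : Cinf M) p * cf_cut F p * P v s p = 0 := h.
by rewrite cinf_natr !mulf_eq0 pnatr_eq0 (negbTE c0) /= => /eqP.
Qed.

(** With its first argument fixed, [D] is a derivation in the second; symmetry up to a factor
    exchanges the two slots. *)
Lemma biderivation_generators (D : form B -> form B -> form B) (e : bool) :
  (forall k l u v w, is_form k u -> is_form l v -> is_form l w ->
    D u (comb 1 v w) = comb 1 (D u v) (D u w)) ->
  (forall k l m u v w, is_form k u -> is_form l v -> is_form m w ->
    D u (wedge v w) =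
    comb ((-1) ^+ ((e (+) odd k) && odd l)) (wedge v (D u w)) (wedge (D u v) w)) ->
  (forall k l u v, is_form k u -> is_form l v -> exists f, D u v = fscale f (D v u)) ->
  (forall f g, D (form_fun f) (form_fun g) = zform) ->
  (forall x f, D (form_sec pr x) (form_fun f) = zform) ->
  (forall x y, D (form_sec pr x) (form_sec pr y) = zform) ->
  forall k l u v, is_form k u -> is_form l v -> D u v = zform.
Proof.
move=> Dadd Dwedge Danti Dff Dxf Dxy k l u v hu hv.
have sym k' l' u' v' : is_form k' u' -> is_form l' v' -> D u' v' = zform -> D v' u' = zform.
  move=> hu' hv' h; have [f ->] := Danti _ _ _ _ hv' hu'; rewrite h.
  by apply/funext => s; rewrite /fscale mulr0.
have gen k' u' : is_form k' u' -> (forall f, D u' (form_fun f) = zform) ->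
    (forall x, D u' (form_sec pr x) = zform) -> forall l' v', is_form l' v' -> D u' v' = zform.
  move=> hu' hf hx; apply: (derivation_generators (e := e (+) odd k')) => //.
  - by move=> m v1 v2 h1 h2; exact: (Dadd _ _ _ _ _ hu' h1 h2).
  - by move=> m n v1 v2 h1 h2; exact: (Dwedge _ _ _ _ _ _ hu' h1 h2).
have hf f := @is_form_fun _ _ B f; have hx x := is_form_sec pr x.
apply: (gen k u hu _ _ l v hv) => [f|x].
  apply: (sym _ _ _ _ (hf f) hu); apply: (gen _ _ (hf f) _ _ _ _ hu) => // x.
  exact: (sym _ _ _ _ (hx x) (hf f)).
exact: (sym _ _ _ _ (hx x) hu (gen _ _ (hx x) (Dxf x) (Dxy x) _ _ hu)).
Qed.

End Generators.

(** * Uniqueness of the Schouten bracket *)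

Section Uniqueness.
Context {R : realType} {M : manifold R} {A B : vbundle M}.
Context (pr : perfect_pairing A B) (LA : lieAlgebroid A) (fr : framed pr).

Lemma schouten_unique br br' : is_schouten pr LA br -> is_schouten pr LA br' ->
  forall k l u v, is_form k u -> is_form l v -> br u v = br' u v.
Proof.
move=> h h'.
have lin_r b : is_schouten pr LA b -> forall k l u v w, is_form k u -> is_form l v ->
    is_form l w -> b u (comb 1 v w) = comb 1 (b u v) (b u w).
  move=> hb k l u v w hu hv hw; rewrite -cinf_cst1; apply/funext => s.
  rewrite (sch_anti hb hu (is_form_comb _ hv hw)) (sch_linear hb 1 hv hw hu) /form_lin /comb.
  by rewrite (sch_anti hb hu hv) (sch_anti hb hu hw) !cinf_cst1; ring.
pose D u v := comb (-1) (br' u v) (br u v).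
suff H : forall k l u v, is_form k u -> is_form l v -> D u v = zform.
  move=> k l u v hu hv; apply/funext => s.
  have := congr1 (fun w => w s) (H _ _ _ _ hu hv).
  by rewrite /D /comb /zform mulN1r addrC => /eqP; rewrite subr_eq0 => /eqP.
(* Bracketing with a form of degree k has degree k - 1, of parity opposite to k, hence
   [e := true]. *)
apply: (biderivation_generators fr (e := true)).
- move=> k l u v w hu hv hw; rewrite /D !(lin_r _ _ _ _ _ _ _ hu hv hw) //.
  by apply/funext => s; rewrite /comb; ring.
- move=> k l m u v w hu hv hw; apply/funext => s.
  rewrite {1}/D /comb (sch_leibniz h hu hv hw) (sch_leibniz h' hu hv hw).
  rewrite /D wedge_combl wedge_combr /comb (sign_parity (_ * _)) oddM /=; ring.
- move=> k l u v hu hv; exists (- (-1) ^+ (k.+1 * l.+1)); apply/funext => s.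
  by rewrite /D /comb /fscale (sch_anti h hu hv) (sch_anti h' hu hv); ring.
- move=> f g; have hf f := @is_form_fun _ _ B f; apply/funext => s.
  by rewrite /D /comb (sch_deg0 h) // (sch_deg0 h') // mulr0 addr0.
- move=> x f; apply/funext => s.
  by rewrite /D /comb (sch_fun h) (sch_fun h') mulN1r addNr.
- move=> x y; apply/funext => s.
  by rewrite /D /comb (sch_sec h) (sch_sec h') mulN1r addNr.
Qed.

End Uniqueness.

(** * The compatibility defect of a pair of algebroids *)

Section Compatibility.
Context {R : realType} {M : manifold R} {A B : vbundle M}.
Context (pr : perfect_pairing A B) (LA : lieAlgebroid A) (LB : lieAlgebroid B).
Context (fr : framed pr).
Implicit Types (u v w : form B) (s : seq (sec B)) (xi eta : sec B) (x y z : sec A).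
Implicit Types (f g : Cinf M) (b c : bool).
Local Notation pair := (pair_sec pr).
Local Notation rhoA := (anc_act (la_anchor LA)).
Local Notation rhoB := (anc_act (la_anchor LB)).
Local Notation d := (la_diff LB).
Local Notation br := (schouten pr LA).

(** [altsgn u] supplies the sign - (-1)^(k-1) = (-1)^k of the last term. *)
Definition defect u v : form B :=
  fun s => d (br u v) s - br (d u) v s + br (altsgn u) (d v) s.

Lemma defectE b c u v : pform b u -> pform c v -> defect u v =
  comb (-1) (br (d u) v) (comb ((-1) ^+ b) (br u (d v)) (d (br u v))).
Proof.
move=> hu hv; apply/funext => s; rewrite /defect (altsgn_par (pform_par hu)).
rewrite fscaleE sign_cst (schouten_combl LA fr _ hu (pform0 b) (pform_diff LB hv)).
rewrite (schouten0l LA fr (pform_diff LB hv)) -sign_cst /comb /zform; ring.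
Qed.

Lemma defect_anti b c u v : pform b u -> pform c v ->
  defect u v = fscale (- (-1) ^+ (~~ b && ~~ c)) (defect v u).
Proof.
move=> hu hv; rewrite (defectE hu hv) (defectE hv hu); apply/funext => s.
have [du dv] := (pform_diff LB hu, pform_diff LB hv).
rewrite (schouten_anti LA fr du hv) (schouten_anti LA fr hu dv) (schouten_anti LA fr hu hv).
rewrite diff_scale_signN /comb /fscale.
by case: b c {hu hv du dv} => [] [] /=; ring.
Qed.

(** As an operator on the second argument, the defect is the graded commutator of the derivations d
    and [u, -], minus the derivation [d u, -]. *)
Lemma defect_wedge b c e u v w : pform b u -> pform c v -> pform e w ->
  defect u (wedge v w) =
  comb ((-1) ^+ (b && c)) (wedge v (defect u w)) (wedge (defect u v) w).
Proof.
move=> hu hv hw; have hvw := pform_wedge hv hw.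
rewrite (defectE hu hvw) (defectE hu hv) (defectE hu hw).
have [[du dv] dw] := (pform_diff LB hu, pform_diff LB hv, pform_diff LB hw).
have [buv buw] := (pform_schouten LA fr hu hv, pform_schouten LA fr hu hw).
rewrite (schouten_wedge LA fr du hv hw) (schouten_wedge LA fr hu hv hw).
rewrite (diff_wedge LB hv hw) (schouten_combr_sign LA fr _ hu (pform_wedge hv dw)); last first.
  by have := pform_wedge dv hw; rewrite addbN addNb.
rewrite (schouten_wedge LA fr hu hv dw) (schouten_wedge LA fr hu dv hw).
rewrite diff_sign (diff_wedge LB hv buw) (diff_wedge LB buv hw).
rewrite !wedge_combl !wedge_combr; apply/funext => s; rewrite /comb.
by case: b c {hu hv hvw du dv buv buw} => [] [] /=; ring.
Qed.

Lemma defect_combr b c u v w : pform b u -> pform c v -> pform c w ->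
  defect u (comb 1 v w) = comb 1 (defect u v) (defect u w).
Proof.
move=> hu hv hw; apply/funext => s; rewrite (defectE hu (pform_comb 1 hv hw)).
rewrite (defectE hu hv) (defectE hu hw).
have E : comb 1 v w = comb ((-1) ^+ false) v w by rewrite expr0.
rewrite E diff_sign (schouten_combr_sign LA fr _ (pform_diff LB hu) hv hw).
rewrite (schouten_combr_sign LA fr _ hu (pform_diff LB hv) (pform_diff LB hw)).
rewrite (schouten_combr_sign LA fr _ hu hv hw) diff_sign /comb /=; ring.
Qed.

(** By uniqueness the bracket in the definition may be taken to be [schouten], whose defect is a
    biderivation. *)
Lemma lie_bialgebroid_generators : lie_bialgebroid pr LA LB <->
  [/\ forall f g, defect (form_fun f) (form_fun g) = zform,
      forall x f, defect (form_sec pr x) (form_fun f) = zform &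
      forall x y, defect (form_sec pr x) (form_sec pr y) = zform].
Proof.
have hf f := @is_form_fun _ _ B f; have hx x := is_form_sec pr x.
split=> [[br' hbr' H]|[Dff Dxf Dxy]].
  have E := schouten_unique fr hbr' (is_schouten_schouten LA fr).
  suff D0 k l u v : is_form k u -> is_form l v -> defect u v = zform.
    by split=> [f g|x f|x y]; apply: D0; (exact: hf || exact: hx).
  move=> hu hv; apply/funext => s; have := H _ _ _ _ hu hv s.
  rewrite (E _ _ _ _ hu hv) (E _ _ _ _ (is_form_diff LB hu) hv).
  rewrite (E _ _ _ _ hu (is_form_diff LB hv)) => e.
  rewrite (defectE (is_form_pform hu) (is_form_pform hv)) /comb e.
  by rewrite (sign_parity k.+1) /zform /=; case: (odd k) => /=; ring.
exists br; first exact: is_schouten_schouten.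
move=> k l u v hu hv s.
suff /(congr1 (fun w => w s)) : defect u v = zform.
  rewrite (defectE (is_form_pform hu) (is_form_pform hv)) /comb /zform (sign_parity k.+1).
  move=> e; apply/eqP; rewrite -subr_eq0 -e; apply/eqP => /=.
  by case: (odd k) => /=; ring.
(* On its second argument the defect acts with degree k, hence [e := false]. *)
apply: (biderivation_generators fr (e := false) (D := defect)) hu hv => //.
- move=> k' l' u' v' w' hu' hv' hw'.
  exact: defect_combr (is_form_pform hu') (is_form_pform hv') (is_form_pform hw').
- move=> k' l' m' u' v' w' hu' hv' hw'.
  exact: defect_wedge (is_form_pform hu') (is_form_pform hv') (is_form_pform hw').
- move=> k' l' u' v' hu' hv'; eexists.
  exact: defect_anti (is_form_pform hu') (is_form_pform hv').
Qed.

Definition dsecB f : sec A := sharp pr (d (form_fun f)).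

Lemma dsecBE f xi : pair xi (dsecB f) = rhoB xi f.
Proof.
have hf := is_form_pform (@is_form_fun _ _ B f).
rewrite (sharpE fr _ (pform_diff LB hf)) (diff_cons _ _ _ hf).
by rewrite contract_fun diff0 lie_nil subr0.
Qed.

Lemma diff_fun f : d (form_fun f) = form_sec pr (dsecB f).
Proof. exact: (is_form1_sec fr (is_form_diff LB (@is_form_fun _ _ B f))). Qed.

Lemma diff_sec x xi eta : d (form_sec pr x) [:: xi; eta] =
  rhoB xi (pair eta x) - rhoB eta (pair xi x) - pair (la_br LB xi eta) x.
Proof.
have hx := is_form_pform (is_form_sec pr x).
rewrite (diff_cons _ _ _ hx) (diff_cons _ _ _ (pform_contract xi hx)).
rewrite (contract_sec pr) contract_fun diff0 lie_nil /lie big_ord1 /= /zform.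
by rewrite expr0; ring.
Qed.

(** On generators this leaves only lists of length 0, 1 and 2 to be examined. *)
Lemma defect_deg k l u v s : is_form k u -> is_form l v ->
  size s <> (k + l)%N -> defect u v s = 0.
Proof.
move=> hu hv h; have [pu pv] := (is_form_pform hu, is_form_pform hv).
have [du dv] := (is_form_diff LB hu, is_form_diff LB hv).
rewrite (defectE pu pv) /comb (schouten_deg LA fr du hv) => [|/=]; last first.
  by rewrite addSn => -[]; exact: h.
rewrite (schouten_deg LA fr hu dv) => [|/=]; last first.
  by rewrite addnS => -[]; exact: h.
rewrite !mulr0 !add0r.
case: s h => [|xi s] h; first exact: diff_nil.
apply: (@diff_vanish _ _ _ LB (pred1 (size s))) => //= t /eqP ht.
by apply: (schouten_deg LA fr hu hv); rewrite ht.
Qed.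

(* [lxi] and [leta] are the Lie derivatives of [xi] and [eta] along [x]. *)
Lemma schouten_sec_form2 x P xi eta lxi leta : is_form 2 P ->
  (forall z, pair lxi z = rhoA x (pair xi z) - pair xi (la_br LA x z)) ->
  (forall z, pair leta z = rhoA x (pair eta z) - pair eta (la_br LA x z)) ->
  br (form_sec pr x) P [:: xi; eta] =
  rhoA x (P [:: xi; eta]) - P [:: lxi; eta] - P [:: xi; leta].
Proof.
move=> hP hxi heta; have hx := is_form_pform (is_form_sec pr x).
have pP := is_form_pform hP.
have cP zeta := is_form1_sec fr (is_form_contract zeta hP).
have sP zeta zeta' : pair zeta' (sharp pr (contract zeta P)) = P [:: zeta; zeta'].
  by rewrite (sharpE fr _ (pform_contract zeta pP)).
have swP zeta zeta' : P [:: zeta; zeta'] = - P [:: zeta'; zeta].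
  exact: (pform_swap [::] [::] _ _ pP).
(* After one recursion step, [<xi, x>, P] is a contraction of P with d<xi, x>, and [x, i_xi P] is a
   bracket of two sections, since i_xi P has degree 1. *)
rewrite (schouten_cons LA fr _ _ hx pP) (contract_sec pr) (schouten_fun LA fr _ pP).
rewrite (cP xi) (sch_sec (is_schouten_schouten LA fr)).
rewrite (tor_cons fr (altbil_dcov pr LA xi) _ _ hx pP) (contract_sec pr) /=.
rewrite (sharp_even fr (is_form_pform (@is_form_fun _ _ B _))).
rewrite (altbil0l (altbil_dcov pr LA xi)) (sharp_sec fr) /dcov.
rewrite /fscale /contract /=.
have -> : rhoA (sharp pr (contract eta P)) (pair xi x) = P [:: eta; dsec pr LA (pair xi x)].
  by rewrite -(dsecE LA fr) sP.
have -> : pair eta (la_br LA x (sharp pr (contract xi P))) =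
    rhoA x (P [:: xi; eta]) - P [:: xi; leta].
  by rewrite -!sP heta; ring.
have -> : pair xi (la_br LA x (sharp pr (contract eta P))) =
    rhoA x (P [:: eta; xi]) - P [:: eta; lxi].
  by rewrite -!sP hxi; ring.
rewrite sP (swP eta (dsec _ _ _)) (swP eta lxi).
by rewrite expr1; ring.
Qed.

Lemma defect_fun_fun f g : defect (form_fun f) (form_fun g) [::] =
  - rhoB (dsec pr LA g) f - rhoB (dsec pr LA f) g.
Proof.
have hf h := is_form_pform (@is_form_fun _ _ B h).
rewrite (defectE (hf f) (hf g)) /comb diff_nil !diff_fun.
by rewrite /= !dsecBE expr0; ring.
Qed.

Lemma defect_sec_fun x f xi : defect (form_sec pr x) (form_fun f) [:: xi] =
  rhoB (dsec pr LA f) (pair xi x) - pair (la_br LB (dsec pr LA f) xi) x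
  - pair xi (la_br LA x (dsecB f)).
Proof.
have hf := is_form_pform (@is_form_fun _ _ B f).
have hx := is_form_pform (is_form_sec pr x).
have hS := is_schouten_schouten LA fr.
rewrite (defectE hx hf) /comb diff_fun (sch_sec hS).
rewrite (_ : br (form_sec pr x) (form_fun f) = form_fun (rhoA x f)); last first.
  by apply/funext => s; exact: (sch_fun hS).
rewrite (schouten_anti LA fr (pform_diff LB hx) hf) (schouten_fun LA fr _ (pform_diff LB hx)).
rewrite diff_fun /fscale /contract diff_sec /= dsecBE (dsecE LA fr).
by rewrite expr1; ring.
Qed.

(** The bracket of a section with a form is a Lie derivative, so the defect is d[x, y] - L_x dy +
    L_y dx. The Lie derivatives of the arguments are parameters, so that explicit ones can be
    supplied. *)
Lemma defect_sec_sec x y xi eta lx_xi lx_eta ly_xi ly_eta :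
  (forall z, pair lx_xi z = rhoA x (pair xi z) - pair xi (la_br LA x z)) ->
  (forall z, pair lx_eta z = rhoA x (pair eta z) - pair eta (la_br LA x z)) ->
  (forall z, pair ly_xi z = rhoA y (pair xi z) - pair xi (la_br LA y z)) ->
  (forall z, pair ly_eta z = rhoA y (pair eta z) - pair eta (la_br LA y z)) ->
  let dx := d (form_sec pr x) in let dy := d (form_sec pr y) in
  defect (form_sec pr x) (form_sec pr y) [:: xi; eta] =
  d (form_sec pr (la_br LA x y)) [:: xi; eta]
  - (rhoA x (dy [:: xi; eta]) - dy [:: lx_xi; eta] - dy [:: xi; lx_eta])
  + (rhoA y (dx [:: xi; eta]) - dx [:: ly_xi; eta] - dx [:: xi; ly_eta]).
Proof.
move=> h1 h2 h3 h4 dx dy.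
have [hx hy] := (is_form_sec pr x, is_form_sec pr y).
have [px py] := (is_form_pform hx, is_form_pform hy).
rewrite (defectE px py) /comb (schouten_anti LA fr (pform_diff LB px) py) /fscale.
rewrite (schouten_sec_form2 (is_form_diff LB hx) h3 h4).
rewrite (schouten_sec_form2 (is_form_diff LB hy) h1 h2).
rewrite (_ : br (form_sec pr x) (form_sec pr y) = form_sec pr (la_br LA x y)); last first.
  by apply/funext => s; exact: (sch_sec (is_schouten_schouten LA fr)).
by rewrite /= -/dx -/dy expr0 expr1; ring.
Qed.

End Compatibility.

(** * Crossed modules *)

Section CrossedModules.
Context {R : realType} {M : manifold R} {theta g : vbundle M}.
Context {phi : bundle_map theta g}.
Context (X : crossed_module phi) (Y : crossed_module (neg_transpose phi)).
Context (act_g : sec g -> sec (dual theta) -> sec (dual theta)).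
Context (act_t : sec (dual theta) -> sec g -> sec g).
Context (dual_g : dual_actions (la_anchor (cm_algebroid X)) act_g (cm_act X)).
Context (dual_t : dual_actions (la_anchor (cm_algebroid Y)) (cm_act Y) act_t).
Context (fr : framed (dsum_pairing g theta)).
Implicit Types (x y : sec g) (u v : sec theta).
Implicit Types (t : sec (dual theta)) (c : sec (dual g)) (f h : Cinf M).
Local Notation "<< e | x >>" := (pair_sec (dual_pairing _) e x).
Local Notation rho := (anc_act (la_anchor (cm_algebroid X))).
Local Notation sigma := (anc_act (la_anchor (cm_algebroid Y))).
Local Notation actX := (cm_act X).
Local Notation actY := (cm_act Y).
Local Notation brX := (la_br (cm_algebroid X)).
Local Notation brY := (la_br (cm_algebroid Y)).
Local Notation LA := (assoc_algebroid X).
Local Notation LB := (assoc_algebroid Y).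
Local Notation pair := (pair_sec (dsum_pairing g theta)).

Lemma pair_dsum (b : sec (dsum (dual theta) (dual g))) (z : sec (dsum g theta)) :
  pair b z = << sec_snd b | sec_fst z >> + << sec_fst b | sec_snd z >>.
Proof. exact: cinfE. Qed.

Lemma sec_pairK (A E : vbundle M) (z : sec (dsum A E)) :
  sec_pair (sec_fst z) (sec_snd z) = z.
Proof. by apply: secE => p; rewrite /= -surjective_pairing. Qed.

Lemma sec_fst0 (A E : vbundle M) : sec_fst (0 : sec (dsum A E)) = 0.
Proof. exact: secE. Qed.

Lemma sec_snd0 (A E : vbundle M) : sec_snd (0 : sec (dsum A E)) = 0.
Proof. exact: secE. Qed.

Definition sec_simpl := (@sec_fst_pair R M, @sec_snd_pair R M, sec_fst0, sec_snd0).

(** Sections padded with a zero component are separated by the framed pairing of the direct sums. *)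
Lemma g_ext x y : (forall c, << c | x >> = << c | y >>) -> x = y.
Proof.
move=> H; have : sec_pair x (0 : sec theta) = sec_pair y 0.
  by apply: (pair_inj_r fr) => b; rewrite !pair_dsum !sec_simpl H.
by move/(congr1 (@sec_fst _ _ _ _)); rewrite !sec_fst_pair.
Qed.

Lemma dual_theta_ext t t' : (forall u, << t | u >> = << t' | u >>) -> t = t'.
Proof.
move=> H; have : sec_pair t (0 : sec (dual g)) = sec_pair t' 0.
  by apply: (pair_inj_l fr) => z; rewrite !pair_dsum !sec_simpl H.
by move/(congr1 (@sec_fst _ _ _ _)); rewrite !sec_fst_pair.
Qed.

Lemma dual_g_riesz (F : sec g -> Cinf M) :
  (forall f x y, F (f *: x + y) = f * F x + F y) ->
  exists c, forall x, << c | x >> = F x.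
Proof.
move=> Fl; have [f z z'|b Hb] := framed_riesz_l fr (F := fun z => F (sec_fst z)).
  by rewrite sec_fst_lin Fl.
exists (sec_snd b) => x; have := Hb (sec_pair x 0).
by rewrite pair_dsum !sec_simpl pair0r addr0.
Qed.

Lemma phiT_pair c u : << bmap_sec (neg_transpose phi) c | u >> = - << c | bmap_sec phi u >>.
Proof. by apply: cinfE => p /=; rewrite neg_transposeE. Qed.

Lemma rho_phi u f : rho (bmap_sec phi u) f = 0.
Proof. by rewrite (cm_morphism X).1 anc_act0. Qed.

Lemma sigma_phiT c f : sigma (bmap_sec (neg_transpose phi) c) f = 0.
Proof. by rewrite (cm_morphism Y).1 anc_act0. Qed.

Lemma act_g_pair x t u : << act_g x t | u >> = rho x << t | u >> - << t | actX x u >>.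
Proof. by rewrite dual_g addrK. Qed.

Lemma act_t_pair t c x : << c | act_t t x >> = sigma t << c | x >> - << actY t c | x >>.
Proof. by rewrite dual_t addrC addKr. Qed.

Lemma actX_linear_l f x y u : actX (f *: x + y) u = f *: actX x u + actX y u.
Proof. exact: rep_linear_l (cm_rep X) _ _ _ _. Qed.

Lemma actY_linear_l f t t' c : actY (f *: t + t') c = f *: actY t c + actY t' c.
Proof. exact: rep_linear_l (cm_rep Y) _ _ _ _. Qed.

Lemma act_g_rep : is_representation (cm_algebroid X) act_g.
Proof.
split.
- move=> f x y t; apply: dual_theta_ext => u.
  rewrite pair_linear_l !act_g_pair anc_act_linear_l actX_linear_l pair_linear_r; ring.
- move=> a x t t'; apply: dual_theta_ext => u.
  by rewrite pair_linear_l !act_g_pair !pair_linear_l anc_act_linear_r; ring.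
- move=> f x t; apply: dual_theta_ext => u.
  by rewrite pairDl !pairZl !act_g_pair !pairZl anc_actM; ring.
- move=> x y t; apply: dual_theta_ext => u.
  rewrite pairDl pairNl !act_g_pair (rep_flat (cm_rep X)) la_anchor_br.
  by rewrite pairDr pairNr !anc_actD !anc_actN; ring.
Qed.

Lemma act_t_rep : is_representation (cm_algebroid Y) act_t.
Proof.
split.
- move=> f t t' x; apply: g_ext => c.
  rewrite pair_linear_r !act_t_pair anc_act_linear_l actY_linear_l pair_linear_l; ring.
- move=> a t x x'; apply: g_ext => c.
  by rewrite pair_linear_r !act_t_pair !pair_linear_r anc_act_linear_r; ring.
- move=> f t x; apply: g_ext => c.
  by rewrite pairDr !pairZr !act_t_pair !pairZr anc_actM; ring.
- move=> t t' x; apply: g_ext => c.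
  rewrite pairDr pairNr !act_t_pair (rep_flat (cm_rep Y)) la_anchor_br.
  by rewrite pairDl pairNl !anc_actD !anc_actN; ring.
Qed.

(** * Failures of the matched pair conditions *)

Definition anchor_defect x t f :=
  rho x (sigma t f) - sigma t (rho x f) + rho (act_t t x) f - sigma (act_g x t) f.

Definition brQ_defect x t t' := act_g x (brY t t') -
  (brY (act_g x t) t' + brY t (act_g x t') + act_g (act_t t' x) t - act_g (act_t t x) t').

Definition brP_defect t x y := act_t t (brX x y) -
  (brX (act_t t x) y + brX x (act_t t y) + act_t (act_g y t) x - act_t (act_g x t) y).

Lemma matched_pair_defects :
  matched_pair (cm_algebroid X) (cm_algebroid Y) act_g act_t <->
  [/\ forall x t f, anchor_defect x t f = 0,
      forall x t t', brQ_defect x t t' = 0 &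
      forall t x y, brP_defect t x y = 0].
Proof.
split=> [[_ _ anch brQ brP]|[anch brQ brP]].
  split=> [x t f|x t t'|t x y].
  - by rewrite /anchor_defect anch; ring.
  - by rewrite /brQ_defect brQ subrr.
  - by rewrite /brP_defect brP subrr.
split.
- exact: act_g_rep.
- exact: act_t_rep.
- move=> x t f /=; apply/eqP; rewrite -subr_eq0 -(anch x t f); apply/eqP.
  by rewrite /anchor_defect; ring.
- by move=> x t t'; apply/eqP; rewrite -subr_eq0 -(brQ x t t').
- by move=> t x y; apply/eqP; rewrite -subr_eq0 -(brP t x y).
Qed.

(** The differential of the algebroid theta^* applied to [u], seen as a 1-form on it. *)
Definition diff_theta u t t' :=
  sigma t << t' | u >> - sigma t' << t | u >> - << brY t t' | u >>.

(* The expression Q of the header; P is [brP_defect]. *)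
Definition brQ_form x u t t' :=
  diff_theta (actX x u) t t' - rho x (diff_theta u t t')
  + diff_theta u (act_g x t) t' + diff_theta u t (act_g x t')
  + << t | actX (act_t t' x) u >> - << t' | actX (act_t t x) u >>.

Lemma brQ_formE x u t t' : brQ_form x u t t' = << brQ_defect x t t' | u >>
  - anchor_defect x t << t' | u >> + anchor_defect x t' << t | u >>.
Proof.
rewrite /brQ_form /brQ_defect /anchor_defect /diff_theta.
rewrite !(pairDl, pairNl, pairDr, pairNr) !act_g_pair !(anc_actD, anc_actN).
ring.
Qed.

(** By the Peiffer identity the bracket of [c] and [c'] is phi^T(c) |> c', so it merges with t |> c'
    into the action of t + phi^T(c). *)
Lemma diff_assoc x u t c t' c' :
  la_diff LB (form_sec (dsum_pairing g theta) (sec_pair x u))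
    [:: sec_pair t c; sec_pair t' c'] =
  << c' | act_t (t + bmap_sec (neg_transpose phi) c) x >> - << c | act_t t' x >>
  + diff_theta u t t'.
Proof.
rewrite diff_sec !fst_anchorE /= !pair_dsum /assoc_br !sec_simpl.
rewrite -(cm_peiffer Y) !(act_t_pair, pairDl, pairNl) !anc_actD /diff_theta.
have -> : actY (t + bmap_sec (neg_transpose phi) c) c' =
    actY t c' + actY (bmap_sec (neg_transpose phi) c) c'.
  by have := actY_linear_l 1 t (bmap_sec (neg_transpose phi) c) c'; rewrite !scale1r.
by rewrite anc_actDl sigma_phiT !pairDl; ring.
Qed.

Lemma act_tDl t t' x : act_t (t + t') x = act_t t x + act_t t' x.
Proof. by have := rep_linear_l act_t_rep 1 t t' x; rewrite !scale1r. Qed.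

Lemma act_tDr t x x' : act_t t (x + x') = act_t t x + act_t t x'.
Proof. by have := rep_linear_r act_t_rep 1 t x x'; rewrite cinf_cst1 !scale1r. Qed.

Lemma act_t0l x : act_t 0 x = 0.
Proof. by apply: (addrI (act_t 0 x)); rewrite -act_tDl !addr0. Qed.

Lemma act_tNl t x : act_t (- t) x = - act_t t x.
Proof. by apply/eqP; rewrite -addr_eq0 -act_tDl addNr act_t0l. Qed.

Lemma act_gDl x x' t : act_g (x + x') t = act_g x t + act_g x' t.
Proof. by have := rep_linear_l act_g_rep 1 x x' t; rewrite !scale1r. Qed.

Lemma act_gDr x t t' : act_g x (t + t') = act_g x t + act_g x t'.
Proof. by have := rep_linear_r act_g_rep 1 x t t'; rewrite cinf_cst1 !scale1r. Qed.

Lemma actXDl x x' u : actX (x + x') u = actX x u + actX x' u.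
Proof. by have := actX_linear_l 1 x x' u; rewrite !scale1r. Qed.

Lemma diff_theta_anti u t t' : diff_theta u t t' = - diff_theta u t' t.
Proof. by rewrite /diff_theta (la_anti _ t t') pairNl; ring. Qed.

Lemma diff_thetaDt u t1 t2 t' :
  diff_theta u (t1 + t2) t' = diff_theta u t1 t' + diff_theta u t2 t'.
Proof.
by rewrite /diff_theta la_brDl !pairDl anc_actDl anc_actD; ring.
Qed.

Lemma diff_thetaDt' u t t1 t2 :
  diff_theta u t (t1 + t2) = diff_theta u t t1 + diff_theta u t t2.
Proof.
rewrite diff_theta_anti diff_thetaDt (diff_theta_anti u t1) (diff_theta_anti u t2); ring.
Qed.

Lemma diff_thetaNt u t t' : diff_theta u (- t) t' = - diff_theta u t t'.
Proof.
have : diff_theta u (- t) t' + diff_theta u t t' = 0.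
  rewrite -diff_thetaDt addNr /diff_theta pair0l anc_act_f0 anc_act0l.
  have -> : brY 0 t' = 0.
    by apply: (addrI (brY 0 t')); rewrite -la_brDl !addr0.
  by rewrite pair0l !subr0.
by move/eqP; rewrite addr_eq0 => /eqP.
Qed.

Lemma diff_thetaD u u' t t' : diff_theta (u + u') t t' = diff_theta u t t' + diff_theta u' t t'.
Proof. by rewrite /diff_theta !pairDr !anc_actD; ring. Qed.

Lemma diff_thetaN u t t' : diff_theta (- u) t t' = - diff_theta u t t'.
Proof. by rewrite /diff_theta !pairNr !anc_actN; ring. Qed.

(* The covector field [k] = <t, - |> u> satisfies phi^T k = - phi(u) |> t, which
   transposes terms through the two Peiffer identities. *)
Lemma transposed_covector t u : exists k : sec (dual g),
  (forall x, << k | x >> = << t | actX x u >>) /\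
  bmap_sec (neg_transpose phi) k = - act_g (bmap_sec phi u) t.
Proof.
have [f x y|k Hk] := dual_g_riesz (F := fun x => << t | actX x u >>).
  by rewrite actX_linear_l pair_linear_r.
exists k; split=> //; apply: dual_theta_ext => v.
rewrite phiT_pair Hk pairNl act_g_pair rho_phi !(cm_peiffer X).
have -> : lab_sec (cm_bundle X) u v = - lab_sec (cm_bundle X) v u.
  exact: (la_anti (lab_algebroid (cm_bundle X))).
by rewrite pairNr; ring.
Qed.

(** For the covector field k = <t, - |> v>, equivariance of phi^T turns <t' |> k, phi(u)> into a
    bracket in theta^*, and phi^T(k) is - phi(v) |> t. *)
Lemma pair_act_phi t t' u v : << t | actX (act_t t' (bmap_sec phi u)) v >> =
  - diff_theta u (act_g (bmap_sec phi v) t) t'.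
Proof.
have [k [Hk kE]] := transposed_covector t v.
have e1 : << k | bmap_sec phi u >> = - << bmap_sec (neg_transpose phi) k | u >>.
  by rewrite phiT_pair opprK.
have e2 : << actY t' k | bmap_sec phi u >> =
    - << brY t' (bmap_sec (neg_transpose phi) k) | u >>.
  by rewrite -(cm_equivariant Y) phiT_pair opprK.
rewrite -diff_thetaNt -kE -Hk act_t_pair e1 e2.
by rewrite diff_theta_anti /diff_theta sigma_phiT anc_actN; ring.
Qed.

(** The Peiffer identity turns phi^T(c) |> k into the bracket [c, k], whose antisymmetry exchanges
    [c] and [k]. *)
Lemma pair_act_phiT c t x u :
  << t | actX (act_t (bmap_sec (neg_transpose phi) c) x) u >> =
  << c | act_t (act_g (bmap_sec phi u) t) x >>.
Proof.
have [k [Hk kE]] := transposed_covector t u.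
rewrite -Hk -[act_g _ _]opprK -kE act_tNl pairNr !act_t_pair !sigma_phiT !(cm_peiffer Y).
have -> : lab_sec (cm_bundle Y) k c = - lab_sec (cm_bundle Y) c k.
  exact: (la_anti (lab_algebroid (cm_bundle Y))).
by rewrite pairNl; ring.
Qed.

(** [l] is the second component of the Lie derivative of (t, c) along x + u. The middle clause says
    that t + phi^T(c), the combination occurring in [diff_assoc], moves by [act_g x] alone. *)
Lemma lie_covector x u t c : exists l : sec (dual g),
  [/\ forall y, << l | y >> = rho x << c | y >> - << c | brX x y >> + << t | actX y u >>,
      act_g (x + bmap_sec phi u) t + bmap_sec (neg_transpose phi) l =
      act_g x (t + bmap_sec (neg_transpose phi) c) &
      forall z, pair (sec_pair (act_g (x + bmap_sec phi u) t) l) z =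
        anc_act (la_anchor LA) (sec_pair x u) (pair (sec_pair t c) z)
        - pair (sec_pair t c) (la_br LA (sec_pair x u) z)].
Proof.
have [f y y'|l Hl] := dual_g_riesz (F := fun y =>
    rho x << c | y >> - << c | brX x y >> + << t | actX y u >>).
  rewrite actX_linear_l la_br_linear_r !pair_linear_r anc_actD anc_actM; ring.
have anti v w : lab_sec (cm_bundle X) v w = - lab_sec (cm_bundle X) w v.
  exact: (la_anti (lab_algebroid (cm_bundle X))).
exists l; split=> //.
  apply: dual_theta_ext => v; rewrite !pairDl phiT_pair Hl act_gDr act_gDl !pairDl.
  rewrite -(cm_equivariant X) !act_g_pair rho_phi !phiT_pair !(cm_peiffer X).
  by rewrite (anti v u) pairNr anc_actN; ring.
move=> z; rewrite fst_anchorE !pair_dsum /= /assoc_br !sec_simpl Hl act_g_pair.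
rewrite actXDl (cm_peiffer X) !pairDr pairNr anc_actDl rho_phi anc_actD; ring.
Qed.

Lemma defect_assoc_sec x1 u1 x2 u2 t c t' c' :
  let b := sec_pair t c in let b' := sec_pair t' c' in
  defect (dsum_pairing g theta) LA LB
    (form_sec (dsum_pairing g theta) (sec_pair x1 u1))
    (form_sec (dsum_pairing g theta) (sec_pair x2 u2)) [:: b; b'] =
  << c' | brP_defect (t + bmap_sec (neg_transpose phi) c) x1 x2 >>
  - << c | brP_defect t' x1 x2 >>
  + brQ_form (x1 + bmap_sec phi u1) u2 t t' - brQ_form x2 u1 t t'.
Proof.
move=> b b'; have [c1 [c1E T1 L1]] := lie_covector x1 u1 t c.
have [c1' [c1'E T1' L1']] := lie_covector x1 u1 t' c'.
have [c2 [c2E T2 L2]] := lie_covector x2 u2 t c.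
have [c2' [c2'E T2' L2']] := lie_covector x2 u2 t' c'.
rewrite (defect_sec_sec LB fr L1 L1' L2 L2') !fst_anchorE !sec_fst_pair.
have -> : la_br LA (sec_pair x1 u1) (sec_pair x2 u2) = sec_pair (brX x1 x2)
    (lab_sec (cm_bundle X) u1 u2 + actX x1 u2 - actX x2 u1).
  by rewrite /= /assoc_br !sec_simpl.
rewrite !diff_assoc T1 T2 c1E c1'E c2E c2'E.
rewrite /brQ_form /brP_defect !act_gDr !actXDl !(cm_peiffer X) !act_gDl !act_tDl !act_tDr.
rewrite !actXDl !la_brDl !la_brDr !diff_thetaDt !diff_thetaDt' !diff_thetaD !diff_thetaN.
(* The Lie derivatives and [brP_defect] write these brackets in opposite orders. *)
rewrite (la_anti _ (act_t t x1)) (la_anti _ (act_t t' x1)).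
rewrite (la_anti _ (act_t (bmap_sec _ c) x1)).
rewrite !(pairDr, pairNr) !(anc_actDl, rho_phi) !(anc_actD, anc_actN).
(* The terms in which [phi] or phi^T meets both actions are transposed to a common form, where they
   cancel. *)
rewrite !pair_act_phi !pair_act_phiT.
rewrite (diff_theta_anti _ (act_g (bmap_sec phi u2) t') t).
ring.
Qed.

(** As theta and g^* have zero anchor, df lies in g^* and d_* f in theta. They are killed by phi^T
    and phi respectively, because the anchors vanish on the images of these maps; what remains is
    the anchor condition. *)
Lemma defect_assoc_fun x u t c f :
  defect (dsum_pairing g theta) LA LB
    (form_sec (dsum_pairing g theta) (sec_pair x u)) (form_fun f)
    [:: sec_pair t c] = - anchor_defect x t f.
Proof.
rewrite (defect_sec_fun LA LB fr) fst_anchorE.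
set a := dsec _ _ f; set h := dsecB _ _ f.
have aE z : << sec_snd a | sec_fst z >> + << sec_fst a | sec_snd z >> = rho (sec_fst z) f.
  by rewrite -pair_dsum /a (dsecE LA fr) fst_anchorE.
have hE b : << sec_snd b | sec_fst h >> + << sec_fst b | sec_snd h >> = sigma (sec_fst b) f.
  by rewrite -pair_dsum /h (dsecBE LB fr) fst_anchorE.
have a0 : sec_fst a = 0.
  apply: dual_theta_ext => v; have := aE (sec_pair 0 v).
  by rewrite !sec_simpl pair0r add0r anc_act0l pair0l.
have h0 : sec_fst h = 0.
  apply: g_ext => k; have := hE (sec_pair 0 k).
  by rewrite !sec_simpl pair0l addr0 anc_act0l pair0r.
have {}aE y : << sec_snd a | y >> = rho y f.
  by have := aE (sec_pair y 0); rewrite !sec_simpl a0 pair0l addr0.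
have {}hE t' : << t' | sec_snd h >> = sigma t' f.
  by have := hE (sec_pair t' 0); rewrite !sec_simpl h0 pair0r add0r.
have phiTa : bmap_sec (neg_transpose phi) (sec_snd a) = 0.
  by apply: dual_theta_ext => v; rewrite phiT_pair aE rho_phi pair0l oppr0.
have phih : bmap_sec phi (sec_snd h) = 0.
  apply: g_ext => k; rewrite pair0r -[LHS]opprK -phiT_pair hE sigma_phiT oppr0 //.
have actX0 v : actX 0 v = 0.
  by apply: (addrI (actX 0 v)); rewrite -actXDl !addr0.
have actY0 k : actY 0 k = 0.
  apply: (addrI (actY 0 k)); have := actY_linear_l 1 0 0 k.
  by rewrite !scale1r !addr0 => <-.
have br0 : brX x 0 = 0 by apply: (addrI (brX x 0)); rewrite -la_brDr !addr0.
have br0' : brY 0 t = 0 by apply: (addrI (brY 0 t)); rewrite -la_brDl !addr0.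
have labh : lab_sec (cm_bundle X) u (sec_snd h) = 0.
  have -> : lab_sec (cm_bundle X) u (sec_snd h) = - lab_sec (cm_bundle X) (sec_snd h) u.
    exact: (la_anti (lab_algebroid (cm_bundle X))).
  by rewrite -(cm_peiffer X) phih actX0 oppr0.
rewrite !pair_dsum /= /assoc_br !sec_simpl a0 h0 anc_act0l br0 br0' labh.
rewrite -(cm_peiffer Y) phiTa actX0 actY0 !(pair0l, pair0r) !add0r !subr0 pairNl.
have -> : << actY t (sec_snd a) | x >> = sigma t (rho x f) - rho (act_t t x) f.
  by rewrite -!aE act_t_pair; ring.
have -> : << t | actX x (sec_snd h) >> = rho x (sigma t f) - sigma (act_g x t) f.
  by rewrite -!hE act_g_pair; ring.
by rewrite /anchor_defect; ring.
Qed.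

(** The differential of a function lies in g^*, where the anchor of the dual algebroid vanishes. *)
Lemma defect_assoc_fun_fun f h :
  defect (dsum_pairing g theta) LA LB (form_fun f) (form_fun h) [::] = 0.
Proof.
have D0 k : sec_fst (dsec (dsum_pairing g theta) LA k) = 0.
  apply: dual_theta_ext => v; have := dsecE LA fr k (sec_pair 0 v).
  by rewrite fst_anchorE pair_dsum !sec_simpl pair0r add0r anc_act0l pair0l.
by rewrite (defect_fun_fun LA LB fr) !fst_anchorE !D0 !anc_act0l oppr0 addr0.
Qed.

Lemma crossed_module_matched_pair :
  lie_bialgebroid_crossed_module X Y <->
  matched_pair (cm_algebroid X) (cm_algebroid Y) act_g act_t.
Proof.
rewrite matched_pair_defects.
apply: (iff_trans (lie_bialgebroid_generators LA LB fr)).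
have phi0 : bmap_sec phi 0 = 0 by apply: secE => p /=; rewrite linear0.
have phiT0 : bmap_sec (neg_transpose phi) 0 = 0 by apply: secE => p /=; rewrite linear0.
have hf k := @is_form_fun _ _ (dsum (dual theta) (dual g)) k.
have hx z := is_form_sec (dsum_pairing g theta) z.
split=> [[_ Dxf Dxy]|[anch brQ brP]].
  have anch x t f : anchor_defect x t f = 0.
    rewrite -[LHS]opprK -(defect_assoc_fun x 0 t 0 f) Dxf; exact: oppr0.
  split=> // [x t t'|t x y].
    apply: dual_theta_ext => u; rewrite pair0l.
    (* These zeros leave only Q(x, u; t, t'), in which the anchor terms are already known to
       vanish. *)
    have := defect_assoc_sec x 0 0 u t 0 t' 0.
    rewrite /= Dxy !pair0l phi0 addr0 !brQ_formE !anch !pair0r /zform => ->.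
    ring.
  apply: g_ext => c; rewrite pair0r.
  (* Zero theta components and the arguments (t, 0) and (0, c) leave only <c, P(t; x, y)>. *)
  have := defect_assoc_sec x 0 y 0 t 0 0 c.
  rewrite /= Dxy phiT0 !addr0 !pair0l !brQ_formE !anch !pair0r /zform => ->.
  ring.
split=> [f h|z f|z w]; apply/funext => s.
- have [s0|s0] := eqVneq (size s) 0%N.
    by rewrite (size0nil s0) defect_assoc_fun_fun.
  by rewrite (defect_deg LA LB fr (hf f) (hf h)) //; apply/eqP.
- have [|s1] := eqVneq (size s) 1%N; last first.
    by rewrite (defect_deg LA LB fr (hx z) (hf f)) //; apply/eqP.
  case: s => [|b []] // _.
  by rewrite -(sec_pairK z) -(sec_pairK b) defect_assoc_fun anch oppr0.
- have [|s2] := eqVneq (size s) 2%N; last first.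
    by rewrite (defect_deg LA LB fr (hx z) (hx w)) //; apply/eqP.
  case: s => [|b [|b' []]] // _.
  rewrite -(sec_pairK z) -(sec_pairK w) -(sec_pairK b) -(sec_pairK b').
  rewrite defect_assoc_sec !brP !pair0r !brQ_formE !brQ !anch !pair0l.
  by rewrite /zform; ring.
Qed.

End CrossedModules.

Theorem theorem3p2 (R : realType) (M : manifold R) (theta g : vbundle M)
    (phi : bundle_map theta g)
    (X : crossed_module phi) (Y : crossed_module (neg_transpose phi))
    (act_g : sec g -> sec (dual theta) -> sec (dual theta))
    (act_thetad : sec (dual theta) -> sec g -> sec g) :
  dual_actions (la_anchor (cm_algebroid X)) act_g (cm_act X) ->
  dual_actions (la_anchor (cm_algebroid Y)) (cm_act Y) act_thetad ->
  (lie_bialgebroid_crossed_module X Y <->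
   matched_pair (cm_algebroid X) (cm_algebroid Y) act_g act_thetad).
Proof.
by move=> dual_g dual_t; apply: crossed_module_matched_pair => //; exact: framed_dsum.
Qed.
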